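(* Let $X=\{X(t):t\in\mathbb{R}\}$ be a spectrally positive Lévy process (no negative jumps, and not a subordinator) with $X(0)=0$ and $\mathbb{E}X(1)=0$, let $Y(t)=X(t)-t$ and $\hat Y=-Y$, let $\hat\psi(x)=\log\mathbb{E}e^{x\hat Y(1)}$ for $x\ge 0$, and let $\hat\Phi(q)=\sup\{\theta\ge 0:\hat\psi(\theta)=q\}$ for $q\ge0$. Let $M(t)=\inf_{s\in[0,t]}Q(s)$, where $Q$ is the stationary reflected process $Q(t)=\sup_{s\le t}(Y(t)-Y(s))$, and for $q>0$ let $\boldsymbol{e}_q$ be an exponentially distributed random variable with parameter $q$, independent of $X$. Then for all $x,q>0$ with $x\ne\hat\Phi(q)$, \[ \mathbb{E}\,e^{-xM(\boldsymbol{e}_q)}=\frac{\hat\psi'(0)\,x}{\hat\psi(x)}\cdot\frac{\hat\Phi(q)}{q}\cdot\frac{q-\hat\psi(x)}{\hat\Phi(q)-x}, \] and for $q>0$ and $x=\hat\Phi(q)$, \[ \mathbb{E}\,e^{-xM(\boldsymbol{e}_q)}=\frac{\hat\psi'(0)\,\hat\Phi(q)^2\,\hat\psi'(\hat\Phi(q))}{q^2}. \]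
   Context: A Lévy process indexed by $\mathbb{R}$ is a càdlàg process with stationary independent increments and $X(0)=0$. A subordinator is a Lévy process with increasing paths. The supremum defining $Q(t)$ is over all real $s\le t$; $Q=\{Q(t):t\ge0\}$ is a stationary process (the reflection of $Y$ at $0$). The variable $\boldsymbol{e}_q$ has mean $1/q$. For a process $X$ without negative jumps, $\hat\psi(x)$ is finite for every $x\ge0$; $\hat\psi'(0)$ denotes the right derivative at $0$. *)

(* Defs.v *)
From HB Require Import structures.
From mathcomp Require Import all_boot all_order all_algebra.
From mathcomp Require Import all_classical all_reals all_analysis.

Set Implicit Arguments.
Unset Strict Implicit.
Unset Printing Implicit Defensive.

Import Order.TTheory GRing.Theory Num.Theory.
Import numFieldNormedType.Exports.

Local Open Scope classical_set_scope.
Local Open Scope ring_scope.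

Definition cadlag (R : realType) (f : R -> R) : Prop :=
  forall t : R, f s @[s --> t^'+] --> f t /\ cvg (f s @[s --> t^'-]).

Definition no_negative_jumps (R : realType) (f : R -> R) : Prop :=
  forall t : R, lim (f s @[s --> t^'-]) <= f t.

(* Taking some of the A i to be the whole line gives the product rule for
   every subfamily. *)
Definition mutually_independent d (T : measurableType d) (R : realType)
    (P : probability T R) (n : nat) (Z : 'I_n -> T -> R) : Prop :=
  forall A : 'I_n -> set R, (forall i, measurable (A i)) ->
    P (\bigcap_i (Z i @^-1` A i)) = (\prod_(i < n) P (Z i @^-1` A i))%E.

Definition independent_increments d (T : measurableType d) (R : realType)
    (P : probability T R) (X : R -> {RV P >-> R}) : Prop :=
  forall (n : nat) (t : nat -> R),
    (forall i j : nat, (i <= j)%N -> t i <= t j) ->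
    mutually_independent P (fun (i : 'I_n) w => X (t i.+1) w - X (t i) w).

(* Laws are compared on Borel sets only: the value of P on non-measurable
   sets carries no information. *)
Definition stationary_increments d (T : measurableType d) (R : realType)
    (P : probability T R) (X : R -> {RV P >-> R}) : Prop :=
  forall (s t h : R) (A : set R), s <= t -> measurable A ->
    P [set w | A (X (t + h) w - X (s + h) w)] = P [set w | A (X t w - X s w)].

Definition levy_process d (T : measurableType d) (R : realType)
    (P : probability T R) (X : R -> {RV P >-> R}) : Prop :=
  [/\ {ae P, forall w, X 0 w = 0},
      {ae P, forall w, cadlag (fun t => X t w)},
      independent_increments X
    & stationary_increments X].

Definition subordinator d (T : measurableType d) (R : realType)
    (P : probability T R) (X : R -> {RV P >-> R}) : Prop :=
  levy_process X /\
  {ae P, forall w, forall s t : R, s <= t -> X s w <= X t w}.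

Definition spectrally_positive d (T : measurableType d) (R : realType)
    (P : probability T R) (X : R -> {RV P >-> R}) : Prop :=
  [/\ levy_process X,
      {ae P, forall w, no_negative_jumps (fun t => X t w)}
    & ~ subordinator X].

Definition sigma_of_process d (T : measurableType d) (R : realType)
    (P : probability T R) (X : R -> {RV P >-> R}) : set (set T) :=
  <<s \bigcup_(t : R) preimage_set_system setT (X t) measurable >>.

Definition independent_of_process d (T : measurableType d) (R : realType)
    (P : probability T R) (e : {RV P >-> R}) (X : R -> {RV P >-> R}) : Prop :=
  forall (A : set T) (B : set R), sigma_of_process X A -> measurable B ->
    P (A `&` e @^-1` B) = (P A * P (e @^-1` B))%E.

Definition exponentially_distributed d (T : measurableType d) (R : realType)
    (P : probability T R) (e : {RV P >-> R}) (q : R) : Prop :=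
  forall B : set R, measurable B -> distribution P e B = exponential_prob q B.

Definition Y_of d (T : measurableType d) (R : realType) (P : probability T R)
    (X : R -> {RV P >-> R}) (t : R) (w : T) : R := X t w - t.

(* When X has no negative jumps, this expectation is finite and positive at
   every x >= 0. *)
Definition psi_hat d (T : measurableType d) (R : realType)
    (P : probability T R) (X : R -> {RV P >-> R}) (x : R) : R :=
  ln (fine 'E_P[fun w => expR (x * - Y_of X 1 w)]%E).

Definition Phi_hat d (T : measurableType d) (R : realType)
    (P : probability T R) (X : R -> {RV P >-> R}) (q : R) : R :=
  sup [set theta : R | 0 <= theta /\ psi_hat X theta = q].

Definition right_derivative (R : realType) (f : R -> R) (a : R) : R :=
  lim ((f (a + h) - f a) / h @[h --> 0^'+]).

(* Q_of and M_of take values in the extended reals, since the supremum over all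
   s <= t may be infinite on a null set. *)
Definition Q_of d (T : measurableType d) (R : realType) (P : probability T R)
    (X : R -> {RV P >-> R}) (t : R) (w : T) : \bar R :=
  ereal_sup [set (Y_of X t w - Y_of X s w)%:E | s in [set s : R | s <= t]].

Definition M_of d (T : measurableType d) (R : realType) (P : probability T R)
    (X : R -> {RV P >-> R}) (t : R) (w : T) : \bar R :=
  ereal_inf [set Q_of X s w | s in [set s : R | 0 <= s <= t]].

Definition laplace_M d (T : measurableType d) (R : realType)
    (P : probability T R) (X : R -> {RV P >-> R}) (e : {RV P >-> R}) (x : R) :
    \bar R :=
  (\int[P]_w expeR (- (x%:E * M_of X (e w) w)))%E.

(* Main.v *)
(* Put S = sup_[0,e] (-Y).  Then M(e) = max(Q(0) - S, 0), where Q(0) is a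
   function of the past of X, hence independent of S.

   S is exponential with rate Phi: optional stopping for exp(- q t - Phi Y(t)),
   stopped when - Y passes a level, where the overshoot over a dyadic grid is
   negligible.  Indeed a path of - Y has no positive jumps, so its increments
   over a grid of mesh 2^-n are eventually at most eps, which by independence
   forces 2^n P(increment > eps) -> 0.

   Q(0) has Laplace transform x / psi(x).  On the grid Q(0) is the limit of the
   Lindley recursion V <- max(0, V - Z), and E exp(- x V) evolves by
   (E exp(x Z) - 1) E exp(- x V) minus an excess term E (exp(x (Z - V)^+) - 1);
   the excess is asymptotically linear in x, and psi'(0) = 1 fixes the slope.

   The two laws give the formula for x <> Phi.  Both sides are continuous at
   x = Phi, and this also yields the derivative of psi at Phi. *)

Require Import Defs.
From mathcomp Require Import all_boot all_order all_algebra.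
From mathcomp Require Import all_classical all_reals all_analysis.
From mathcomp Require Import measurable_realfun.
From mathcomp Require Import ring lra.
Import Order.TTheory GRing.Theory Num.Theory.
Import numFieldNormedType.Exports.
Local Open Scope classical_set_scope.
Local Open Scope ring_scope.
Set Implicit Arguments.
Unset Strict Implicit.

(** * Independence *)

(** Two facts usually taken for granted shape the proof. One is that [E exp(x Yhat(1))] is finite
    for all [x >= 0]: only path regularity is available, so an exponential tail is extracted from a
    reflected walk that is reset by steps above 1/2. Its tail is submultiplicative, with a ratio
    bounded by the probability of an oscillation on [[0, 2^-m]]; right-continuity at 0 makes this
    ratio small enough to beat any prescribed exponential rate. The other is measurability of
    [M_of], which is avoided by squeezing the integral between measurable envelopes that differ only
    on a null set.

    Mean zero enters through [exp(- x X) >= 1 - x X], which gives [psi x >= x]: hence psi is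
    strictly increasing on the half-line, reaches every level q, and has slope at least 1 at 0.

    Laws are computed on grids of mesh 2^-n and horizon n, where the steps are i.i.d.; paths enter
    through almost sure limits. The tail of the grid supremum is controlled uniformly in the level,
    since it is later integrated against a kernel of mass at most 1. *)

Section sigma_independence.
Context (d : measure_display) (T : measurableType d) (R : realType).
Context (P : probability T R).

(** As functions of [A], both sides are finite measures: [P] restricted to [E], and [P] scaled by
    [P E]. Agreement on a pi-system containing the whole space extends to the generated
    sigma-algebra. *)
Lemma indep_pi1 (G : set (set T)) (E : set T) :
  G `<=` measurable -> setI_closed G -> G setT -> measurable E ->
  (forall A, G A -> P (A `&` E) = (P A * P E)%E) ->
  forall A, <<s G >> A -> P (A `&` E) = (P A * P E)%E.
Proof.
move=> Gm GI GT mE GE A sA.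
have PE0 : 0 <= fine (P E) by rewrite fine_ge0.
pose m2 := mscale (NngNum PE0) P.
have m2E B : m2 B = (P B * P E)%E.
  by rewrite /m2 /mscale /= fineK ?fin_num_measure// muleC.
have -> : P (A `&` E) = mrestr P mE A by [].
rewrite -m2E.
apply: (g_sigma_algebra_measure_unique G Gm (fun=> setT)) sA => //=.
- by rewrite bigcup_const.
- by move=> B GB; rewrite -/m2 m2E /mrestr GE.
- by move=> _; rewrite /mrestr setTI (le_lt_trans (probability_le1 P mE))// ltry.
Qed.

Lemma indep_pi (G1 G2 : set (set T)) :
  G1 `<=` measurable -> G2 `<=` measurable ->
  setI_closed G1 -> setI_closed G2 -> G1 setT -> G2 setT ->
  (forall A B, G1 A -> G2 B -> P (A `&` B) = (P A * P B)%E) ->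
  forall A B, <<s G1 >> A -> <<s G2 >> B -> P (A `&` B) = (P A * P B)%E.
Proof.
move=> G1m G2m G1I G2I G1T G2T G12 A B sA sB.
have mA : measurable A.
  by apply: (smallest_sub (@sigma_algebra_measurable _ T) G1m).
rewrite setIC muleC; apply: (indep_pi1 (G := G2)) => // C G2C.
rewrite setIC muleC; apply: (indep_pi1 (G := G1)) => //; first exact: G2m.
by move=> D G1D; exact: G12.
Qed.

Definition indep_seq (Z : nat -> T -> R) :=
  forall n (A : nat -> set R), (forall i, measurable (A i)) ->
    P (\bigcap_(i in `I_n) Z i @^-1` A i) =
    (\prod_(i < n) P (Z i @^-1` A i))%E.

Definition sigma_on (Z : nat -> T -> R) (D : set nat) : set (set T) :=
  <<s \bigcup_(i in D) preimage_set_system setT (Z i) measurable >>.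

(** A pi-system generating [sigma_on Z D]: finite rectangles that constrain only coordinates in [D].
    Padding with [setT] lets two rectangles be written with the same length. *)
Let rect (Z : nat -> T -> R) (D : set nat) : set (set T) :=
  [set B | exists n, exists2 A : nat -> set R,
     (forall i, measurable (A i)) /\ (forall i, ~ D i -> A i = setT) &
     B = \bigcap_(i in `I_n) Z i @^-1` A i].

Let rect_widen (Z : nat -> T -> R) (D : set nat) B :
  rect Z D B -> exists n0, forall n, (n0 <= n)%N -> exists2 A : nat -> set R,
     (forall i, measurable (A i)) /\ (forall i, ~ D i -> A i = setT) &
     B = \bigcap_(i in `I_n) Z i @^-1` A i.
Proof.
move=> [n0 [A [mA AD] ->]]; exists n0 => n n0n.
exists (fun i => if (i < n0)%N then A i else setT).
  split=> i; first by case: ifP.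
  by move=> nDi; case: ifP => // _; exact: AD.
apply/seteqP; split=> w /= h i /= ilt.
  by case: ifPn => // ilt0; exact: h.
by move: (h i (leq_trans ilt n0n)) => /=; rewrite ilt.
Qed.

Let rectI (Z : nat -> T -> R) (D : set nat) : setI_closed (rect Z D).
Proof.
move=> B C /rect_widen[n hB] /rect_widen[m hC].
have [A [mA AD] eB] := hB _ (leq_maxl n m).
have [A' [mA' AD'] eC] := hC _ (leq_maxr n m).
exists (maxn n m), (fun i => A i `&` A' i).
  split=> i; first exact: measurableI.
  by move=> nDi; rewrite AD// AD'// setTI.
rewrite eB eC; apply/seteqP; split=> w /=.
  by move=> [h1 h2] i ilt; split; [exact: h1|exact: h2].
by move=> h; split=> i ilt; have [] := h i ilt.
Qed.

Let rectT (Z : nat -> T -> R) (D : set nat) : rect Z D setT.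
Proof.
exists 0%N, (fun=> setT) => //.
by apply/seteqP; split.
Qed.

Let sigma_rect (Z : nat -> T -> R) (D : set nat) :
  sigma_on Z D `<=` <<s rect Z D >>.
Proof.
apply: smallest_sub; first exact: smallest_sigma_algebra.
move=> B [i Di [A mA] <-]; apply: sub_sigma_algebra.
exists i.+1, (fun j => if j == i then A else setT).
  split=> j; first by case: ifP.
  by move=> nDj; case: eqP => // ji; rewrite ji in nDj.
rewrite setTI; apply/seteqP; split=> w /=.
  by move=> Aw j _; case: eqP => // ->.
by move=> /(_ i (ltnSn i)) /=; rewrite eqxx.
Qed.

(** For rectangles of equal length over disjoint index sets, each coordinate is constrained by at
    most one of the two, so the product given by [indep_seq] splits factor by factor. The pi-system
    argument does the rest. *)
Lemma indep_sigma (Z : nat -> T -> R) (D1 D2 : set nat) :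
  (forall i, measurable_fun setT (Z i)) -> indep_seq Z ->
  D1 `&` D2 = set0 ->
  forall A B, sigma_on Z D1 A -> sigma_on Z D2 B ->
    P (A `&` B) = (P A * P B)%E.
Proof.
move=> mZ iZ D12 A B sA sB.
have rm D : rect Z D `<=` measurable.
  move=> C [n [E [mE _] ->]].
  apply: bigcap_measurableType => i _.
  by rewrite -[_ @^-1` _]setTI; exact: mZ.
apply: (indep_pi (G1 := rect Z D1) (G2 := rect Z D2)) => //; try exact: sigma_rect.
move=> {sA sB}C1 C2 /rect_widen[n hB] /rect_widen[m hC].
have [A1 [mA1 AD1] e1] := hB _ (leq_maxl n m).
have [A2 [mA2 AD2] e2] := hC _ (leq_maxr n m).
rewrite e1 e2.
transitivity (P (\bigcap_(i in `I_(maxn n m)) Z i @^-1` (A1 i `&` A2 i))).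
  congr (P _); apply/seteqP; split=> w /=.
    by move=> [h1 h2] i ilt; split; [exact: h1|exact: h2].
  by move=> h; split=> i ilt; have [] := h i ilt.
rewrite !iZ//; last by move=> i; exact: measurableI.
rewrite -big_split/=; apply: eq_bigr => i _.
have [D1i|nD1i] := pselect (D1 i).
  have nD2i : ~ D2 i by move=> D2i; have : (D1 `&` D2) i by []; rewrite D12.
  by rewrite (AD2 i)// setIT preimage_setT probability_setT mule1.
by rewrite (AD1 i)// setTI preimage_setT probability_setT mul1e.
Qed.

End sigma_independence.

(** * Expectation *)

Section expectation_toolkit.
Context (d : measure_display) (T : measurableType d) (R : realType).
Context (P : probability T R).

(** A real number, hence informative only together with [L1]: [fine] turns an infinite integral into
    0. *)
Definition Ex (f : T -> R) : R := (\int[P]_w f w)%R.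
Definition L1 (f : T -> R) : Prop := P.-integrable setT (EFin \o f).
Implicit Types f g : T -> R.

Lemma L1_meas f : L1 f -> measurable_fun setT f.
Proof. by move=> /measurable_int/measurable_EFinP. Qed.

Lemma L1_dom f g : measurable_fun setT f -> L1 g ->
  (forall w, `|f w| <= g w) -> L1 f.
Proof.
move=> mf Lg fg; apply: le_integrable Lg => //; first exact/measurable_EFinP.
by move=> w _ /=; rewrite lee_fin (le_trans (fg w))// ler_norm.
Qed.

Lemma L1_cst r : L1 (fun=> r).
Proof. exact: finite_measure_integrable_cst. Qed.

Lemma L1_bnd f (M : R) : measurable_fun setT f -> (forall w, `|f w| <= M) -> L1 f.
Proof. by move=> mf fM; apply: (L1_dom mf (L1_cst M)). Qed.

Lemma L1D f g : L1 f -> L1 g -> L1 (fun w => f w + g w).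
Proof. by move=> Lf Lg; exact: (integrableD measurableT Lf Lg). Qed.

Lemma L1B f g : L1 f -> L1 g -> L1 (fun w => f w - g w).
Proof. by move=> Lf Lg; exact: (integrableB measurableT Lf Lg). Qed.

Lemma L1Z k f : L1 f -> L1 (fun w => k * f w).
Proof. by move=> Lf; exact: (integrableZl measurableT k Lf). Qed.

Lemma L1_sum n (f : nat -> T -> R) : (forall i, L1 (f i)) ->
  L1 (fun w => \sum_(i < n) f i w).
Proof.
move=> Lf; elim: n => [|n IH].
  by apply: eq_integrable (L1_cst 0) => // w _ /=; rewrite big_ord0.
by apply: eq_integrable (L1D IH (Lf n)) => // w _ /=; rewrite big_ord_recr.
Qed.

Lemma L1_eq f g : f =1 g -> L1 f -> L1 g.
Proof. by move=> /funext->. Qed.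

Lemma ExE f : L1 f -> (\int[P]_w (f w)%:E = (Ex f)%:E)%E.
Proof. by move=> Lf; rewrite /Ex /Rintegral fineK// integrable_fin_num. Qed.

Lemma eq_Ex f g : f =1 g -> Ex f = Ex g.
Proof. by move=> /funext->. Qed.

Lemma ExD f g : L1 f -> L1 g -> Ex (fun w => f w + g w) = Ex f + Ex g.
Proof. by move=> Lf Lg; rewrite /Ex RintegralD. Qed.

Lemma ExB f g : L1 f -> L1 g -> Ex (fun w => f w - g w) = Ex f - Ex g.
Proof. by move=> Lf Lg; rewrite /Ex RintegralB. Qed.

Lemma ExZ k f : L1 f -> Ex (fun w => k * f w) = k * Ex f.
Proof. by move=> Lf; rewrite /Ex RintegralZl. Qed.

Lemma Ex_cst r : Ex (fun=> r) = r.
Proof.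
rewrite /Ex Rintegral_cst//; transitivity (r * fine 1%E); last by rewrite mulr1.
by congr (_ * fine _); exact: probability_setT.
Qed.

Lemma Ex_sum n (f : nat -> T -> R) : (forall i, L1 (f i)) ->
  Ex (fun w => \sum_(i < n) f i w) = \sum_(i < n) Ex (f i).
Proof.
move=> Lf; elim: n => [|n IH].
  by rewrite big_ord0 -[RHS](Ex_cst 0); apply: eq_Ex => w; rewrite big_ord0.
rewrite big_ord_recr/= -IH -ExD//; last exact: L1_sum.
by apply: eq_Ex => w; rewrite big_ord_recr.
Qed.

Lemma Ex_ge0 f : (forall w, 0 <= f w) -> 0 <= Ex f.
Proof. by move=> f0; apply: Rintegral_ge0. Qed.

Lemma Ex_le f g : L1 f -> L1 g -> (forall w, f w <= g w) -> Ex f <= Ex g.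
Proof. by move=> Lf Lg fg; apply: le_Rintegral. Qed.

Lemma Ex_le_cst f r : L1 f -> (forall w, f w <= r) -> Ex f <= r.
Proof. by move=> Lf fr; rewrite -(Ex_cst r); apply: Ex_le => //; exact: L1_cst. Qed.

Lemma L1_lty f : measurable_fun setT f -> (forall w, 0 <= f w) ->
  (\int[P]_w (f w)%:E < +oo)%E -> L1 f.
Proof.
move=> mf f0 fo; apply/integrableP; split; first exact/measurable_EFinP.
by under eq_integral => w _ do rewrite /= ger0_norm ?f0//.
Qed.

Lemma Ex_dct (f_ : nat -> T -> R) f g :
  (forall n, measurable_fun setT (f_ n)) -> measurable_fun setT f ->
  {ae P, forall w, f_ n w @[n --> \oo] --> f w} -> L1 g ->
  (forall n w, `|f_ n w| <= g w) ->
  L1 f /\ Ex (f_ n) @[n --> \oo] --> Ex f.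
Proof.
move=> mf_ mf f_f Lg fg.
have [] := @dominated_convergence _ _ _ P setT measurableT
  (fun n => EFin \o f_ n) (EFin \o f) (EFin \o g).
- by move=> n; exact/measurable_EFinP.
- exact/measurable_EFinP.
- apply: filterS f_f => w h _; apply: cvg_EFin h; exact: nearW.
- exact: Lg.
- by apply: nearW => w n _; rewrite /= lee_fin.
move=> Lf _ h; split=> //.
have L_ n : L1 (f_ n) by apply: (L1_dom (mf_ n) Lg) => w.
have : (Ex (f_ n))%:E @[n --> \oo] --> (Ex f)%:E.
  rewrite -ExE//; under eq_fun do rewrite -ExE//.
  exact: h.
by move/fine_cvg.
Qed.

Lemma Ex_b (b : T -> bool) : measurable_fun setT b ->
  (P [set w | b w] = (Ex (fun w => (b w)%:R))%:E)%E.
Proof.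
move=> mb.
have mB : measurable [set w | b w].
  rewrite (_ : [set w | b w] = setT `&` b @^-1` [set true]); first exact: mb.
  by rewrite setTI; apply/seteqP; split.
rewrite -ExE.
  rewrite -[in LHS](setIT [set w | b w]) -integral_indic//; apply: eq_integral => w _.
  rewrite indicE; have [bw|/negP bw] := boolP (b w); first by rewrite mem_set.
  by rewrite memNset.
apply: (L1_bnd (M := 1)) => [|w]; last by case: (b w); rewrite ?normr1 ?normr0.
apply: (measurableT_comp (f := fun b : bool => b%:R : R)) => //.
Qed.

End expectation_toolkit.
Arguments L1_bnd {d T R P f} M _ _.

(** * Pairs of independent variables *)

Section pairs.
Context (d : measure_display) (T : measurableType d) (R : realType).
Context (P : probability T R).
Implicit Types U V : T -> R.

Definition indep2 U V := forall A B : set R, measurable A -> measurable B ->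
  P (U @^-1` A `&` V @^-1` B) = (P (U @^-1` A) * P (V @^-1` B))%E.

Definition eqlaw U V := forall A : set R, measurable A ->
  P (U @^-1` A) = P (V @^-1` A).

Lemma indep2_comp U V (f g : R -> R) :
  measurable_fun setT f -> measurable_fun setT g ->
  indep2 U V -> indep2 (fun w => f (U w)) (fun w => g (V w)).
Proof.
move=> mf mg UV A B mA mB; rewrite -[X in P (X `&` _)]/(U @^-1` (f @^-1` A)).
rewrite -[X in P (_ `&` X)]/(V @^-1` (g @^-1` B)) UV//.
  by rewrite -[X in measurable X]setTI; exact: mf.
by rewrite -[X in measurable X]setTI; exact: mg.
Qed.

Lemma indep2_sym U V : indep2 U V -> indep2 V U.
Proof. by move=> UV A B mA mB; rewrite setIC muleC UV. Qed.

Let rv U (mU : measurable_fun setT U) : {mfun T >-> R} :=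
  MeasurableFun.Pack (MeasurableFun.Class (isMeasurableFun.Build _ _ _ _ _ mU)).

(** On rectangles this is independence, and a measure agreeing with the product measure on
    rectangles equals it. The marginals are read off from another pair [U], [V], so that independent
    pairs with equal marginals get the same joint law. *)
Lemma joint_law U V U' V' (mU : measurable_fun setT U)
    (mV : measurable_fun setT V) (D : set (R * R)) :
  measurable_fun setT U' -> measurable_fun setT V' ->
  indep2 U' V' -> eqlaw U U' -> eqlaw V V' -> measurable D ->
  P [set w | D (U' w, V' w)] =
  (distribution P (rv mU) \x distribution P (rv mV))%E D.
Proof.
move=> mU' mV' iUV eU eV mD.
have mUV : measurable_fun setT (fun w => (U' w, V' w)).
  exact: measurable_fun_pair.
pose UV' : {mfun T >-> (R * R)%type} :=
  MeasurableFun.Pack (MeasurableFun.Class (isMeasurableFun.Build _ _ _ _ _ mUV)).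
symmetry.
apply: (@product_measure_unique _ _ _ _ R (distribution P (rv mU))
  (distribution P (rv mV)) (distribution P UV')) => // A B mA mB.
transitivity (P (U' @^-1` A `&` V' @^-1` B)) => //.
rewrite iUV//.
by congr (_ * _)%E; symmetry; [exact: eU|exact: eV].
Qed.

Lemma indep2_integral U V (h : R * R -> \bar R) :
  measurable_fun setT U -> measurable_fun setT V -> indep2 U V ->
  measurable_fun setT h -> (forall z, 0 <= h z)%E ->
  (\int[P]_w h (U w, V w) = \int[P]_w \int[P]_w' h (U w, V w'))%E.
Proof.
move=> mU mV iUV mh h0.
have mUV : measurable_fun setT (fun w => (U w, V w)).
  exact: measurable_fun_pair.
pose UV : {mfun T >-> (R * R)%type} :=
  MeasurableFun.Pack (MeasurableFun.Class (isMeasurableFun.Build _ _ _ _ _ mUV)).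
transitivity (\int[distribution P UV]_z h z)%E.
  by rewrite ge0_integral_distribution.
rewrite (eq_measure_integral
  (distribution P (rv mU) \x distribution P (rv mV))%E); last first.
  by move=> A mA _; exact: (joint_law mU mV mU mV).
rewrite fubini_tonelli1//.
rewrite ge0_integral_distribution//=; last 2 first.
  exact: measurable_fun_fubini_tonelli_F.
  by move=> x; exact: integral_ge0.
apply: eq_integral => w _ /=; rewrite /fubini_F.
rewrite ge0_integral_distribution//.
exact: measurableT_comp.
Qed.

Lemma eqlaw_integral U U' (f : R -> \bar R) :
  measurable_fun setT U -> measurable_fun setT U' -> eqlaw U U' ->
  measurable_fun setT f -> (forall z, 0 <= f z)%E ->
  (\int[P]_w f (U w) = \int[P]_w f (U' w))%E.
Proof.
move=> mU mU' e mf f0.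
transitivity (\int[distribution P (rv mU)]_z f z)%E.
  by rewrite ge0_integral_distribution.
transitivity (\int[distribution P (rv mU')]_z f z)%E; last first.
  by rewrite ge0_integral_distribution.
by apply: eq_measure_integral => A mA _; exact: e.
Qed.

Lemma eqlaw2 U V U' V' (phi : R * R -> R) :
  measurable_fun setT U -> measurable_fun setT V ->
  measurable_fun setT U' -> measurable_fun setT V' ->
  indep2 U V -> indep2 U' V' -> eqlaw U U' -> eqlaw V V' ->
  measurable_fun setT phi ->
  eqlaw (fun w => phi (U w, V w)) (fun w => phi (U' w, V' w)).
Proof.
move=> mU mV mU' mV' i i' eU eV mphi A mA.
have mD : measurable (phi @^-1` A) by rewrite -[X in measurable X]setTI; exact: mphi.
have := joint_law mU mV mU' mV' i' eU eV mD.
by have := joint_law mU mV mU mV i (fun _ _ => erefl) (fun _ _ => erefl) mD => <- ->.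
Qed.

Lemma L1_eqlaw U U' (f : R -> R) :
  measurable_fun setT U -> measurable_fun setT U' -> eqlaw U U' ->
  measurable_fun setT f -> L1 P (fun w => f (U w)) -> L1 P (fun w => f (U' w)).
Proof.
move=> mU mU' e mf /integrableP[_ h]; apply/integrableP; split.
  by apply/measurable_EFinP; exact: measurableT_comp.
rewrite (le_lt_trans _ h)//=.
rewrite (eqlaw_integral (f := fun x => `|(f x)%:E|%E) mU mU' e)//.
by apply: measurableT_comp => //; exact/measurable_EFinP.
Qed.

Lemma Ex_eqlaw U U' (f : R -> R) :
  measurable_fun setT U -> measurable_fun setT U' -> eqlaw U U' ->
  measurable_fun setT f -> (forall x, 0 <= f x) ->
  Ex P (fun w => f (U w)) = Ex P (fun w => f (U' w)).
Proof.
move=> mU mU' e mf f0; rewrite /Ex /Rintegral; congr fine.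
apply: (eqlaw_integral (f := fun x => (f x)%:E)) => //.
exact/measurable_EFinP.
Qed.

Lemma indep2_Ex U V (h : R * R -> R) M :
  measurable_fun setT U -> measurable_fun setT V -> indep2 U V ->
  measurable_fun setT h -> (forall z, 0 <= h z <= M) ->
  Ex P (fun w => h (U w, V w)) = Ex P (fun w => Ex P (fun w' => h (U w, V w'))).
Proof.
move=> mU mV iUV mh h0M; rewrite {1}/Ex /Rintegral.
rewrite (indep2_integral (h := fun z => (h z)%:E) mU mV)//; first last.
- by move=> z; rewrite lee_fin; case/andP: (h0M z).
- exact/measurable_EFinP.
congr fine; apply: eq_integral => w _; rewrite ExE//.
apply: (L1_bnd M).
  by apply: (measurableT_comp mh); exact: measurable_fun_pair.
by move=> w'; have /andP[h0 hM] := h0M (U w, V w'); rewrite ger0_norm.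
Qed.

Lemma indep2_ExM U V :
  indep2 U V -> L1 P U -> L1 P V -> (forall w, 0 <= U w) -> (forall w, 0 <= V w) ->
  L1 P (fun w => U w * V w) /\ Ex P (fun w => U w * V w) = Ex P U * Ex P V.
Proof.
move=> iUV LU LV U0 V0.
have mU := L1_meas LU; have mV := L1_meas LV.
have mUV : measurable_fun setT (fun w => U w * V w) by exact: measurable_funM.
have h : (\int[P]_w (U w * V w)%:E = (Ex P U * Ex P V)%:E)%E.
  (* [indep2_integral] asks for an integrand nonnegative on the whole plane, while [U] and [V] are
     nonnegative only along their values. *)
  transitivity (\int[P]_w (`|U w| * `|V w|)%:E)%E.
    by apply: eq_integral => w _; rewrite !ger0_norm.
  rewrite (indep2_integral (h := fun z => (`|z.1| * `|z.2|)%:E) mU mV)//=.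
  - transitivity (\int[P]_w ((U w)%:E * (Ex P V)%:E))%E.
      apply: eq_integral => w _.
      rewrite -ExE// -integralZl//; apply: eq_integral => w' _.
      by rewrite !ger0_norm// EFinM.
    by rewrite EFinM -(ExE LU) -integralZr.
  - apply/measurable_EFinP; apply: measurable_funM.
      by apply: (measurableT_comp (@normr_measurable _ _)); exact: measurable_fst.
    by apply: (measurableT_comp (@normr_measurable _ _)); exact: measurable_snd.
have L : L1 P (fun w => U w * V w).
  apply: L1_lty => // [w|]; first exact: mulr_ge0.
  by rewrite h ltry.
by split=> //; move: h; rewrite ExE// => -[].
Qed.

End pairs.

(** * Recursions driven by independent steps *)

Section chains.
Context (d : measure_display) (T : measurableType d) (R : realType).
Context (P : probability T R).

Definition smeas (Z : nat -> T -> R) (D : set nat) (f : T -> R) :=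
  measurable_fun (setT : set (g_sigma_algebraType
    (\bigcup_(i in D) preimage_set_system setT (Z i) measurable))) f.

Lemma smeas_Z (Z : nat -> T -> R) (D : set nat) i : D i -> smeas Z D (Z i).
Proof.
move=> Di _ B mB; apply: sub_sigma_algebra; exists i => //.
by exists B.
Qed.

Lemma smeas_meas (Z : nat -> T -> R) (D : set nat) f :
  (forall i, measurable_fun setT (Z i)) -> smeas Z D f -> measurable_fun setT f.
Proof.
move=> mZ mf _ B mB; have := mf measurableT B mB.
apply: (smallest_sub (@sigma_algebra_measurable _ T)) => A [i _ [C mC <-]].
exact: mZ.
Qed.

Lemma indep2_smeas (Z : nat -> T -> R) (D1 D2 : set nat) f g :
  (forall i, measurable_fun setT (Z i)) -> indep_seq P Z -> D1 `&` D2 = set0 ->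
  smeas Z D1 f -> smeas Z D2 g -> indep2 P f g.
Proof.
move=> mZ iZ D12 mf mg A B mA mB; apply: (indep_sigma mZ iZ D12).
  by rewrite -[X in sigma_on _ _ X]setTI; exact: mf.
by rewrite -[X in sigma_on _ _ X]setTI; exact: mg.
Qed.

(** One scheme for four walks: partial sums, the walk reset at large steps, the walk frozen above a
    level, the Lindley recursion. State [k] reads only the steps of index below [k]; for independent
    steps it is thus independent of [Z k], and its law depends only on the laws of the steps. *)
Fixpoint chain (phi : R -> R -> R) (v0 : R) (Z : nat -> T -> R) (k : nat) (w : T) : R :=
  if k is k'.+1 then phi (Z k' w) (chain phi v0 Z k' w) else v0.

Variable phi : R -> R -> R.
Hypothesis mphi : measurable_fun setT (fun z : R * R => phi z.1 z.2).
Variable v0 : R.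

Lemma chain_smeas (Z : nat -> T -> R) (D : set nat) k :
  (forall i, (i < k)%N -> D i) -> smeas Z D (chain phi v0 Z k).
Proof.
elim: k => [|k IH] kD; first exact: measurable_cst.
apply: (measurableT_comp mphi (measurable_fun_pair _ _)).
  by apply: smeas_Z; exact: kD.
by apply: IH => i ik; apply: kD; exact: ltnW.
Qed.

Lemma chain_meas (Z : nat -> T -> R) k :
  (forall i, measurable_fun setT (Z i)) -> measurable_fun setT (chain phi v0 Z k).
Proof.
move=> mZ; apply: (@smeas_meas Z setT) => //.
exact: chain_smeas.
Qed.

Lemma chain_indep (Z : nat -> T -> R) k :
  (forall i, measurable_fun setT (Z i)) -> indep_seq P Z ->
  indep2 P (Z k) (chain phi v0 Z k).
Proof.
move=> mZ iZ; apply: (@indep2_smeas Z [set k] `I_k) => //.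
- by apply/seteqP; split=> i //= [->]; rewrite ltnn.
- exact: smeas_Z.
- exact: chain_smeas.
Qed.

Lemma chain_law (Z Z' : nat -> T -> R) k :
  (forall i, measurable_fun setT (Z i)) -> indep_seq P Z ->
  (forall i, measurable_fun setT (Z' i)) -> indep_seq P Z' ->
  (forall i, eqlaw P (Z i) (Z' i)) ->
  eqlaw P (chain phi v0 Z k) (chain phi v0 Z' k).
Proof.
move=> mZ iZ mZ' iZ' e; elim: k => [|k IH] //=.
apply: (@eqlaw2 _ _ _ P (Z k) (chain phi v0 Z k) (Z' k) (chain phi v0 Z' k)
  (fun z => phi z.1 z.2)) => //.
- exact: chain_meas.
- exact: chain_meas.
- exact: chain_indep.
- exact: chain_indep.
Qed.

End chains.

(** * Increments of -Y over a grid *)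

Section grid.
Context (d : measure_display) (T : measurableType d) (R : realType).
Context (P : probability T R) (X : R -> {RV P >-> R}).

Definition Yhat (t : R) (w : T) : R := t - X t w.

Definition Yinc (s dl : R) (i : nat) (w : T) : R :=
  Yhat (s + i.+1%:R * dl) w - Yhat (s + i%:R * dl) w.

Lemma Yhat_meas t : measurable_fun setT (Yhat t).
Proof. exact: measurable_funB. Qed.

Lemma Yinc_meas s dl i : measurable_fun setT (Yinc s dl i).
Proof. by apply: measurable_funB; exact: Yhat_meas. Qed.

Let refl_meas (c : R) (A : set R) :
  measurable A -> measurable ((fun x : R => c - x) @^-1` A).
Proof.
move=> mA; rewrite -[X in measurable X]setTI.
have h : measurable_fun setT (fun x : R => c - x) by exact: measurable_funB.
exact: h.
Qed.

Let YincE s dl i w : Yinc s dl i w =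
  dl - (X (s + i.+1%:R * dl) w - X (s + i%:R * dl) w).
Proof. by rewrite /Yinc /Yhat -natr1; ring. Qed.

Lemma Yinc_indep s dl : 0 <= dl -> independent_increments X ->
  indep_seq P (Yinc s dl).
Proof.
move=> dl0 ind n A mA.
have := ind n (fun i => s + i%:R * dl) _
  (fun i : 'I_n => (fun x : R => dl - x) @^-1` A i) _.
have h0 : forall i j : nat, (i <= j)%N -> s + i%:R * dl <= s + j%:R * dl.
  by move=> i j ij; rewrite lerD2l ler_wpM2r// ler_nat.
move=> /(_ h0 (fun i => refl_meas _ (mA i))).
have preE (i : nat) : Yinc s dl i @^-1` A i =
    (fun w => X (s + i.+1%:R * dl) w - X (s + i%:R * dl) w)
      @^-1` ((fun x : R => dl - x) @^-1` A i).
  by apply/seteqP; split=> w /=; rewrite YincE.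
have -> : (\bigcap_(i in [set: 'I_n])
    (fun w => X (s + i.+1%:R * dl) w - X (s + i%:R * dl) w)
      @^-1` ((fun x : R => dl - x) @^-1` A i)) =
    \bigcap_(i in `I_n) Yinc s dl i @^-1` A i.
  apply/seteqP; split=> w h i /= ilt.
    by rewrite YincE; exact: (h (Ordinal ilt) I).
  by rewrite -YincE; exact: (h i (ltn_ord i)).
move=> ->; apply: eq_bigr => i _.
by rewrite preE.
Qed.

Lemma Yinc_law s dl i : 0 <= dl -> stationary_increments X ->
  eqlaw P (Yinc s dl i) (Yinc 0 dl 0).
Proof.
move=> dl0 st A mA.
have := st 0 dl (s + i%:R * dl) _ dl0 (refl_meas dl mA).
have -> : [set w | ((fun x : R => dl - x) @^-1` A)
    (X (dl + (s + i%:R * dl)) w - X (0 + (s + i%:R * dl)) w)] = Yinc s dl i @^-1` A.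
  have e1 : dl + (s + i%:R * dl) = s + i.+1%:R * dl by rewrite -natr1; ring.
  by apply/seteqP; split=> w /=; rewrite YincE e1 add0r.
move=> ->; congr (P _).
by apply/seteqP; split=> w /=; rewrite YincE mul1r mul0r !add0r.
Qed.

(** Coordinate 0 is the clock [e], the others are shifted by one. Independence of [e] from the
    process becomes independence of a single sequence, and variables built from disjoint sets of
    coordinates are independent. *)
Definition ext (e : T -> R) (Z : nat -> T -> R) (i : nat) : T -> R :=
  if i is j.+1 then Z j else e.

Lemma ext_indep (e : {RV P >-> R}) s dl : 0 <= dl -> independent_increments X ->
  independent_of_process e X -> indep_seq P (ext e (Yinc s dl)).
Proof.
move=> dl0 ind ie [|n] A mA.
  by rewrite big_ord0 II0 bigcap_set0 probability_setT.
have mU i : sigma_of_process X (Yinc s dl i @^-1` A i.+1).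
  rewrite /sigma_of_process.
  set G := \bigcup_t _.
  have mX t : measurable_fun (setT : set (g_sigma_algebraType G)) (X t).
    move=> _ B mB; apply: sub_sigma_algebra; exists t => //; exists B => //.
  have : measurable_fun (setT : set (g_sigma_algebraType G)) (Yinc s dl i).
    by apply: measurable_funB; apply: measurable_funB => //; exact: measurable_cst.
  by move=> /(_ measurableT _ (mA i.+1)); rewrite setTI.
have sU : sigma_of_process X (\bigcap_(i in `I_n) Yinc s dl i @^-1` A i.+1).
  apply: (@bigcap_measurableType _
    (g_sigma_algebraType (\bigcup_(t : R) preimage_set_system setT (X t) measurable))).
  by move=> i _; exact: mU.
transitivity (P ((\bigcap_(i in `I_n) Yinc s dl i @^-1` A i.+1) `&` e @^-1` A 0)).
  congr (P _); apply/seteqP; split=> w /=.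
    by move=> h; split; [move=> i ilt; exact: (h i.+1)|exact: (h 0)].
  by move=> [h1 h2] [|i] //= ilt; exact: (h1 i).
rewrite ie// big_ord_recl/= muleC; congr (_ * _)%E.
rewrite (Yinc_indep s dl0 ind n (fun i => mA i.+1)); apply: eq_bigr => i _.
by rewrite /bump /= add1n.
Qed.

Lemma ext_meas (e : {RV P >-> R}) s dl i : measurable_fun setT (ext e (Yinc s dl) i).
Proof. by case: i => [|i] //=; exact: Yinc_meas. Qed.

End grid.

(** * Cadlag paths without negative jumps *)

Section cadlag_paths.
Context (R : realType).
Variable g : R -> R.
Hypotheses (gc : cadlag g) (gj : no_negative_jumps g).

Lemma at_left_ex (Q : R -> Prop) (x : R) : (\forall s \near x^'-, Q s) ->
  exists2 h, 0 < h & forall s, x - h < s -> s < x -> Q s.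
Proof.
move=> [h /= h0 hQ]; exists h => // s xs sx; apply: hQ => //=.
by rewrite ger0_norm ?subr_ge0 ?ltW//; lra.
Qed.

Lemma at_right_ex (Q : R -> Prop) (x : R) : (\forall s \near x^'+, Q s) ->
  exists2 h, 0 < h & forall s, x < s -> s < x + h -> Q s.
Proof.
move=> [h /= h0 hQ]; exists h => // s xs sx; apply: hQ => //=.
by rewrite ltr0_norm ?subr_lt0//; lra.
Qed.

Lemma cadlag_local (x eps : R) : 0 < eps -> exists l h, [/\ l <= g x, 0 < h,
  (forall s, x - h < s -> s < x -> `|g s - l| <= eps) &
  (forall s, x <= s -> s < x + h -> `|g s - g x| <= eps)].
Proof.
move=> e0; have [gr gl] := gc x.
have /cvgrPdist_le/(_ _ e0)/at_right_ex[h1 h10 H1] := gr.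
have /cvgrPdist_le/(_ _ e0)/at_left_ex[h2 h20 H2] := gl.
exists (lim (g s @[s --> x^'-])), (Num.min h1 h2); split.
- exact: gj.
- by rewrite lt_min h10.
- move=> s; have := ge_min h2 h1 h2; rewrite lexx orbT => hle sx s2.
  by rewrite distrC; apply: H2 => //; lra.
- move=> s; have := ge_min h1 h1 h2; rewrite lexx /= => hle.
  rewrite le_eqVlt => /orP[/eqP<- _|xs s2]; first by rewrite subrr normr0 ltW.
  by rewrite distrC; apply: H1 => //; lra.
Qed.

(** A one-sided uniform continuity. Near [x] a later value undercuts an earlier one by at most twice
    the local tolerance, because crossing [x] moves the path from near the left limit up to near
    [g x]. Compactness of [[a, b]] makes the step length uniform. *)
Lemma increments_ge (a b eps : R) : 0 < eps -> exists2 h, 0 < h &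
  forall s s', a <= s <= b -> s <= s' <= s + h -> g s - g s' <= eps.
Proof.
move=> e0.
have /compact_near_coveringP cab := segment_compact (a := a) (b := b).
have H : \forall h \near 0^'+, `[a, b]%classic `<=`
    [set s | forall s', s <= s' <= s + h -> g s - g s' <= eps].
  apply: (cab _ _ (fun h s => forall s', s <= s' <= s + h -> g s - g s' <= eps)).
  move=> x _; have e20 : 0 < eps / 2 by lra.
  have [l [h [lg h0 Hl Hr]]] := cadlag_local x e20.
  have h20 : 0 < h / 2 by lra.
  exists (ball x (h / 2), [set k | 0 < k /\ k < h / 2]).
    split; first exact: nbhsx_ballx.
    by near=> k; split.
  move=> [s k] /= [+ [k0 kh]] s' /andP[ss' s'k].
  rewrite /ball/= ltr_norml => /andP[xs1 xs2].
  have [sx|xs] := ltP s x; last first.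
    have := Hr s xs; have := Hr s'; rewrite !ler_norml.
    have -> : x <= s' by lra.
    have -> : s' < x + h by lra.
    have -> : s < x + h by lra.
    by move=> /(_ isT isT)/andP[? ?] /(_ isT)/andP[? ?]; lra.
  have := Hl s; rewrite !ler_norml.
  have -> : x - h < s by lra.
  rewrite sx => /(_ isT isT)/andP[? ?].
  have [s'x|xs'] := ltP s' x.
    have := Hl s'; rewrite !ler_norml s'x.
    have -> : x - h < s' by lra.
    by move=> /(_ isT isT)/andP[? ?]; lra.
  have := Hr s'; rewrite !ler_norml xs'.
  have -> : s' < x + h by lra.
  by move=> /(_ isT isT)/andP[? ?]; lra.
have [h h0 hh] := at_right_ex H.
exists (h / 2); first lra.
move=> s s' sab ss'.
have h1 : 0 < h / 2 by lra.
have h2 : h / 2 < 0 + h by lra.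
have := hh _ h1 h2; apply => //.
Unshelve. all: end_near. Qed.

Lemma path_lbounded (a b : R) : exists M, forall s, a <= s <= b -> - M <= g s.
Proof.
have /compact_near_coveringP cab := segment_compact (a := a) (b := b).
have H : \forall M \near +oo, `[a, b]%classic `<=` [set s | - M <= g s].
  apply: (cab _ _ (fun M s => - M <= g s)).
  move=> x _; have [l [h [lg h0 Hl Hr]]] := cadlag_local x ltr01.
  exists (ball x h, [set M | - l + 1 <= M]).
    split; first exact: nbhsx_ballx.
    by apply: nbhs_pinfty_ge; rewrite num_real.
  move=> [s M] /= [+ HM]; rewrite /ball/= ltr_norml => /andP[xs1 xs2].
  have [sx|xs] := ltP s x.
    have := Hl s; rewrite !ler_norml sx.
    have -> : x - h < s by lra.
    by move=> /(_ isT isT)/andP[? ?]; lra.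
  have := Hr s; rewrite !ler_norml xs.
  have -> : s < x + h by lra.
  by move=> /(_ isT isT)/andP[? ?]; lra.
have [M [_ HM]] := H.
exists (M + 1) => s sab; have := HM (M + 1); rewrite ltrDl ltr01 => /(_ isT).
by apply.
Qed.

Lemma right_local (x eps : R) : 0 < eps -> exists2 h, 0 < h &
  forall s, x <= s -> s < x + h -> `|g s - g x| <= eps.
Proof. by move=> /(cadlag_local x)[l [h [_ h0 _ H]]]; exists h. Qed.

Lemma left_local (x eps : R) : 0 < eps -> exists2 h, 0 < h &
  forall s, x - h < s -> s < x -> g s <= g x + eps.
Proof.
move=> /(cadlag_local x)[l [h [lg h0 H _]]]; exists h => // s s1 s2.
by have := H s s1 s2; rewrite ler_norml => /andP[_ ?]; lra.
Qed.

End cadlag_paths.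

(** * A random walk killed at large steps *)

Lemma measurable_bR (d : measure_display) (T : measurableType d) (R : realType)
  (b : T -> bool) : measurable_fun setT b -> measurable_fun setT (fun w => (b w)%:R : R).
Proof. by move=> mb; apply: (measurableT_comp (f := fun b : bool => b%:R : R)). Qed.

Lemma boolR01 (R : numDomainType) (b : bool) : 0 <= (b%:R : R) <= 1.
Proof. by case: b; rewrite ?lexx ?ler01. Qed.

Ltac meas := repeat first
  [ exact: measurable_cst | exact: measurable_id | exact: measurable_fst
  | exact: measurable_snd | assumption
  | apply: measurable_bR | apply: measurable_and | apply: measurable_fun_ifT
  | apply: measurable_fun_ler | apply: measurable_fun_ltr
  | apply: measurable_maxr | apply: measurable_minr
  | apply: measurable_funB | apply: measurable_funD | apply: measurable_funM
  | apply: measurable_funX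
  | apply: measurable_funN
  | apply: (measurableT_comp (@measurable_expR _)) ].

Section iid.
Context (d : measure_display) (T : measurableType d) (R : realType).
Context (P : probability T R).
Context (Z : nat -> T -> R) (xi : T -> R).
Hypothesis mZ : forall i, measurable_fun setT (Z i).
Hypothesis mxi : measurable_fun setT xi.
Hypothesis iZ : indep_seq P Z.
Hypothesis lZ : forall i, eqlaw P (Z i) xi.

Notation E := (Ex P).

Lemma L1_bool (b : T -> bool) : measurable_fun setT b -> L1 P (fun w => (b w)%:R).
Proof.
move=> mb; apply: (L1_bnd 1); first exact: measurable_bR.
by move=> w; case: (b w); rewrite ?normr1 ?normr0.
Qed.

Lemma exp_iid_sum (th : R) k : L1 P (fun w => expR (th * xi w)) ->
  L1 P (fun w => expR (th * \sum_(i < k) Z i w)) /\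
  E (fun w => expR (th * \sum_(i < k) Z i w)) = E (fun w => expR (th * xi w)) ^+ k.
Proof.
move=> Lxi.
pose add (x v : R) := x + v.
have madd : measurable_fun setT (fun z : R * R => add z.1 z.2) by rewrite /add; meas.
have cE j w : chain add 0 Z j w = \sum_(i < j) Z i w.
  by elim: j => [|j IH] /=; rewrite ?big_ord0// big_ord_recr/= -IH addrC.
have -> : (fun w => expR (th * \sum_(i < k) Z i w)) =
    (fun w => expR (th * chain add 0 Z k w)).
  by apply/funext => w; rewrite cE.
have me : measurable_fun setT (fun x : R => expR (th * x)) by meas.
elim: k => [|k [IH1 IH2]] /=.
  by under eq_fun do rewrite mulr0 expR0; rewrite Ex_cst expr0; split=> //; exact: L1_cst.
have i2 := indep2_comp me me (chain_indep madd 0 k mZ iZ).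
have Lk : L1 P (fun w => expR (th * Z k w)).
  apply: (@L1_eqlaw _ _ _ P xi (Z k) (fun x => expR (th * x))) => //.
  by move=> A mA; rewrite lZ.
have [L e] := indep2_ExM i2 Lk IH1 (fun w => expR_ge0 _) (fun w => expR_ge0 _).
have eE : (fun w => expR (th * add (Z k w) (chain add 0 Z k w))) =
   (fun w => expR (th * Z k w) * expR (th * chain add 0 Z k w)).
  by apply/funext => w; rewrite /add mulrDr expRD.
rewrite eE; split=> //; rewrite e IH2 exprS; congr (_ * _).
by apply: (@Ex_eqlaw _ _ _ P (Z k) xi (fun x => expR (th * x))) => // x; exact: expR_ge0.
Qed.

Section broken_walk.
Variable eps : R.
Hypothesis eps0 : 0 <= eps.

(** A walk reflected at 0 and reset to 0 by each step above [eps]. It enters a half-line with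
    overshoot at most [eps], whatever the law of the steps; this is what yields a geometric tail
    before any moment is known to exist. *)
Definition broken (x v : R) : R := if x <= eps then Num.max 0 (x + v) else 0.

Lemma broken_measurable : measurable_fun setT (fun z : R * R => broken z.1 z.2).
Proof. by rewrite /broken; meas. Qed.

Notation c := (chain broken 0 Z).

Definition btail k (a : R) : R := E (fun w => (a < c k w)%R%:R).

Lemma c_ge0 k w : 0 <= c k w.
Proof. by case: k => [|k] //=; rewrite /broken; case: ifP => // _; rewrite le_max lexx. Qed.

Let mc k : measurable_fun setT (c k).
Proof. exact: (chain_meas broken_measurable). Qed.

Lemma btail_ge0 k a : 0 <= btail k a.
Proof. by apply: Ex_ge0 => w; rewrite ler0n. Qed.

Lemma btail_le1 k a : btail k a <= 1.
Proof.
apply: Ex_le_cst => [|w]; first by apply: L1_bool; meas.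
by rewrite lern1; case: (_ < _).
Qed.

Lemma btail_lt0 k a : a < 0 -> btail k a = 1.
Proof.
move=> a0; rewrite -[RHS](Ex_cst P 1); apply: eq_Ex => w.
by rewrite (lt_le_trans a0 (c_ge0 k w)).
Qed.

Lemma btail_anti k a b : a <= b -> btail k b <= btail k a.
Proof.
move=> ab; apply: Ex_le => [||w]; try by apply: L1_bool; meas.
rewrite ler_nat; have [|//] := ltP b (c k w).
by move=> /(le_lt_trans ab)->.
Qed.

Lemma btail_meas k : measurable_fun setT (btail k).
Proof. by apply: nonincreasing_measurable => // a b ab; exact: btail_anti. Qed.

Lemma btailS k a : 0 <= a ->
  btail k.+1 a = E (fun w => (xi w <= eps)%R%:R * btail k (a - xi w)).
Proof.
move=> a0; rewrite /btail /=.
pose h (z : R * R) : R := ((z.1 <= eps) && (a < z.1 + z.2))%R%:R.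
have mh : measurable_fun setT h by rewrite /h; meas.
transitivity (E (fun w => h (Z k w, c k w))).
  apply: eq_Ex => w; rewrite /h /broken /=.
  by case: ifP => //= _; rewrite ?lt_max ltNge a0.
rewrite (indep2_Ex (M := 1) (mZ k) (mc k) (chain_indep broken_measurable 0 k mZ iZ))//; last first.
  by move=> z; exact: boolR01.
pose F x := (x <= eps)%R%:R * btail k (a - x).
transitivity (E (fun w => F (Z k w))).
  apply: eq_Ex => w; rewrite /F /btail -ExZ; last by apply: L1_bool; meas.
  by apply: eq_Ex => w'; rewrite /h /= -mulnb natrM ltrBlDl.
apply: Ex_eqlaw => //; last by move=> x; rewrite mulr_ge0 ?ler0n ?btail_ge0.
apply: measurable_funM; first by meas.
by apply: (measurableT_comp (btail_meas k)); meas.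
Qed.

Let L1F k a b : L1 P (fun w => (xi w <= eps)%R%:R * (btail k (a - xi w) * b)).
Proof.
apply: (L1_bnd `|b|).
  apply: measurable_funM; first by meas.
  apply: measurable_funM; last by meas.
  by apply: (measurableT_comp (btail_meas k)); meas.
move=> w; rewrite normrM -[leRHS]mul1r ler_pM//.
  by rewrite ger0_norm ?ler0n// lern1; case: (_ <= _).
rewrite normrM -[leRHS]mul1r ler_wpM2r//.
by rewrite ger0_norm ?btail_ge0// btail_le1.
Qed.

Let L1F' k a : L1 P (fun w => (xi w <= eps)%R%:R * btail k (a - xi w)).
Proof. by apply: L1_eq (L1F k a 1) => w; rewrite mulr1. Qed.

(** The walk starts from its lowest state 0, and the recursion [btailS] preserves inequalities
    between tails; single paths need not be monotone in [k]. *)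
Lemma btail_nd k b : btail k b <= btail k.+1 b.
Proof.
elim: k b => [|k IH] b.
  have [b0|b0] := ltP b 0; first by rewrite !btail_lt0.
  rewrite (_ : btail 0 b = 0) ?btail_ge0// /btail /= ltNge b0/=.
  exact: Ex_cst.
have [b0|b0] := ltP b 0; first by rewrite !btail_lt0.
rewrite !btailS//; apply: Ex_le => // w.
by rewrite ler_wpM2l ?ler0n.
Qed.

(* An admissible step is at most [eps], so the walk enters [(a, +oo[] below
   [a + eps] and has to climb by a further [b] from there. *)
Lemma btail_sub k a b : - eps <= a -> 0 <= b ->
  btail k (a + b + eps) <= btail k a * btail k b.
Proof.
elim: k a b => [|k IH] a b ea b0.
  rewrite (_ : btail 0 (a + b + eps) = 0) ?mulr_ge0 ?btail_ge0// /btail /=.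
  by rewrite ltNge (_ : 0 <= a + b + eps)/=; [exact: Ex_cst|lra].
have [a0|a0] := ltP a 0.
  by rewrite (btail_lt0 _ a0) mul1r; apply: btail_anti; lra.
rewrite btailS; last by lra.
rewrite [btail k.+1 a]btailS//.
apply: (@le_trans _ _ (E (fun w => (xi w <= eps)%R%:R * btail k (a - xi w)) * btail k b)).
  rewrite mulrC -ExZ//; apply: Ex_le => [||w]; first exact: L1F'.
    exact: L1Z.
  have [xe|xe] := leP (xi w) eps; last by rewrite !mul0r mulr0.
  rewrite !mul1r mulrC (_ : a + b + eps - xi w = a - xi w + b + eps); last by ring.
  by apply: IH => //; lra.
rewrite ler_wpM2l ?btail_nd//; apply: Ex_ge0 => w.
by rewrite mulr_ge0 ?ler0n ?btail_ge0.
Qed.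

End broken_walk.

(** Each unit of height consists of a climb of [1/2] and an overshoot allowance of [1/2]. *)
Lemma broken_tail k j : btail (1/2) k j%:R <= btail (1/2) k (1/2) ^+ j.
Proof.
elim: j => [|j IH]; first by rewrite expr0 btail_le1.
rewrite exprS (_ : j.+1%:R = 1/2 + j%:R + 1/2 :> R); last by rewrite -natr1; field.
have e0 : 0 <= 1/2 :> R by lra.
apply: (@le_trans _ _ (btail (1/2) k (1/2) * btail (1/2) k j%:R)).
  by apply: btail_sub => //; lra.
by rewrite ler_wpM2l ?btail_ge0.
Qed.

End iid.

(** * Increments over dyadic grids *)

Section small_jumps.
Context (d : measure_display) (T : measurableType d) (R : realType).
Context (P : probability T R) (X : R -> {RV P >-> R}).
Hypothesis X_ind : independent_increments X.
Hypothesis X_stat : stationary_increments X.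
Hypothesis X_cadlag : {ae P, forall w, cadlag (fun t => X t w)}.
Hypothesis X_nnj : {ae P, forall w, no_negative_jumps (fun t => X t w)}.

Definition dl (n : nat) : R := (2 ^+ n)^-1.
Definition xi (n : nat) : T -> R := Yinc X 0 (dl n) 0.

Lemma dl_gt0 n : 0 < dl n.
Proof. by rewrite invr_gt0 exprn_gt0. Qed.

Lemma dl_cvg0 : dl n @[n --> \oo] --> 0.
Proof.
rewrite (_ : dl = fun n => (2^-1) ^+ n); last by apply/funext => n; rewrite /dl exprVn.
by apply: cvg_expr; rewrite ger0_norm; lra.
Qed.

Lemma dl_small h : 0 < h -> \forall n \near \oo, dl n < h.
Proof.
move=> h0; have /cvgrPdist_lt/(_ _ h0) := dl_cvg0.
apply: filterS => n; rewrite sub0r normrN ger0_norm//; exact: (ltW (dl_gt0 n)).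
Qed.

Lemma dl_pow n : (2 ^ n)%:R * dl n = 1.
Proof. by rewrite natrX /dl divff// expf_neq0// pnatr_eq0. Qed.

Lemma Ex_indic (A : set T) : measurable A -> Ex P \1_A = fine (P A).
Proof. by move=> mA; rewrite /Ex /Rintegral integral_indic// setIT. Qed.

Definition calm eps n : set T :=
  \bigcap_(i in `I_(2 ^ n)) (Yinc X 0 (dl n) i @^-1` `]-oo, eps]).

Lemma calm_measurable eps n : measurable (calm eps n).
Proof.
apply: bigcap_measurableType => i _; rewrite -[X in measurable X]setTI.
exact: Yinc_meas.
Qed.

(** Over short intervals [X] drops by at most [eps / 2] by [increments_ge], and the drift over one
    mesh adds at most another [eps / 2]. *)
Lemma ae_calm eps : 0 < eps ->
  {ae P, forall w, \forall n \near \oo, calm eps n w}.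
Proof.
move=> e0; have e20 : 0 < eps / 2 by lra.
apply: filterS2 X_cadlag X_nnj => w gc gj.
have [h h0 H] := increments_ge gc gj 0 1 e20.
apply: filterS2 (dl_small h0) (dl_small e20) => n nh ne.
move=> i /= ilt; rewrite in_itv/= /Yinc /Yhat !add0r.
have dn := dl_gt0 n.
have i1 : i%:R * dl n <= 1.
  by rewrite -[leRHS](dl_pow n); apply: ler_wpM2r; rewrite ?ler_nat ?(ltnW ilt)// ltW.
have i0 : 0 <= i%:R * dl n by rewrite mulr_ge0 ?ler0n// ltW.
have -> : i.+1%:R * dl n = i%:R * dl n + dl n by rewrite -natr1; ring.
have s1 : 0 <= i%:R * dl n <= 1 by rewrite i0.
have s2 : i%:R * dl n <= i%:R * dl n + dl n <= i%:R * dl n + h.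
  by rewrite lerDl lerD2l (ltW dn) ltW.
by have := H _ _ s1 s2; lra.
Qed.

Lemma calm_cvg eps : 0 < eps -> fine (P (calm eps n)) @[n --> \oo] --> (1 : R).
Proof.
move=> e0.
have [] := @Ex_dct _ _ _ P (fun n => \1_(calm eps n)) (fun=> 1) (fun=> 1).
- by move=> n; apply: measurable_indic; exact: calm_measurable.
- exact: measurable_cst.
- apply: filterS (ae_calm e0) => w nw.
  apply: cvg_near_cst; apply: filterS nw => n nw.
  by rewrite indicE mem_set.
- exact: L1_cst.
- by move=> n w; rewrite indicE; case: (_ \in _); rewrite ?normr1 ?normr0.
move=> _; rewrite Ex_cst.
by under eq_fun do rewrite (Ex_indic (@calm_measurable _ _)).
Qed.

Lemma calmE eps n : P (calm eps n) = ((fine (P (xi n @^-1` `]-oo, eps]))) ^+ (2 ^ n))%:E.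
Proof.
have d0 := ltW (dl_gt0 n).
rewrite /calm (@Yinc_indep _ _ _ P X 0 (dl n) d0 X_ind (2 ^ n)%N
  (fun=> `]-oo, eps]%classic) (fun _ => measurable_itv _)).
have h i : P (Yinc X 0 (dl n) i @^-1` `]-oo, eps]) = (fine (P (xi n @^-1` `]-oo, eps])))%:E.
  rewrite fineK ?fin_num_measure//; last first.
    by rewrite -[X in measurable X]setTI; exact: Yinc_meas.
  exact: Yinc_law.
transitivity (\prod_(i < 2 ^ n) (fine (P (xi n @^-1` `]-oo, eps])))%:E)%E.
  by apply: eq_bigr => i _; exact: h.
by rewrite prodEFin prodr_const card_ord.
Qed.

(* If the [2^n] independent increments all stay below [eps] with probability
   [y -> 1], then [1 + 2^n p <= 1 / y]. *)
Lemma jump_rate eps : 0 < eps ->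
  (2 ^ n)%:R * Ex P (fun w => (eps < xi n w)%R%:R) @[n --> \oo] --> (0 : R).
Proof.
move=> e0; pose y n : R := fine (P (calm eps n)).
pose p n : R := Ex P (fun w => (eps < xi n w)%R%:R).
have mxi n : measurable_fun setT (xi n) by exact: Yinc_meas.
have mb n : measurable_fun setT (fun w => eps < xi n w) by meas.
have p0 n : 0 <= p n by apply: Ex_ge0 => w; rewrite ler0n.
have yE n : y n = (1 - p n) ^+ (2 ^ n).
  rewrite /y calmE /=; congr (_ ^+ _).
  have mA : measurable (xi n @^-1` `]-oo, eps]) by rewrite -[X in measurable X]setTI; exact: mxi.
  have /(congr1 fine) := probability_setC P mA.
  rewrite fineB ?fin_num_measure//= (_ : ~` _ = [set w | eps < xi n w]); last first.
    by apply/seteqP; split=> w /=; rewrite in_itv/= ltNge; move/negP.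
  by rewrite Ex_b//= -/(p n) => ->; rewrite opprB addrC subrK.
have y1 : y n @[n --> \oo] --> (1 : R) by exact: calm_cvg.
have yV : (y n)^-1 - 1 @[n --> \oo] --> (0 : R).
  rewrite -(subrr (1 : R)); apply: cvgB; last exact: cvg_cst.
  by rewrite -[X in _ --> X]invr1; apply: cvgV => //; exact: oner_neq0.
apply: (@squeeze_cvgr _ _ _ _ (fun=> 0) (fun n => (y n)^-1 - 1)) => //; last exact: cvg_cst.
have : \forall n \near \oo, 0 < y n by apply: (cvgr_gt _ y1); exact: ltr01.
apply: filterS => n yn; rewrite mulr_ge0 ?p0//= lerBrDl.
apply: (le_trans (expR_ge1Dx _)); rewrite -[expR _]invrK -expRN lef_pV2 ?posrE ?expR_gt0//.
rewrite yE -mulrN expRM_natl; apply: lerXn2r; rewrite ?nnegrE ?expR_ge0//; last first.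
  exact: expR_ge1Dx.
rewrite subr_ge0; apply: Ex_le_cst => [|w]; first exact: L1_bool.
by case/andP: (boolR01 R (eps < xi n w)).
Qed.

End small_jumps.

(** * Tails of the grid increments *)

Section moments.
Context (d : measure_display) (T : measurableType d) (R : realType).
Context (P : probability T R) (X : R -> {RV P >-> R}).
Hypothesis X_ind : independent_increments X.
Hypothesis X_stat : stationary_increments X.
Hypothesis X_cadlag : {ae P, forall w, cadlag (fun t => X t w)}.
Hypothesis X_nnj : {ae P, forall w, no_negative_jumps (fun t => X t w)}.

Notation Yhat := (Yhat X).
Notation dl := (dl R).
Notation xi := (xi X).

Lemma xiE n w : xi n w = Yhat (dl n) w - Yhat 0 w.
Proof. by rewrite /xi /Yinc mul1r mul0r addr0 add0r. Qed.

Lemma Yinc_sum s h K w : \sum_(i < K) Yinc X s h i w = Yhat (s + K%:R * h) w - Yhat s w.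
Proof.
elim: K => [|K IH]; first by rewrite big_ord0 mul0r addr0 subrr.
by rewrite big_ord_recr/= IH /Yinc; ring.
Qed.

Lemma dl_split m n : (m <= n)%N -> (2 ^ (n - m))%:R * dl n = dl m.
Proof.
move=> mn; rewrite natrX /dl -[in (2 ^+ n)^-1](subnK mn) exprD invfM mulrA divff ?mul1r//.
Qed.

(** Displacements are tested at dyadic points of every mesh, which keeps the event measurable and
    independent of the grid used later. The threshold is [1/4] because two values more than [1/2]
    apart force one of them to be that far from the start. *)
Definition osc m : set T := \bigcup_n \bigcup_j
  [set w | j%:R * dl n <= dl m /\ 1/4 < `|Yhat (j%:R * dl n) w - Yhat 0 w|].

Lemma osc_measurable m : measurable (osc m).
Proof.
apply: bigcupT_measurable => n; apply: bigcupT_measurable => j.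
have [h|h] := boolP (j%:R * dl n <= dl m); last first.
  by rewrite (_ : [set w | _] = set0)//; apply/seteqP; split=> w //= [].
rewrite (_ : [set w | _] = (fun w => `|Yhat (j%:R * dl n) w - Yhat 0 w|) @^-1` `]1/4, +oo[).
  rewrite -[X in measurable X]setTI.
  have : measurable_fun setT (fun w => `|Yhat (j%:R * dl n) w - Yhat 0 w|).
    apply: measurableT_comp; first exact: normr_measurable.
    by apply: measurable_funB; exact: Yhat_meas.
  by apply.
by apply/seteqP; split=> w /=; rewrite in_itv/= andbT; [case|split].
Qed.

Lemma osc_cvg : fine (P (osc m)) @[m --> \oo] --> (0 : R).
Proof.
have [] := @Ex_dct _ _ _ P (fun n => \1_(osc n)) (fun=> 0) (fun=> 1).
- by move=> n; apply: measurable_indic; exact: osc_measurable.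
- exact: measurable_cst.
- apply: filterS2 X_cadlag X_nnj => w gc gj.
  apply: cvg_near_cst.
  have e0 : 0 < 1/8 :> R by lra.
  have [h h0 H] := right_local gc gj 0 e0.
  apply: filterS2 (dl_small h0) (dl_small e0) => m mh me.
  rewrite indicE memNset// => -[n _ [j _ /= [jm]]].
  have j0 : 0 <= j%:R * dl n by rewrite mulr_ge0 ?ler0n// ltW// dl_gt0.
  have := H (j%:R * dl n) j0; rewrite add0r => /(_ (le_lt_trans jm mh)).
  rewrite /Yhat ler_norml => /andP[? ?]; apply/negP; rewrite -leNgt ler_norml.
  by apply/andP; split; lra.
- exact: L1_cst.
- by move=> n w; rewrite indicE; case: (_ \in _); rewrite ?normr1 ?normr0.
move=> _; rewrite Ex_cst.
by under eq_fun do rewrite (Ex_indic P (osc_measurable _)).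
Qed.

Let mxi n : measurable_fun setT (xi n).
Proof. exact: Yinc_meas. Qed.

Lemma calm_cvgC eps : 0 < eps -> 1 - fine (P (calm X eps n)) @[n --> \oo] --> (0 : R).
Proof.
move=> e0; rewrite -(subrr (1 : R)); apply: cvgB; first exact: cvg_cst.
exact: calm_cvg.
Qed.

Notation Z n := (Yinc X 0 (dl n)).
Notation c n := (chain (broken (1/2)) 0 (Z n)).

(** Without a step above [1/2] the broken walk is never reset; being reflected, it dominates the
    free walk. *)
Let c_calm n K w : (K <= 2 ^ n)%N -> calm X (1/2) n w ->
  Yhat (K%:R * dl n) w - Yhat 0 w <= c n K w.
Proof.
move=> Kn cw; elim: K Kn => [|K IH] Kn; first by rewrite mul0r subrr.
have := IH (ltnW Kn) => {}IH /=.
have := cw K Kn; rewrite /= in_itv/= => h.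
by rewrite /broken h le_max {1}/Yinc !add0r; apply/orP; right; lra.
Qed.

(** [j] is an index at which the broken walk stood at 0 and since which it has followed the free
    walk. *)
Let c_osc n K w : exists2 j, (j <= K)%N &
  c n K w <= Yhat (K%:R * dl n) w - Yhat (j%:R * dl n) w.
Proof.
elim: K => [|K [j jK IH]]; first by exists 0%N => //=; rewrite subrr.
rewrite /= /broken; case: ifP => _; last by exists K.+1 => //; rewrite subrr.
have [h|h] := leP 0 (Z n K w + c n K w); last first.
  by exists K.+1; rewrite // subrr.
by exists j; [exact: leqW|move: h; rewrite /Yinc !add0r; lra].
Qed.

(** [xi m] is a sum of [2 ^ (n - m)] increments of mesh [2^-n]. On the calm event it lies below the
    broken walk, whose tail is geometric with ratio at most [P (osc m)]. Only the second term
    depends on [n], so [n] can later tend to infinity. *)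
Lemma xi_tail m n j : (m <= n)%N ->
  Ex P (fun w => (j%:R < xi m w)%R%:R) <=
  fine (P (osc m)) ^+ j + (1 - fine (P (calm X (1/2) n))).
Proof.
move=> mn; have d0 := ltW (dl_gt0 R n).
pose K := (2 ^ (n - m))%N.
have Kn : (K <= 2 ^ n)%N by rewrite leq_exp2l// leq_subr.
have mZ i : measurable_fun setT (Z n i) by exact: Yinc_meas.
have iZ := Yinc_indep 0 d0 X_ind.
have lZ i := Yinc_law 0 i d0 X_stat.
have mx := mxi m.
have mc : measurable_fun setT (c n K).
  by apply: chain_meas => //; exact: broken_measurable.
have mcalm := calm_measurable X (1/2) n.
have L1calm : L1 P (\1_(calm X (1/2) n)).
  apply: (L1_bnd 1); first exact: measurable_indic.
  by move=> w; rewrite indicE; case: (_ \in _); rewrite ?normr1 ?normr0.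
apply: (@le_trans _ _ (btail P (Z n) (1/2) K j%:R + (1 - fine (P (calm X (1/2) n))))).
  rewrite -Ex_indic// -[X in _ + (X - _)](Ex_cst P) -ExB//; last exact: L1_cst.
  rewrite /btail -ExD; last 2 first.
  - by apply: L1_bool; meas.
  - by apply: L1B => //; exact: L1_cst.
  apply: Ex_le => [||w].
  - by apply: L1_bool; meas.
  - apply: L1D; first by apply: L1_bool; meas.
    by apply: L1B => //; exact: L1_cst.
  rewrite indicE; have [cw|cw] := pselect (calm X (1/2) n w).
    rewrite mem_set// subrr addr0 ler_nat.
    have := c_calm Kn cw; rewrite dl_split// -xiE => h.
    have [|//] := ltP j%:R (xi m w).
    by move=> /lt_le_trans/(_ h)->.
  rewrite memNset// subr0.
  have /andP[? _] := boolR01 R (j%:R < c n K w).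
  by have /andP[_ ?] := boolR01 R (j%:R < xi m w); lra.
rewrite lerD2r.
apply: le_trans (broken_tail mZ (mZ 0%N) iZ lZ K j) _.
apply: lerXn2r; rewrite ?nnegrE ?btail_ge0 ?fine_ge0//.
rewrite -Ex_indic; last exact: osc_measurable.
apply: Ex_le => [||w].
- by apply: L1_bool; meas.
- apply: (L1_bnd 1); first exact/measurable_indic/osc_measurable.
  by move=> w; rewrite indicE; case: (_ \in _); rewrite ?normr1 ?normr0.
have [h|_] := ltP (1/2) (c n K w); last by rewrite indicE ler0n.
rewrite indicE mem_set//.
have [j' jK hj] := c_osc n K w.
have [h1|h1] := ltP (1/4) `|Yhat (K%:R * dl n) w - Yhat 0 w|.
  by exists n => //; exists K => //=; split=> //; rewrite dl_split.
exists n => //; exists j' => //=; split.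
  by rewrite -(dl_split mn) ler_wpM2r// ler_nat.
move: h1; rewrite ler_norml => /andP[? ?].
rewrite ltNge ler_norml; apply/negP => /andP[? ?]; lra.
Qed.

End moments.

Lemma geo_sum_le (R : realFieldType) (x : R) n : 0 <= x -> x < 1 ->
  \sum_(i < n) x ^+ i <= (1 - x)^-1.
Proof.
move=> x0 x1; have y0 : 0 < 1 - x by lra.
rewrite -[leRHS]mul1r ler_pdivlMr//.
have -> : (\sum_(i < n) x ^+ i) * (1 - x) = 1 - x ^+ n.
  elim: n => [|n IH]; first by rewrite big_ord0 mul0r expr0 subrr.
  by rewrite big_ord_recr/= mulrDl IH exprS; ring.
by rewrite lerBlDr lerDl exprn_ge0.
Qed.

(** On [j < f w <= j + 1] the exponential is at most [exp(th (j + 1))]. A tail ratio of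
    [exp(- 2 th)] beats this and leaves a geometric series of ratio [exp(- th)]; monotone
    convergence removes the truncation [f w <= n]. *)
Lemma L1_exp_tail (d : measure_display) (T : measurableType d) (R : realType)
    (P : probability T R) (f : T -> R) (th : R) :
  measurable_fun setT f -> 0 < th ->
  (forall j, Ex P (fun w => (j%:R < f w)%R%:R) <= expR (- th *+ 2) ^+ j) ->
  L1 P (fun w => expR (th * f w)).
Proof.
move=> mf th0 tail.
pose t n w := (f w <= n%:R)%R%:R * expR (th * f w).
pose s n w : R := 1 + \sum_(j < n) expR (th * j.+1%:R) * (j%:R < f w)%R%:R.
pose C := 1 + expR th * (1 - expR (- th))^-1.
have mt n : measurable_fun setT (t n) by rewrite /t; meas.
have Ls n : L1 P (s n).
  apply: L1D; first exact: L1_cst.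
  apply: (@L1_sum _ _ _ P n (fun j w => expR (th * j.+1%:R) * (j%:R < f w)%R%:R)) => i.
  by apply: L1Z; apply: L1_bool; meas.
have ts n w : t n w <= s n w.
  rewrite /t /s; elim: n => [|n IH].
    rewrite big_ord0 addr0; have [f0|f0] := leP (f w) 0; last by rewrite mul0r.
    by rewrite mul1r expR_le1 pmulr_rle0.
  rewrite big_ord_recr/= addrA.
  have [fn|fn] := leP (f w) n%:R.
    by move: IH; rewrite fn !mul1r mulr0 addr0 (le_trans fn) ?ler_nat// mul1r.
  have [fn1|fn1] := leP (f w) n.+1%:R.
    rewrite mul1r mulr1; apply: (@le_trans _ _ (0 + expR (th * n.+1%:R))).
      by rewrite add0r ler_expR ler_pM2l.
    by rewrite lerD2r addr_ge0// sumr_ge0.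
  rewrite mul0r addr_ge0// ?mulr_ge0 ?expR_ge0 ?ler0n//.
  by rewrite addr_ge0// sumr_ge0.
have t0 n w : 0 <= t n w by rewrite /t mulr_ge0 ?ler0n ?expR_ge0.
have Lt n : L1 P (t n).
  by apply: (L1_dom (mt n) (Ls n)) => w; rewrite ger0_norm.
have EsC n : Ex P (s n) <= C.
  rewrite /s (@ExD _ _ _ P (fun=> 1)); first last.
  - apply: (@L1_sum _ _ _ P n (fun j w => expR (th * j.+1%:R) * (j%:R < f w)%R%:R)) => i.
    by apply: L1Z; apply: L1_bool; meas.
  - exact: L1_cst.
  rewrite Ex_cst lerD2l.
  rewrite (@Ex_sum _ _ _ P n (fun j w => expR (th * j.+1%:R) * (j%:R < f w)%R%:R)); last first.
    by move=> i; apply: L1Z; apply: L1_bool; meas.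
  apply: (@le_trans _ _ (\sum_(j < n) expR th * expR (- th) ^+ j)).
    apply: ler_sum => j _; rewrite ExZ; last by apply: L1_bool; meas.
    apply: (le_trans (ler_wpM2l (expR_ge0 _) (tail j))).
    rewrite -!expRM_natr -!expRD ler_expR -natr1.
    by rewrite le_eqVlt; apply/orP; left; apply/eqP; rewrite -mulr_natr; ring.
  rewrite -big_distrr/= ler_wpM2l ?expR_ge0//; apply: geo_sum_le; first exact: expR_ge0.
  by rewrite expR_lt1 oppr_lt0.
have EtC n : (\int[P]_w (t n w)%:E <= C%:E)%E.
  by rewrite ExE// lee_fin (le_trans _ (EsC n))// Ex_le.
apply: L1_lty; [by meas|by move=> w; exact: expR_ge0|].
apply: (@le_lt_trans _ _ C%:E); last exact: ltry.
have := @cvg_monotone_convergence _ _ _ P setT measurableT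
  (fun n w => (t n w)%:E) _ _ _.
move=> /(_ (fun n => (measurable_EFinP _ _).2 (mt n))).
move=> /(_ (fun n w _ => t0 n w)) H.
have ndt w : setT w -> nondecreasing_seq (fun n => (t n w)%:E).
  move=> _ m n mn; rewrite lee_fin /t ler_wpM2r ?expR_ge0// ler_nat.
  have [fm|//] := leP (f w) m%:R.
  by rewrite (le_trans fm) ?ler_nat.
have {H} := H ndt.
have -> : (\int[P]_w (limn (fun n => (t n w)%:E)) = \int[P]_w (expR (th * f w))%:E)%E.
  apply: eq_integral => w _; apply/cvg_lim => //.
  apply: cvg_near_cst.
  near=> n; rewrite /t.
  have -> : f w <= n%:R by near: n; exact: nbhs_infty_ger.
  by rewrite mul1r.
move=> H; have <- := cvg_lim _ H => //.
apply: lime_le; first by apply/cvg_ex; eexists; exact: H.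
exact: nearW.
Unshelve. all: end_near. Qed.

(** * The Laplace exponent *)

Lemma ln_sub_le (R : realType) (a b : R) : 1 <= a -> a <= b -> ln b - ln a <= b - a.
Proof.
move=> a1 ab; have a0 : 0 < a by exact: lt_le_trans a1.
have b0 := lt_le_trans a0 ab.
rewrite -ln_div ?posrE// -[X in ln X](subrKC 1).
have q1 : 0 <= b / a - 1 by rewrite subr_ge0 ler_pdivlMr// mul1r.
apply: le_trans (le_ln1Dx _) _; first by lra.
have -> : b / a - 1 = (b - a) / a by rewrite mulrBl divff ?gt_eqF.
by rewrite ler_pdivrMr// ler_peMr// subr_ge0.
Qed.

Section laplace.
Context (d : measure_display) (T : measurableType d) (R : realType).
Context (P : probability T R) (X : R -> {RV P >-> R}).
Hypothesis X_ind : independent_increments X.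
Hypothesis X_stat : stationary_increments X.
Hypothesis X_cadlag : {ae P, forall w, cadlag (fun t => X t w)}.
Hypothesis X_nnj : {ae P, forall w, no_negative_jumps (fun t => X t w)}.
Hypothesis X_0 : {ae P, forall w, X 0 w = 0}.
Hypothesis X_mean : ('E_P[X 1%R] = 0)%E.

Notation Yhat := (Yhat X).
Notation dl := (dl R).
Notation xi := (xi X).
Notation Ex := (Ex P).

Let mxi n : measurable_fun setT (xi n).
Proof. exact: Yinc_meas. Qed.

(** [m] is so large that [P (osc m)] is below [exp(- 2 th)]; then [n] tends to infinity in
    [xi_tail]. *)
Lemma exp_xi_near th : 0 < th ->
  \forall m \near \oo, L1 P (fun w => expR (th * xi m w)).
Proof.
move=> th0.
have e0 : 0 < expR (- th *+ 2) :> R by exact: expR_gt0.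
have := osc_cvg X_cadlag X_nnj => /cvgrPdist_lt/(_ _ e0).
apply: filterS => m; rewrite sub0r normrN => hm.
apply: L1_exp_tail => // j.
have H n : (m <= n)%N -> Ex (fun w => (j%:R < xi m w)%R%:R) - expR (- th *+ 2) ^+ j <=
    1 - fine (P (calm X (1/2) n)).
  move=> mn; rewrite lerBlDl; apply: (le_trans (xi_tail X_ind X_stat j mn)).
  rewrite lerD2r; apply: lerXn2r; rewrite ?nnegrE ?fine_ge0 ?expR_ge0//.
  by rewrite (le_trans (ler_norm _))// ltW.
have e20 : 0 < 1/2 :> R by lra.
rewrite -subr_le0.
apply: (cvgr_to_ge (calm_cvgC X_cadlag X_nnj e20)).
by exists m => // n /= mn; exact: H.
Qed.

Let xi_sum n w : \sum_(i < 2 ^ n) Yinc X 0 (dl n) i w = xi 0 w.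
Proof.
by rewrite Yinc_sum add0r dl_pow xiE /dl expr0 invr1.
Qed.

Lemma exp_xi_pow th n : L1 P (fun w => expR (th * xi n w)) ->
  L1 P (fun w => expR (th * xi 0 w)) /\
  Ex (fun w => expR (th * xi 0 w)) = Ex (fun w => expR (th * xi n w)) ^+ (2 ^ n).
Proof.
have d0 := ltW (dl_gt0 R n).
have mZ i : measurable_fun setT (Yinc X 0 (dl n) i) by exact: Yinc_meas.
move=> /(exp_iid_sum mZ (mxi n) (Yinc_indep 0 d0 X_ind)
  (fun i => Yinc_law 0 i d0 X_stat) (2 ^ n))[].
by under eq_fun do rewrite xi_sum.
Qed.

(** Integrability is known so far only for meshes that are fine enough for [th]; a coarser increment
    is a sum of independent fine ones. *)
Lemma exp_xi th n : 0 <= th -> L1 P (fun w => expR (th * xi n w)).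
Proof.
rewrite le_eqVlt => /orP[/eqP<-|th0].
  by under eq_fun do rewrite mul0r expR0; exact: L1_cst.
have [m _ hm] := exp_xi_near th0.
pose k := maxn m n.
have Lk : L1 P (fun w => expR (th * xi k w)) by apply: hm; exact: leq_maxl.
have nk : (n <= k)%N by exact: leq_maxr.
have d0 := ltW (dl_gt0 R k).
have mZ i : measurable_fun setT (Yinc X 0 (dl k) i) by exact: Yinc_meas.
have [L _] := exp_iid_sum mZ (mxi k) (Yinc_indep 0 d0 X_ind)
  (fun i => Yinc_law 0 i d0 X_stat) (2 ^ (k - n)) Lk.
by apply: L1_eq L => w /=; rewrite Yinc_sum add0r dl_split// -xiE.
Qed.

Lemma Ex_ae (f g : T -> R) : measurable_fun setT f -> measurable_fun setT g ->
  {ae P, forall w, f w = g w} -> Ex f = Ex g.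
Proof.
move=> mf mg fg; rewrite /Ex /Rintegral; congr fine.
apply: ae_eq_integral => //; [exact/measurable_EFinP|exact/measurable_EFinP|].
by apply: filterS fg => w e _ /=; rewrite e.
Qed.

Lemma L1_ae (f g : T -> R) : measurable_fun setT g ->
  {ae P, forall w, f w = g w} -> L1 P f -> L1 P g.
Proof.
move=> mg fg Lf; have mf := L1_meas Lf.
move/integrableP : (Lf) => [_ h]; apply/integrableP; split; first exact/measurable_EFinP.
rewrite (le_lt_trans _ h)// le_eqVlt; apply/orP; left; apply/eqP.
apply: ae_eq_integral => //.
- by apply: measurableT_comp => //; exact/measurable_EFinP.
- by apply: measurableT_comp => //; exact/measurable_EFinP.
- by apply: filterS fg => w e _ /=; rewrite e.
Qed.

(** The hypothesis equates extended reals. A finite difference of the integrals of the positive and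
    negative parts forces both to be finite, so mean zero includes integrability. *)
Lemma X1_mean : L1 P (X 1) /\ Ex (X 1) = 0.
Proof.
have h : (\int[P]_w (X 1 w)%:E = 0)%E by move: X_mean; rewrite unlock.
split; last by rewrite /Ex /Rintegral h.
move: (h); rewrite integralE => h'.
have : (\int[P]_x ((fun x0 => (X 1 x0)%:E)^\+ x) -
       \int[P]_x ((fun x0 => (X 1 x0)%:E)^\- x))%E \is a fin_num by rewrite h'.
rewrite fin_numB => /andP[fp fn].
apply/integrableP; split; first exact/measurable_EFinP.
rewrite -/(abse \o (fun x0 => (X 1 x0)%:E)) fune_abse.
have mX : measurable_fun setT (fun w => (X 1 w)%:E) by exact/measurable_EFinP.
rewrite ge0_integralD//; [|exact: measurable_funepos|exact: measurable_funeneg].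
by rewrite lte_add_pinfty// ltey_eq ?fp ?fn.
Qed.

(** Taken over the increment from 0 to 1, to which the grid results apply; it agrees with the
    expectation inside [psi_hat] because [X 0] vanishes almost surely. *)
Definition lap th : R := Ex (fun w => expR (th * xi 0 w)).

Lemma lap_alt th : lap th = Ex (fun w => expR (th * (1 - X 1 w))).
Proof.
apply: Ex_ae.
- by have mx := mxi 0; meas.
- by meas.
apply: filterS X_0 => w X0; rewrite xiE /Yhat X0 /dl expr0 invr1.
by rewrite subr0 subr0.
Qed.

Lemma psi_hatE th : psi_hat X th = ln (lap th).
Proof.
rewrite lap_alt /psi_hat unlock /Ex /Rintegral; congr (ln (fine _)).
by apply: eq_integral => w _; rewrite /Y_of opprB.
Qed.

(** A tangent line replaces Jensen: [exp(- th X) >= 1 - th X], and [X 1] has mean zero. *)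
Lemma lap_ge th : 0 <= th -> expR th <= lap th.
Proof.
move=> th0; have [LX EX] := X1_mean.
have -> : expR th = Ex (fun w => expR th * (1 - th * X 1 w)).
  rewrite ExZ; last by apply: L1B; [exact: L1_cst|exact: L1Z].
  by rewrite ExB ?Ex_cst ?ExZ ?EX ?mulr0 ?subr0 ?mulr1//; [exact: L1_cst|exact: L1Z].
rewrite lap_alt; apply: Ex_le => [||w].
- by apply/L1Z/L1B; [exact: L1_cst|exact: L1Z].
- apply: L1_ae (exp_xi 0 th0); first by meas.
  apply: filterS X_0 => w X0; rewrite xiE /Yhat X0 /dl expr0 invr1.
  by rewrite subr0 subr0.
have -> : expR (th * (1 - X 1 w)) = expR th * expR (- (th * X 1 w)).
  by rewrite -expRD; congr expR; ring.
by rewrite ler_wpM2l ?expR_ge0//; exact: expR_ge1Dx.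
Qed.

Definition psi th : R := ln (lap th).

Lemma lap_gt0 th : 0 <= th -> 0 < lap th.
Proof. by move=> /lap_ge; apply: lt_le_trans; exact: expR_gt0. Qed.

Lemma lap0 : lap 0 = 1.
Proof. by rewrite /lap; under [X in Ex X]eq_fun do rewrite mul0r expR0; rewrite Ex_cst. Qed.

Lemma psi0 : psi 0 = 0.
Proof. by rewrite /psi lap0 ln1. Qed.

Lemma psi_ge th : 0 <= th -> th <= psi th.
Proof.
move=> th0; rewrite -ler_expR /psi lnK ?posrE ?lap_gt0//; exact: lap_ge.
Qed.

Lemma exp_xiE th n : 0 <= th ->
  Ex (fun w => expR (th * xi n w)) = expR (dl n * psi th).
Proof.
move=> th0; have [_ e] := exp_xi_pow (exp_xi n th0).
set y := Ex (fun w => expR (th * xi n w)) in e *; have y0 : 0 <= y by apply: Ex_ge0 => w; exact: expR_ge0.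
have y1 : 0 < y.
  rewrite lt_def y0 andbT; apply: contraTneq (lap_gt0 th0) => y0'.
  by rewrite /lap e y0' expr0n -leqn0 leqNgt expn_gt0/= ltxx.
rewrite /psi /lap e lnXn// -mulr_natl mulrA [dl n * _]mulrC dl_pow mul1r.
by rewrite lnK.
Qed.

Lemma expR_conv (s x y : R) : 0 <= s <= 1 ->
  expR ((1 - s) * x + s * y) <= (1 - s) * expR x + s * expR y.
Proof.
move=> /andP[s0 s1].
set z := (1 - s) * x + s * y.
have e1 := expR_ge1Dx (x - z); have e2 := expR_ge1Dx (y - z).
have -> : expR x = expR z * expR (x - z) by rewrite -expRD; congr expR; ring.
have -> : expR y = expR z * expR (y - z) by rewrite -expRD; congr expR; ring.
have -> : (1 - s) * (expR z * expR (x - z)) + s * (expR z * expR (y - z)) =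
  expR z * ((1 - s) * expR (x - z) + s * expR (y - z)) by ring.
rewrite -[leLHS]mulr1 ler_wpM2l ?expR_ge0//.
apply: (@le_trans _ _ ((1 - s) * (1 + (x - z)) + s * (1 + (y - z)))).
  by rewrite /z le_eqVlt; apply/orP; left; apply/eqP; ring.
by apply: lerD; rewrite ler_wpM2l//; lra.
Qed.

Lemma lap_conv s y : 0 <= s <= 1 -> 0 <= y -> lap (s * y) <= (1 - s) + s * lap y.
Proof.
move=> s01 y0; have /andP[s0 s1] := s01.
rewrite /lap -[X in X + _](Ex_cst P) -ExZ; last exact: exp_xi.
rewrite -ExD; [|exact: L1_cst|by apply: L1Z; exact: exp_xi].
apply: Ex_le => [||w]; first by apply: exp_xi; exact: mulr_ge0.
  by apply: L1D; [exact: L1_cst|by apply: L1Z; exact: exp_xi].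
have := expR_conv 0 (y * xi 0 w) s01.
by rewrite mulr0 add0r expR0 mulr1 mulrA.
Qed.

(** Convexity puts [lap x] on or below the chord from [lap 0 = 1] to [lap y > 1], which stays
    strictly below [lap y] before its right end. *)
Lemma lap_lt x y : 0 <= x -> x < y -> lap x < lap y.
Proof.
move=> x0 xy; have y0 : 0 < y by lra.
pose s := x / y.
have s1 : s < 1 by rewrite /s ltr_pdivrMr ?mul1r.
have s0 : 0 <= s by rewrite divr_ge0// ltW.
have s01 : 0 <= s <= 1 by rewrite s0 ltW.
have := lap_conv s01 (ltW y0); rewrite /s mulfVK ?gt_eqF// -/s => h.
have : 1 < lap y.
  by apply: lt_le_trans (lap_ge (ltW y0)); rewrite expR_gt1.
nra.
Qed.

Lemma psi_lt x y : 0 <= x -> x < y -> psi x < psi y.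
Proof.
move=> x0 xy; rewrite /psi ltr_ln ?posrE; first exact: lap_lt.
- exact: lap_gt0.
- by apply: lap_gt0; lra.
Qed.

(** For a value [z >= 0] of the increment, the difference of exponentials is at most
    [(y - x) z exp(y z)], and [z <= exp z] raises the exponent by one; hence [b + 1]. For negative
    [z] the difference is at most 0. *)
Lemma lap_lip b x y : 0 <= x -> x <= y -> y <= b ->
  lap y - lap x <= (y - x) * lap (b + 1).
Proof.
move=> x0 xy yb.
have Lx := exp_xi 0 x0.
have Ly : L1 P (fun w => expR (y * xi 0 w)) by apply: exp_xi; lra.
have Lb : L1 P (fun w => expR ((b + 1) * xi 0 w)) by apply: exp_xi; lra.
rewrite /lap -ExB// -ExZ//; apply: Ex_le => [||w]; [exact: L1B|exact: L1Z|].
set z := xi 0 w.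
have [z0|z0] := leP 0 z; last first.
  apply: (@le_trans _ _ 0); last by rewrite mulr_ge0 ?expR_ge0//; lra.
  by rewrite subr_le0 ler_expR ler_wnM2r// ltW.
have e1 := expR_ge1Dx (- ((y - x) * z)).
have -> : expR (x * z) = expR (y * z) * expR (- ((y - x) * z)).
  by rewrite -expRD; congr expR; ring.
apply: (@le_trans _ _ (expR (y * z) * ((y - x) * z))).
  have := expR_ge0 (y * z); nra.
rewrite mulrCA; apply: ler_wpM2l; first by lra.
  rewrite mulrDl mul1r expRD ler_pM ?expR_ge0// ?ler_expR.
    by rewrite ler_wpM2r.
  by apply: le_trans (expR_ge1Dx _); lra.
Qed.

Lemma psi_lip b x y : 0 <= x -> x <= y -> y <= b ->
  psi y - psi x <= (y - x) * lap (b + 1).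
Proof.
move=> x0 xy yb; apply: le_trans (lap_lip x0 xy yb).
apply: ln_sub_le; first by apply: le_trans (lap_ge x0); rewrite -expR0 ler_expR.
by move: xy; rewrite le_eqVlt => /orP[/eqP->//|xy]; exact/ltW/lap_lt.
Qed.

End laplace.

Lemma expR_quot_bounds (R : realType) (z h : R) : 0 < h ->
  z <= (expR (h^-1 * z) - 1) * h <= z * expR (h^-1 * z).
Proof.
move=> h0.
have e1 := expR_ge1Dx (h^-1 * z); have e2 := expR_ge1Dx (- (h^-1 * z)).
have hz : h * (h^-1 * z) = z by rewrite mulrA divff ?mul1r// gt_eqF.
have e3 := expRxMexpNx_1 (h^-1 * z); have e4 := expR_gt0 (h^-1 * z).
apply/andP; split; first by rewrite -{1}hz mulrC; apply: ler_wpM2r; lra.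
have e5 : expR (h^-1 * z) - 1 <= h^-1 * z * expR (h^-1 * z) by nra.
rewrite -[leRHS](_ : (h^-1 * z * expR (h^-1 * z)) * h = _).
  by apply: ler_wpM2r; lra.
by rewrite mulrAC [_ * h]mulrC hz.
Qed.

Lemma expR_quot_le (R : realType) (z h : R) : 1 <= h ->
  (expR (h^-1 * z) - 1) * h <= expR z.
Proof.
move=> h1; have h0 : 0 < h by lra.
have s01 : 0 <= h^-1 <= 1 by rewrite invr_ge0 invf_le1 ?h1// ltW.
have := expR_conv 0 z s01; rewrite mulr0 add0r expR0 mulr1 => hh.
have : h * expR (h^-1 * z) <= h * (1 - h^-1 + h^-1 * expR z).
  by apply: ler_wpM2l => //; exact: ltW.
have -> : h * (1 - h^-1 + h^-1 * expR z) = h - 1 + expR z.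
  by field; rewrite gt_eqF.
lra.
Qed.

(** * Slope at zero, continuity and inverse of the Laplace exponent *)

Section laplace2.
Context (d : measure_display) (T : measurableType d) (R : realType).
Context (P : probability T R) (X : R -> {RV P >-> R}).
Hypothesis X_ind : independent_increments X.
Hypothesis X_stat : stationary_increments X.
Hypothesis X_cadlag : {ae P, forall w, cadlag (fun t => X t w)}.
Hypothesis X_nnj : {ae P, forall w, no_negative_jumps (fun t => X t w)}.
Hypothesis X_0 : {ae P, forall w, X 0 w = 0}.
Hypothesis X_mean : ('E_P[X 1%R] = 0)%E.

Notation dl := (dl R).
Notation xi := (xi X).
Notation Ex := (Ex P).
Notation psi := (psi X).
Notation lap := (lap X).

Let mxi n : measurable_fun setT (xi n).
Proof. exact: Yinc_meas. Qed.

(** By dominated convergence the difference quotients at 0 tend to the mean of [xi 0], which is 1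
    because [X] is centred; the dominating function is [|z| + exp z]. *)
Let lap_deriv_seq : (lap (n.+1%:R^-1) - 1) * n.+1%:R @[n --> \oo] --> (1 : R).
Proof.
have [LX EX] := X1_mean X_mean.
have mx := mxi 0.
have u0 n : 0 <= (n.+1%:R^-1 : R) by rewrite invr_ge0.
have exi0 : Ex (xi 0) = 1.
  rewrite (@Ex_ae _ _ _ P _ (fun w => 1 - X 1 w)) ?ExB ?Ex_cst ?EX ?subr0//.
  - exact: L1_cst.
  - by meas.
  apply: filterS X_0 => w X0; rewrite xiE /Yhat X0 /dl expr0 invr1.
  by rewrite subr0 subr0.
have Lxi : L1 P (xi 0).
  apply: (@L1_ae _ _ _ P (fun w => 1 - X 1 w)) => //; last first.
    by apply: L1B => //; exact: L1_cst.
  apply: filterS X_0 => w X0; rewrite xiE /Yhat X0 /dl expr0 invr1.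
  by rewrite subr0 subr0.
have L1e n : L1 P (fun w => expR (n.+1%:R^-1 * xi 0 w)) by exact: exp_xi.
pose f n w := (expR (n.+1%:R^-1 * xi 0 w) - 1) * n.+1%:R.
have -> : (fun n => (lap (n.+1%:R^-1) - 1) * n.+1%:R) = (fun n => Ex (f n)).
  apply/funext => n; rewrite /lap -[X in _ - X](Ex_cst P) -ExB//; last exact: L1_cst.
  rewrite mulrC -ExZ; last by apply: L1B => //; exact: L1_cst.
  by apply: eq_Ex => w; rewrite /f mulrC.
rewrite -exi0.
have L1x : L1 P (fun w => expR (1 * xi 0 w)) by exact: exp_xi.
have mf n : measurable_fun setT (f n) by rewrite /f; meas.
have Ln : L1 P (fun w => `|xi 0 w|).
  exact: (integrable_abse Lxi).
have := @Ex_dct _ _ _ P f (xi 0) (fun w => `|xi 0 w| + expR (1 * xi 0 w)) mf mx.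
case => //.
- apply: nearW => w; set z := xi 0 w.
  apply: (@squeeze_cvgr _ _ _ _ (fun=> z) (fun n => z * expR (n.+1%:R^-1 * z))).
  - by apply: nearW => n; apply: expR_quot_bounds; rewrite ltr0n.
  - exact: cvg_cst.
  - have c0 : (n.+1%:R^-1 : R) @[n --> \oo] --> (0 : R) by exact: cvg_harmonic.
    have c1 : (n.+1%:R^-1 * z : R) @[n --> \oo] --> 0 * z by apply: cvgM => //; exact: cvg_cst.
    have c2 : expR (n.+1%:R^-1 * z) @[n --> \oo] --> expR (0 * z).
      by apply: continuous_cvg => //; exact: continuous_expR.
    rewrite mul0r expR0 in c2.
    by rewrite -[X in _ --> X]mulr1; apply: cvgM => //; exact: cvg_cst.
- exact: L1D.
- move=> n w; rewrite /f.
  have h0 : 0 < n.+1%:R :> R by rewrite ltr0n.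
  have h1 : 1 <= n.+1%:R :> R by rewrite ler1n.
  have /andP[hb _] := expR_quot_bounds (xi 0 w) h0.
  have hc := expR_quot_le (xi 0 w) h1.
  have e0 := expR_ge0 (1 * xi 0 w).
  have := ler_norm (xi 0 w); have := ler_norm (- xi 0 w); rewrite normrN => n1 n2.
  by rewrite mul1r in e0 *; rewrite ler_norml; apply/andP; split; lra.
Qed.

(** Convexity carries the bound from one point [1/(n+1)] to all smaller [h], and [psi <= lap - 1].
    With [psi_ge] as the matching lower bound, this determines the derivative at 0. *)
Lemma psi_slope e : 0 < e -> exists2 h0, 0 < h0 &
  forall h, 0 < h <= h0 -> psi h <= (1 + e) * h.
Proof.
move=> e0.
have : \forall n \near \oo, (lap (n.+1%:R^-1) - 1) * n.+1%:R < 1 + e.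
  by apply: (cvgr_lt _ lap_deriv_seq); lra.
move=> [n _ /(_ n (leqnn n))] hn.
exists (n.+1%:R^-1); first by rewrite invr_gt0.
move=> h /andP[h0 hh].
have n0 : 0 < n.+1%:R :> R by rewrite ltr0n.
pose s := h * n.+1%:R.
have s1 : 0 <= s <= 1.
  rewrite mulr_ge0 ?(ltW h0) ?(ltW n0)//=.
  have -> : 1 = n.+1%:R^-1 * n.+1%:R :> R by rewrite mulVf// gt_eqF.
  by apply: ler_wpM2r; [exact: ltW|].
have := lap_conv X_ind X_stat X_cadlag X_nnj s1 (ltW (_ : 0 < n.+1%:R^-1)).
rewrite invr_gt0 => /(_ n0).
rewrite (_ : s * n.+1%:R^-1 = h); last by rewrite /s mulfK// gt_eqF.
have h0' := ltW h0.
have := expR_ge1Dx (psi h); rewrite /psi lnK ?posrE; last exact: lap_gt0.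
have : s * (lap (n.+1%:R^-1) - 1) <= h * (1 + e).
  by rewrite /s -mulrA ler_wpM2l// mulrC ltW.
lra.
Qed.

Lemma right_derivative_psi : right_derivative (psi_hat X) 0 = 1.
Proof.
apply/cvg_lim => //; apply/cvgrPdist_le => e e0.
have [h0 h00 H] := psi_slope e0.
near=> h.
have h1 : 0 < h by [].
have h2 : h <= h0 by near: h; exact: nbhs_right_le.
rewrite add0r !psi_hatE// -/(psi h) -/(psi 0) psi0 subr0.
have := H h; rewrite h1 h2 => /(_ isT) h3.
have h4 : h <= psi h by apply: psi_ge => //; exact: ltW.
rewrite ler_norml; apply/andP; split.
  rewrite lerBrDl; have : psi h / h <= 1 + e by rewrite ler_pdivrMr.
  lra.
have : 1 <= psi h / h by rewrite ler_pdivlMr// mul1r.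
lra.
Unshelve. all: end_near. Qed.

Lemma psi_dist b u v : 0 <= u <= b -> 0 <= v <= b ->
  `|psi u - psi v| <= `|u - v| * lap (b + 1).
Proof.
have mono x y : 0 <= x -> x <= y -> psi x <= psi y.
  move=> x0; rewrite le_eqVlt => /orP[/eqP->//|xy].
  by rewrite ltW//; apply: psi_lt.
move=> /andP[u0 ub] /andP[v0 vb]; have [uv|vu] := leP u v.
  rewrite ler0_norm ?subr_le0 ?mono// ler0_norm ?subr_le0// !opprB.
  exact: psi_lip.
have uv := ltW vu; rewrite ger0_norm ?subr_ge0 ?mono// ger0_norm ?subr_ge0//.
by apply: psi_lip => //; exact: ltW.
Qed.

(** The maximum with 0 extends the exponent to the whole line, since moments are controlled only for
    nonnegative arguments. *)
Lemma psi_continuous : continuous (fun x : R => psi (Num.max 0 x)).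
Proof.
move=> x; apply/cvgrPdist_le => e e0.
pose b := `|x| + 1; pose C := lap (b + 1).
have b0 : 0 <= b by rewrite addr_ge0.
have C0 : 0 < C by apply: lap_gt0 => //; lra.
near=> y.
have h1 : `|x - y| <= 1 by near: y; apply: cvgr_dist_le.
have h2 : `|x - y| <= e / C by near: y; apply: cvgr_dist_le => //; exact: divr_gt0.
have nx := ler_norm x.
have xb : 0 <= Num.max 0 x <= b.
  by rewrite le_max lexx ge_max b0 /b; lra.
have yb : 0 <= Num.max 0 y <= b.
  rewrite le_max lexx ge_max b0 /b /=.
  by move: h1; rewrite ler_norml => /andP[? ?]; lra.
apply: (le_trans (psi_dist xb yb)); rewrite -/C.
rewrite ler_pdivlMr// in h2; apply: le_trans h2; apply: ler_wpM2r; first exact: ltW.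
have := ler_norm (x - y); have := ler_norm (- (x - y)); rewrite normrN => n1 n2.
have [x0|x0] := leP 0 x; have [y0|y0] := leP 0 y; rewrite ?subrr ?normr0//.
- by rewrite ler_norml; apply/andP; split; lra.
- by rewrite ler_norml; apply/andP; split; lra.
Unshelve. all: end_near. Qed.

(** As [psi 0 = 0] and [psi q >= q], the level [q] is attained on [[0, q]]; strict monotonicity
    makes the level set a singleton, so its supremum is the root. *)
Lemma Phi_hat_spec q : 0 < q -> 0 < Phi_hat X q /\ psi (Phi_hat X q) = q.
Proof.
move=> q0.
have cw : {within `[0, q], continuous (fun x : R => psi (Num.max 0 x))}.
  exact/continuous_subspaceT/psi_continuous.
have [|c] := IVT (ltW q0) cw (v := q).
  rewrite maxxx (max_r (ltW q0)) psi0 ge_min le_max ltW//=.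
  by rewrite psi_ge ?orbT// ltW.
rewrite in_itv/= => /andP[c0 cq]; rewrite (max_r c0) => pc.
have cpos : 0 < c.
  rewrite lt_def c0 andbT; apply: contraTneq q0 => c0'.
  by rewrite -pc c0' psi0 ltxx.
suff -> : Phi_hat X q = c by [].
rewrite /Phi_hat (_ : [set theta | _] = [set c]) ?sup1//.
apply/seteqP; split=> [t /= [t0]|t ->]; last by split => //; rewrite psi_hatE.
rewrite psi_hatE// -/(psi t) => pt.
have [tc|tc|//] := ltgtP t c.
  by have := psi_lt X_ind X_stat X_cadlag X_nnj X_0 X_mean t0 tc; rewrite pt pc ltxx.
by have := psi_lt X_ind X_stat X_cadlag X_nnj X_0 X_mean c0 tc; rewrite pt pc ltxx.
Qed.

End laplace2.

(** * First passage and the law of the supremum *)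

Section first_passage.
Context (d : measure_display) (T : measurableType d) (R : realType).
Context (P : probability T R).
Context (Z : nat -> T -> R) (xi : T -> R).
Hypothesis mZ : forall i, measurable_fun setT (Z i).
Hypothesis mxi : measurable_fun setT xi.
Hypothesis iZ : indep_seq P Z.
Hypothesis lZ : forall i, eqlaw P (Z i) xi.
Notation E := (Ex P).

Variables (u th p : R).
Hypotheses (u0 : 0 <= u) (th0 : 0 <= th) (p0 : 0 <= p).
Hypothesis Lxi : L1 P (fun w => expR (th * xi w)).
Hypothesis pE : p * E (fun w => expR (th * xi w)) = 1.

Definition stopped (x v : R) : R := if u < v then v else x + v.

Lemma stopped_measurable : measurable_fun setT (fun z : R * R => stopped z.1 z.2).
Proof. by rewrite /stopped; meas. Qed.

Notation c := (chain stopped 0 Z).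

Let mc k : measurable_fun setT (c k).
Proof. exact: (chain_meas stopped_measurable). Qed.

Let mcS k : measurable_fun setT (fun w => stopped (Z k w) (c k w)).
Proof. exact: (mc k.+1). Qed.

Let LZ k : L1 P (fun w => expR (th * Z k w)).
Proof.
apply: (@L1_eqlaw _ _ _ P xi (Z k) (fun x => expR (th * x))) => //; last by meas.
by move=> A mA; rewrite lZ.
Qed.

Let EZ k : E (fun w => expR (th * Z k w)) = E (fun w => expR (th * xi w)).
Proof.
by apply: (@Ex_eqlaw _ _ _ P (Z k) xi (fun x => expR (th * x))) => //; meas.
Qed.

Definition alive k w : R := (c k w <= u)%R%:R * expR (th * c k w).
(** Since the walk is frozen above [u], this is a first passage, at time [k + 1]; the events for
    different [k] are disjoint. *)
Definition passage k w : R := ((c k w <= u) && (u < c k.+1 w))%R%:R.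

Let m_alive k : measurable_fun setT (alive k).
Proof. by have := mc k; rewrite /alive => mck; meas. Qed.

Lemma passage_meas k : measurable_fun setT (passage k).
Proof.
have mck := mc k; have mck1 := mc k.+1; apply: measurable_bR.
by apply: measurable_and; [apply: measurable_fun_ler|apply: measurable_fun_ltr].
Qed.

Let alive_le k w : 0 <= alive k w <= expR (th * u).
Proof.
rewrite /alive; have [cu|_] := leP (c k w) u; last by rewrite mul0r lexx expR_ge0.
by rewrite mul1r expR_ge0 ler_expR ler_wpM2l.
Qed.

Let L1_alive k : L1 P (alive k).
Proof.
apply: (L1_bnd (expR (th * u))) => // w.
by have /andP[a0 a1] := alive_le k w; rewrite ger0_norm.
Qed.

Let alive_split k w : alive k w * expR (th * Z k w) =
  alive k.+1 w + passage k w * expR (th * c k.+1 w).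
Proof.
rewrite /alive /passage /= /stopped.
have [cu|cu] := leP (c k w) u; last by rewrite !mul0r addr0 leNgt cu mul0r.
rewrite mul1r -expRD -mulrDr [c k w + _]addrC.
by have [h|h] := leP (Z k w + c k w) u; rewrite ?mul0r ?mul1r ?add0r ?addr0.
Qed.

Let L1_pe k : L1 P (fun w => passage k w * expR (th * c k.+1 w)).
Proof.
have mck := mc k.+1; have mp := passage_meas k.
apply: (L1_dom (g := fun w => expR (th * u) * expR (th * Z k w))).
- by meas.
- exact: L1Z.
move=> w; have /andP[a0 a1] := alive_le k w; have /andP[b0 _] := alive_le k.+1 w.
have pe0 : 0 <= passage k w * expR (th * c k.+1 w).
  by rewrite mulr_ge0 ?expR_ge0// ler0n.
rewrite ger0_norm//; apply: (@le_trans _ _ (alive k w * expR (th * Z k w))).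
  by rewrite alive_split lerDr.
by rewrite ler_wpM2r ?expR_ge0.
Qed.

Let alive_step k : E (alive k) =
  p * E (alive k.+1) + p * E (fun w => passage k w * expR (th * c k.+1 w)).
Proof.
rewrite -mulrDr -ExD//.
have i2 : indep2 P (fun w => alive k w) (fun w => expR (th * Z k w)).
  apply: (@indep2_comp _ _ _ P (c k) (Z k)
    (fun v => (v <= u)%R%:R * expR (th * v)) (fun x => expR (th * x))); [by meas|by meas|].
  by apply: indep2_sym; exact: (chain_indep stopped_measurable).
have [_ e] := indep2_ExM i2 (L1_alive k) (LZ k)
  (fun w => (andP (alive_le k w)).1) (fun w => expR_ge0 _).
have -> : E (fun w => alive k.+1 w + passage k w * expR (th * c k.+1 w)) =
    E (fun w => alive k w * expR (th * Z k w)).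
  by apply: eq_Ex => w; rewrite alive_split.
by rewrite e EZ mulrCA pE mulr1.
Qed.

(* Optional stopping for the martingale [p^k exp (th S_k)]. *)
Lemma passage_sum K : 1 = p ^+ K * E (alive K) +
  \sum_(k < K) p ^+ k.+1 * E (fun w => passage k w * expR (th * c k.+1 w)).
Proof.
elim: K => [|K IH].
  rewrite big_ord0 addr0 expr0 mul1r -[LHS](Ex_cst P); apply: eq_Ex => w.
  by rewrite /alive /= u0 mulr0 expR0 mul1r.
rewrite [LHS]IH alive_step big_ord_recr/= mulrDr !mulrA -exprSr.
by rewrite -!addrA; congr (_ + _); rewrite addrC.
Qed.

Lemma passage_sum_le K :
  \sum_(k < K) p ^+ k.+1 * E (passage k) <= expR (- (th * u)).
Proof.
rewrite -(ler_pM2l (expR_gt0 (th * u))) -expRD subrr expR0.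
rewrite [leRHS](passage_sum K) -[leLHS]add0r; apply: lerD.
  by rewrite mulr_ge0 ?exprn_ge0// Ex_ge0// => w; case/andP: (alive_le K w).
rewrite big_distrr/=; apply: ler_sum => k _; rewrite mulrCA ler_wpM2l ?exprn_ge0//.
have Lp : L1 P (passage k).
  apply: (L1_bnd 1); first exact: passage_meas.
  by move=> w; rewrite /passage; case: (_ && _); rewrite ?normr1 ?normr0.
rewrite -ExZ//; apply: Ex_le => // [|w]; first exact: L1Z.
rewrite mulrC /passage.
have [cu|_] := leP (c k w) u; last by rewrite !mul0r.
have [uc|_] := ltP u (c k.+1 w); last by rewrite !mul0r.
by rewrite !mul1r ler_expR ler_wpM2l// ltW.
Qed.

(** At passage the walk is at most [u + eps], unless the last step exceeds [eps]; then it is at most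
    [u] plus that step, which is charged to the second term. The part still below [u] at time [K]
    contributes at most [p ^+ K] times [exp(th u)]. *)
Lemma passage_sum_ge K eps : 0 <= eps ->
  1 <= expR (th * (u + eps)) * (\sum_(k < K) p ^+ k.+1 * E (passage k)) +
    expR (th * u) * ((\sum_(k < K) p ^+ k.+1) *
      E (fun w => (eps < xi w)%R%:R * expR (th * xi w)) + p ^+ K).
Proof.
move=> e0; rewrite [leLHS](passage_sum K) [X in _ <= _ + X]mulrDr addrA [leLHS]addrC.
apply: lerD; last first.
  rewrite mulrC; apply: ler_wpM2r; first exact: exprn_ge0.
  by apply: Ex_le_cst => // w; case/andP: (alive_le K w).
rewrite mulrA !big_distrr/= big_distrl/= -big_split/=; apply: ler_sum => k _.
have Lp : L1 P (passage k).
  apply: (L1_bnd 1); first exact: passage_meas.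
  by move=> w; rewrite /passage; case: (_ && _); rewrite ?normr1 ?normr0.
have mzk := mZ k.
have Lj : L1 P (fun w => (eps < Z k w)%R%:R * expR (th * Z k w)).
  apply: (L1_dom _ (LZ k)) => [|w]; first by meas.
  by case: (_ < _); rewrite ?mul1r ?mul0r ?normr0 ?expR_ge0// ger0_norm ?expR_ge0.
have -> : E (fun w => (eps < xi w)%R%:R * expR (th * xi w)) =
    E (fun w => (eps < Z k w)%R%:R * expR (th * Z k w)).
  symmetry; apply: (@Ex_eqlaw _ _ _ P (Z k) xi (fun x => (eps < x)%R%:R * expR (th * x))) => //.
  by meas.
have re (x y z : R) : expR (th * (u + eps)) * (p ^+ k.+1 * x) + y * p ^+ k.+1 * z =
    p ^+ k.+1 * (expR (th * (u + eps)) * x + y * z) by ring.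
rewrite re; apply: ler_wpM2l; first exact: exprn_ge0.
rewrite -!ExZ// -ExD; [|exact: L1Z|exact: L1Z].
apply: Ex_le => // [|w]; first by apply: L1D; exact: L1Z.
rewrite /passage.
have [cu|_] := leP (c k w) u; last first.
  by rewrite /= mul0r addr_ge0// ?mulr_ge0 ?expR_ge0 ?ler0n.
have [uc|_] := ltP u (c k.+1 w); last first.
  by rewrite /= mul0r addr_ge0// ?mulr_ge0 ?expR_ge0 ?ler0n.
rewrite /= mul1r mulr1 /stopped ltNge cu /=.
have [ez|ez] := ltP eps (Z k w); last first.
  by rewrite mul0r mulr0 addr0 ler_expR ler_wpM2l//; lra.
rewrite mul1r -expRD -mulrDr -[leLHS]add0r; apply: lerD; first exact: expR_ge0.
by rewrite ler_expR ler_wpM2l//; lra.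
Qed.

End first_passage.

Fixpoint bmax (R : realType) (T : Type) (f : nat -> T -> R) (K : nat) (w : T) : R :=
  if K is K'.+1 then Num.max (f K' w) (bmax f K' w) else 0.

Section bmax_theory.
Context (R : realType) (T : Type).
Implicit Type f : nat -> T -> R.

Lemma bmax_ge0 f K w : 0 <= bmax f K w.
Proof. by elim: K => [|K IH] //=; rewrite le_max IH orbT. Qed.

Lemma eq_bmax f g K w : (forall j, f j w = g j w) -> bmax f K w = bmax g K w.
Proof. by move=> fg; elim: K => [//|K IH] /=; rewrite fg IH. Qed.

Lemma bmax_ge f K w j : (j < K)%N -> f j w <= bmax f K w.
Proof.
elim: K => [//|K IH]; rewrite ltnS leq_eqVlt => /orP[/eqP->|jK] /=.
  by rewrite le_max lexx.
by rewrite le_max IH// orbT.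
Qed.

Lemma bmax_le f K w u : 0 <= u -> (forall j, (j < K)%N -> f j w <= u) -> bmax f K w <= u.
Proof.
move=> u0; elim: K => [//|K IH] fu /=; rewrite ge_max fu// IH// => j jK.
by apply: fu; exact: ltnW.
Qed.

Lemma bmax_ex f K w : bmax f K w = 0 \/ exists2 j, (j < K)%N & bmax f K w = f j w.
Proof.
elim: K => [|K IH] /=; first by left.
have [h|h] := leP (f K w) (bmax f K w).
  by case: IH => [->|[j jK ->]]; [left|right; exists j => //; exact: leqW].
by right; exists K.
Qed.

End bmax_theory.

Lemma bmax_measurable (d : measure_display) (T : measurableType d) (R : realType)
  (f : nat -> T -> R) K : (forall j, measurable_fun setT (f j)) ->
  measurable_fun setT (bmax f K).
Proof.
move=> mf; elim: K => [|K IH] /=; first exact: measurable_cst.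
exact: measurable_maxr.
Qed.

Lemma chain_smeas_sub (d : measure_display) (T : measurableType d) (R : realType)
  (W Z : nat -> T -> R) (D : set nat) (phi : R -> R -> R) v0 k :
  measurable_fun setT (fun z : R * R => phi z.1 z.2) ->
  (forall i, (i < k)%N -> smeas W D (Z i)) -> smeas W D (chain phi v0 Z k).
Proof.
move=> mphi; elim: k => [|k IH] kD; first exact: measurable_cst.
apply: (measurableT_comp mphi (measurable_fun_pair _ _)); first exact: kD.
by apply: IH => i ik; apply: kD; exact: ltnW.
Qed.

Section stopped_path.
Context (d : measure_display) (T : measurableType d) (R : realType).
Variables (f : nat -> T -> R) (u : R) (w : T).
Hypothesis f0 : f 0%N w = 0.
Hypothesis u0 : 0 <= u.
Notation c := (chain (stopped u) 0 (fun j w => f j.+1 w - f j w)).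

Let c_le k : c k w <= u -> c k w = f k w /\ forall j, (j <= k)%N -> f j w <= u.
Proof.
elim: k => [_|k IH] /=.
  by split=> // j; rewrite leqn0 => /eqP->; rewrite f0.
rewrite /stopped; have [uc cu|cu] := ltP u (c k w).
  by move: (lt_le_trans uc cu); rewrite ltxx.
have [-> fu] := IH cu; rewrite subrK => fk1; split=> // j.
by rewrite leq_eqVlt ltnS => /orP[/eqP->//|]; exact: fu.
Qed.

Let c_gt k : u < c k w -> exists2 j, (j <= k)%N & u < f j w.
Proof.
elim: k => [|k IH] /=; first by rewrite ltNge u0.
rewrite /stopped; have [/IH[j jk fj] _|cu] := ltP u (c k w).
  by exists j => //; exact: leqW.
have [-> _] := c_le cu; rewrite subrK => h; by exists k.+1.
Qed.

(** A maximum over grid times up to [e] exceeds [u] exactly when the first passage time is at most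
    [e]. At most one summand is nonzero, so the indicator becomes linear in the disjoint passage
    events. *)
Lemma passage_count (dt e : R) K : 0 <= dt ->
  (u < bmax (fun j w => if j%:R * dt <= e then f j w else 0) K.+1 w)%R%:R =
  \sum_(k < K) (k.+1%:R * dt <= e)%R%:R *
    ((c k w <= u) && (u < c k.+1 w))%R%:R :> R.
Proof.
move=> dt0; elim: K => [|K IH].
  rewrite big_ord0 /= f0 if_same ltNge (_ : Num.max _ _ = 0) ?u0//.
  exact: maxxx.
rewrite big_ord_recr -IH/=; set g := fun j w => _.
set b := bmax g K w.
have [cu|cu] := leP (c K w) u.
  have [cf fu] := c_le cu.
  have gu j : (j <= K)%N -> g j w <= u by move=> jK; rewrite /g; case: ifP => // _; exact: fu.
  have bu : b <= u by apply: bmax_le => // j jK; apply: gu; exact: ltnW.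
  rewrite !lt_max (ltNge u b) bu (ltNge u (g K w)) gu//= !orbF.
  rewrite add0r /g; have [ke|ke] := leP (K.+1%:R * dt) e; last by rewrite mul0r ltNge u0.
  by rewrite /stopped (ltNge u (c K w)) cu/= cf subrK mul1r.
rewrite mulr0 addr0; congr (nat_of_bool _)%:R.
rewrite lt_max; case: (ltP u (g K.+1 w)) => //= h.
have [j jK uf] := c_gt cu.
symmetry; have : g j w <= bmax g K.+1 w by exact: bmax_ge.
apply: lt_le_trans; rewrite /g.
move: h; rewrite /g; have [ke _|_] := leP (K.+1%:R * dt) e; last by rewrite ltNge u0.
rewrite ifT//; apply: le_trans ke; rewrite ler_wpM2r// ler_nat.
exact: leqW.
Qed.

End stopped_path.

(** With [t] the mesh and [p1], [p2] the Laplace exponent at [th] and [2 th], the left side is the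
    mean of [(exp(th xi) - 1)^2]; it is of the order of the mesh. *)
Lemma exp_square_bound (R : realType) (t p1 p2 : R) : 0 <= t <= 1 -> 0 <= p1 -> 0 <= p2 ->
  expR (t * p2) - 2 * expR (t * p1) + 1 <= t * (p2 * expR p2).
Proof.
move=> /andP[t0 t1] p10 p20.
have e1 : 1 <= expR (t * p1) by rewrite -expR0 ler_expR mulr_ge0.
have a0 : 0 <= t * p2 by exact: mulr_ge0.
have ea : expR (t * p2) - 1 <= t * p2 * expR (t * p2).
  move: (expR_ge1Dx (- (t * p2))) (expRxMexpNx_1 (t * p2)) (expR_gt0 (t * p2)).
  by set b := expR (- _); set c := expR _; nra.
have ea2 : expR (t * p2) <= expR p2 by rewrite ler_expR ler_piMl.
rewrite mulrA; apply: (@le_trans _ _ (t * p2 * expR (t * p2))); first by lra.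
by apply: ler_wpM2l.
Qed.

(* Above the level [M] the exponential is dominated by the square
   [(exp (th z) - 1)^2], which is a combination of exponential moments vanishing
   at [z = 0]. *)
Lemma exp_truncation (R : realType) (th M eps z : R) : 0 < th -> 1 <= th * M ->
  (eps < z)%R%:R * expR (th * z) <= expR (th * M) * (eps < z)%R%:R +
    expR (- (th * M)) * (4 * (expR (th *+ 2 * z) - 2 * expR (th * z) + 1)).
Proof.
move=> th0 M1.
have sqE : expR (th *+ 2 * z) = expR (th * z) ^+ 2.
  by rewrite expr2 -expRD; congr expR; rewrite mulr2n; ring.
rewrite sqE; set y := expR (th * z).
have y0 : 0 < y by exact: expR_gt0.
have s0 : 0 <= expR (- (th * M)) * (4 * (y ^+ 2 - 2 * y + 1)).
  rewrite mulr_ge0 ?expR_ge0// (_ : y ^+ 2 - 2 * y + 1 = (y - 1) ^+ 2); last by ring.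
  by rewrite mulr_ge0 ?sqr_ge0.
have [ez|ez] := ltP eps z; last by rewrite mul0r mulr0 add0r.
rewrite mul1r mulr1.
have [zM|zM] := leP z M.
  rewrite -[leLHS]addr0; apply: lerD => //.
  by rewrite /y ler_expR ler_pM2l.
rewrite -[leLHS]add0r; apply: lerD; first exact: expR_ge0.
(* Here [1 <= th * M] is used: [y >= 2] gives [y^2 <= 4 (y - 1)^2], the origin of the constant 4. *)
have y2 : 2 <= y.
  have : 1 <= th * z by apply: (le_trans M1); rewrite ler_pM2l// ltW.
  by have := expR_ge1Dx (th * z); rewrite -/y; lra.
have yM : 1 <= expR (- (th * M)) * y.
  rewrite /y -expRD -expR0 ler_expR addrC subr_ge0.
  by rewrite ler_pM2l// ltW.
have -> : expR (- (th * M)) * (4 * (y ^+ 2 - 2 * y + 1)) =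
  (expR (- (th * M)) * y) * (y * (4 * (y ^+ 2 - 2 * y + 1) / y ^+ 2)).
  by field; rewrite gt_eqF.
have h1 : 1 <= 4 * (y ^+ 2 - 2 * y + 1) / y ^+ 2.
  by rewrite ler_pdivlMr ?exprn_gt0// mul1r; nra.
apply: (@le_trans _ _ (1 * (y * 1))); first by rewrite mul1r mulr1.
by apply: ler_pM => //; [rewrite mulr1 ltW|apply: ler_wpM2l => //; exact: ltW].
Qed.

Lemma exp_cutoff (R : realType) (th D e : R) : 0 < th -> 0 <= D -> 0 < e ->
  exists2 M, 1 <= th * M & expR (- (th * M)) * D <= e.
Proof.
move=> th0 D0 e0; have h0 : 0 <= D / e by rewrite divr_ge0// ltW.
exists ((1 + D / e) / th); rewrite [th * _]mulrC divfK ?gt_eqF//; first by rewrite lerDl.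
rewrite expRN mulrC ler_pdivrMr ?expR_gt0//.
rewrite -[leLHS](divfK (x := e)) ?gt_eqF// mulrC ler_wpM2l ?ltW//.
by have := expR_ge1Dx (1 + D / e); lra.
Qed.

Section sup_tail.
Context (d : measure_display) (T : measurableType d) (R : realType).
Context (P : probability T R) (X : R -> {RV P >-> R}).
Hypothesis X_ind : independent_increments X.
Hypothesis X_stat : stationary_increments X.
Hypothesis X_cadlag : {ae P, forall w, cadlag (fun t => X t w)}.
Hypothesis X_nnj : {ae P, forall w, no_negative_jumps (fun t => X t w)}.
Hypothesis X_0 : {ae P, forall w, X 0 w = 0}.
Hypothesis X_mean : ('E_P[X 1%R] = 0)%E.

Notation Yhat := (Yhat X).
Notation dl := (dl R).
Notation xi := (xi X).
Notation Ex := (Ex P).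
Notation psi := (psi X).

Let mxi n : measurable_fun setT (xi n).
Proof. exact: Yinc_meas. Qed.

(** After truncation at [M], the bounded part is [exp(th M)] times the quantity of [jump_rate], and
    the rest is at most [exp(- th M)] times a constant that does not depend on [n]. [M] is fixed
    before [n] tends to infinity. *)
Lemma jump_exp_rate th eps : 0 < th -> 0 < eps ->
  (2 ^ n)%:R * Ex (fun w => (eps < xi n w)%R%:R * expR (th * xi n w)) @[n --> \oo] --> (0 : R).
Proof.
move=> th0 e0.
have th20 : 0 <= th *+ 2 by rewrite mulrn_wge0// ltW.
pose D := 4 * (psi (th *+ 2) * expR (psi (th *+ 2))).
have D0 : 0 <= D.
  have := psi_ge X_ind X_stat X_cadlag X_nnj X_0 X_mean th20 => h.
  by rewrite /D mulr_ge0// mulr_ge0 ?expR_ge0//; exact: le_trans h.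
have L n := exp_xi X_ind X_stat X_cadlag X_nnj n (ltW th0).
have L2 n := exp_xi X_ind X_stat X_cadlag X_nnj n th20.
have key M n : 1 <= th * M ->
  (2 ^ n)%:R * Ex (fun w => (eps < xi n w)%R%:R * expR (th * xi n w)) <=
  expR (th * M) * ((2 ^ n)%:R * Ex (fun w => (eps < xi n w)%R%:R)) + expR (- (th * M)) * D.
  move=> M1; have mx := mxi n.
  have Lb : L1 P (fun w => (eps < xi n w)%R%:R) by apply: L1_bool; meas.
  have Le : L1 P (fun w => (eps < xi n w)%R%:R * expR (th * xi n w)).
    apply: (L1_dom _ (L n)) => [|w]; first by meas.
    by case: (_ < _); rewrite ?mul1r ?mul0r ?normr0 ?expR_ge0// ger0_norm ?expR_ge0.
  have Lsq : L1 P (fun w => expR (th *+ 2 * xi n w) - 2 * expR (th * xi n w) + 1).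
    by apply: L1D; [apply: L1B => //; exact: L1Z|exact: L1_cst].
  have sq : (2 ^ n)%:R * Ex (fun w => expR (th *+ 2 * xi n w) - 2 * expR (th * xi n w) + 1)
      <= psi (th *+ 2) * expR (psi (th *+ 2)).
    rewrite ExD//; [|by apply: L1B => //; exact: L1Z|exact: L1_cst].
    rewrite ExB//; last exact: L1Z.
    rewrite ExZ// Ex_cst !exp_xiE ?(ltW th0)//.
    have p1 := psi_ge X_ind X_stat X_cadlag X_nnj X_0 X_mean (ltW th0).
    have p2 := psi_ge X_ind X_stat X_cadlag X_nnj X_0 X_mean th20.
    have dn : 0 <= dl n <= 1.
      rewrite (ltW (dl_gt0 R n)) -(dl_pow R n) ler_peMl ?(ltW (dl_gt0 R n))//.
      by rewrite ler1n expn_gt0.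
    have := exp_square_bound dn (le_trans (ltW th0) p1) (le_trans th20 p2).
    move=> /(ler_wpM2l (ler0n R (2 ^ n))); rewrite [X in _ <= X -> _]mulrA dl_pow mul1r.
    exact.
  apply: (@le_trans _ _ ((2 ^ n)%:R * (expR (th * M) * Ex (fun w => (eps < xi n w)%R%:R) +
      expR (- (th * M)) * (4 * Ex (fun w => expR (th *+ 2 * xi n w) - 2 * expR (th * xi n w) + 1))))).
    apply: ler_wpM2l; first exact: ler0n.
    rewrite -!ExZ//; last exact: L1Z.
    rewrite -ExD; [|exact: L1Z|by do 2 apply: L1Z].
    apply: Ex_le => // [|w]; first by apply: L1D; [exact: L1Z|by do 2 apply: L1Z].
    exact: exp_truncation.
  rewrite mulrDr; apply: lerD; first by rewrite mulrCA.
  rewrite mulrCA; apply: ler_wpM2l; first exact: expR_ge0.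
  by rewrite mulrCA /D ler_wpM2l.
apply/cvgrPdist_le => e e00.
have e20 : 0 < e / 2 by rewrite divr_gt0.
have [M M1 Me] := exp_cutoff th0 D0 e20.
have c0 := jump_rate X_ind X_stat X_cadlag X_nnj e0.
have eM : 0 < e / 2 / expR (th * M) by rewrite !divr_gt0// ?expR_gt0.
move/cvgrPdist_le : c0 => /(_ _ eM).
apply: filterS => n; rewrite !sub0r !normrN => h.
have J0 : 0 <= (2 ^ n)%:R * Ex (fun w => (eps < xi n w)%R%:R * expR (th * xi n w)).
  rewrite mulr_ge0 ?ler0n//; apply: Ex_ge0 => w.
  by rewrite mulr_ge0 ?ler0n ?expR_ge0.
rewrite ger0_norm//; apply: (le_trans (key M n M1)).
rewrite [leRHS](splitr e).
apply: lerD => //.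
have := le_trans (ler_norm _) h; rewrite ler_pdivlMr ?expR_gt0//.
by rewrite mulrC.
Qed.

End sup_tail.

Lemma exponential_tail (d : measure_display) (T : measurableType d) (R : realType)
    (P : probability T R) (e : {RV P >-> R}) (q t : R) : 0 < q ->
  exponentially_distributed e q -> 0 < t ->
  Ex P (fun w => (t <= e w)%R%:R) = expR (- (q * t)).
Proof.
move=> q0 ee t0.
have mB : measurable (`]-oo, t[%classic : set R) by exact: measurable_itv.
have h := ee _ mB.
have mA : measurable (e @^-1` `]-oo, t[) by rewrite -[X in measurable X]setTI; exact: measurable_funP.
have /(congr1 fine) := probability_setC P mA.
have -> : ~` (e @^-1` `]-oo, t[) = [set w | t <= e w].
  apply/seteqP; split=> w /=; rewrite in_itv/= ltNge.
    by move/negP/negPn.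
  by move=> ->.
rewrite Ex_b; last by apply: measurable_fun_ler => //; exact: measurable_cst.
rewrite /= => ->.
have -> : P (e @^-1` `]-oo, t[) = (1 - expR (- q * t))%:E.
  transitivity (distribution P e `]-oo, t[) => //; rewrite h.
  rewrite EFinB -(exponential_prob_itv0c q t0) /exponential_prob.
  rewrite (integral_itv_bndo_bndc (a := -oo%O)); last first.
    by apply/measurable_EFinP/measurable_funTS; exact: measurable_exponential_pdf.
  have -> : [set` `]-oo, t] : interval R] = `]-oo, 0[ `|` `[0, t] :> set R.
    rewrite -itv_bndbnd_setU ?bnd_simp//; exact: ltW.
  rewrite ge0_integral_setU//=.
  - rewrite integral0_eq ?add0e// => x /=; rewrite in_itv/= => x0.
    by rewrite lt0_exponential_pdf.
  - by apply/measurable_EFinP/measurable_funTS; exact: measurable_exponential_pdf.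
  - by move=> x _; rewrite lee_fin exponential_pdf_ge0// ltW.
  - apply/disj_setPS => x [] /=; rewrite !in_itv/= => x0 /andP[x1 _].
    by move: (lt_le_trans x0 x1); rewrite ltxx.
by rewrite /= opprB addrC subrK mulNr.
Qed.

(** With [t = th u] and [s = th eps], this turns the multiplicative estimate into an additive error
    free of [t], hence uniform in the level. *)
Lemma passage_lower (R : realType) (t s S K K' : R) :
  0 <= t -> 0 <= s -> 0 <= K -> K <= K' ->
  1 <= expR (t + s) * S + expR t * K -> expR (- t) - S <= s + K'.
Proof.
move=> t0 s0 K0 KK; rewrite expRD expRN; set A := expR t; set B := expR s => H.
have A0 : 0 < A by exact: expR_gt0.
have A1 : 1 <= A by rewrite /A -expR0 ler_expR.
have B0 : 0 < B by exact: expR_gt0.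
have B1 : 1 <= B by rewrite /B -expR0 ler_expR.
have C1 : 1 - s <= B^-1 by rewrite -expRN; exact: expR_ge1Dx.
have h1 : (A * B)^-1 <= S + K.
  rewrite -[leLHS]mul1r ler_pdivrMr ?mulr_gt0//; apply: (le_trans H).
  have : A * K <= A * B * K.
    by rewrite -mulrA; apply: ler_wpM2l; [exact: ltW|rewrite ler_peMl].
  by move=> ?; rewrite mulrDl; lra.
have h2 : A^-1 - (A * B)^-1 <= s.
  have Ai0 : 0 < A^-1 by rewrite invr_gt0.
  have Ai1 : A^-1 <= 1 by rewrite invf_le1.
  by rewrite invfM; move: Ai0 Ai1 C1 s0; set a := A^-1; set b := B^-1; clear; nra.
by move: h1 h2 KK; clear; lra.
Qed.

Lemma expR_geo_sum (R : realType) (a : R) K : 0 < a ->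
  \sum_(k < K) expR (- a) ^+ k.+1 <= a^-1.
Proof.
move=> a0.
have p1 : expR (- a) < 1 by rewrite expR_lt1 oppr_lt0.
have p0 : 0 < expR (- a) by exact: expR_gt0.
have -> : \sum_(k < K) expR (- a) ^+ k.+1 = expR (- a) * \sum_(k < K) expR (- a) ^+ k.
  by rewrite big_distrr/=; apply: eq_bigr => k _; rewrite exprS.
apply: (@le_trans _ _ (expR (- a) * (1 - expR (- a))^-1)).
  by rewrite ler_wpM2l ?(ltW p0)// geo_sum_le// ltW.
have y0 : 0 < 1 - expR (- a) by rewrite subr_gt0.
rewrite ler_pdivrMr// mulrC ler_pdivlMr//.
by move: (expR_ge1Dx a) (expRxMexpNx_1 a) p0; set b := expR a; set c := expR _; nra.
Qed.

(** * The supremum of -Y up to the exponential time *)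

Section sup_law.
Context (d : measure_display) (T : measurableType d) (R : realType).
Context (P : probability T R) (X : R -> {RV P >-> R}).
Hypothesis X_ind : independent_increments X.
Hypothesis X_stat : stationary_increments X.
Hypothesis X_cadlag : {ae P, forall w, cadlag (fun t => X t w)}.
Hypothesis X_nnj : {ae P, forall w, no_negative_jumps (fun t => X t w)}.
Hypothesis X_0 : {ae P, forall w, X 0 w = 0}.
Hypothesis X_mean : ('E_P[X 1%R] = 0)%E.
Variables (q : R) (e : {RV P >-> R}).
Hypotheses (q0 : 0 < q) (ee : exponentially_distributed e q).
Hypothesis e_indep : independent_of_process e X.

Notation Yhat := (Yhat X).
Notation dl := (dl R).
Notation xi := (xi X).
Notation Ex := (Ex P).
Notation psi := (psi X).

Let mxi n : measurable_fun setT (xi n).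
Proof. exact: Yinc_meas. Qed.

(* Grid approximation of the supremum of [Yhat] over [[0, e]]. *)
Definition Sn n : T -> R :=
  bmax (fun j w => if j%:R * dl n <= e w then Yhat (j%:R * dl n) w - Yhat 0 w else 0)
    (n * 2 ^ n).+1.

Let p n := expR (- (q * dl n)).

Variable Phi : R.
Hypotheses (Phi0 : 0 < Phi) (PhiE : psi Phi = q).

(** The clock [e] is independent of the walk and reaches [(k + 1) dl n] with probability
    [p n ^+ k.+1], so killing at [e] becomes discounting of the first passage time. *)
Lemma Sn_passage n u : 0 <= u ->
  Ex (fun w => (u < Sn n w)%R%:R) =
  \sum_(k < n * 2 ^ n) p n ^+ k.+1 * Ex (passage (Yinc X 0 (dl n)) u k).
Proof.
move=> u0; have dn := dl_gt0 R n.
have mZ i : measurable_fun setT (Yinc X 0 (dl n) i) by exact: Yinc_meas.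
pose W := ext e (Yinc X 0 (dl n)).
have mW i : measurable_fun setT (W i) by exact: ext_meas.
have iW : indep_seq P W by apply: ext_indep => //; exact: ltW.
have ZE k w : chain (stopped u) 0 (Yinc X 0 (dl n)) k w =
   chain (stopped u) 0 (fun j w => (fun j w => Yhat (j%:R * dl n) w - Yhat 0 w) j.+1 w -
     (fun j w => Yhat (j%:R * dl n) w - Yhat 0 w) j w) k w.
  elim: k => [//|k IH] /=; rewrite IH; congr (stopped _ _ _).
  by rewrite /Yinc !add0r; ring.
have -> : (fun w => (u < Sn n w)%R%:R) = (fun w => \sum_(k < n * 2 ^ n)
    (k.+1%:R * dl n <= e w)%R%:R * passage (Yinc X 0 (dl n)) u k w).
  apply/funext => w; rewrite /Sn.
  have f0 : Yhat (0%:R * dl n) w - Yhat 0 w = 0 by rewrite mul0r subrr.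
  rewrite (@eq_bmax _ _ _ (fun j w' => if j%:R * dl n <= e w
    then Yhat (j%:R * dl n) w' - Yhat 0 w' else 0))//.
  rewrite (@passage_count _ T R (fun j w => Yhat (j%:R * dl n) w - Yhat 0 w) u w
    f0 u0 (dl n) (e w) _ (ltW dn)).
  by apply: eq_bigr => k _; rewrite /passage !ZE.
have mp k : measurable_fun setT (passage (Yinc X 0 (dl n)) u k) by exact: passage_meas.
have Lp k : L1 P (passage (Yinc X 0 (dl n)) u k).
  apply: (L1_bnd 1) => // w.
  by rewrite /passage; case: (_ && _); rewrite ?normr1 ?normr0.
have me k : measurable_fun setT (fun w => (k.+1%:R * dl n <= e w)).
  by apply: measurable_fun_ler => //; exact: measurable_cst.
have Le k : L1 P (fun w => (k.+1%:R * dl n <= e w)%R%:R) by exact: L1_bool.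
have ind k : indep2 P (fun w => (k.+1%:R * dl n <= e w)%R%:R) (passage (Yinc X 0 (dl n)) u k).
  apply: (@indep2_smeas _ _ _ P W [set 0%N] [set i | (0 < i)%N]) => //.
  - by apply/seteqP; split=> // i [/= ->].
  - apply: measurable_bR; apply: measurable_fun_ler; first exact: measurable_cst.
    exact: (@smeas_Z _ _ _ W [set 0%N] 0%N).
  - have sm j : smeas W [set i | (0 < i)%N] (chain (stopped u) 0 (Yinc X 0 (dl n)) j).
      apply: chain_smeas_sub; first exact: stopped_measurable.
      by move=> i _; exact: (@smeas_Z _ _ _ W [set i | (0 < i)%N] i.+1).
    apply: measurable_bR; apply: measurable_and; apply: measurable_fun_ler || apply: measurable_fun_ltr.
    + exact: sm.
    + exact: measurable_cst.
    + exact: measurable_cst.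
    + exact: (sm k.+1).
have Lep k : L1 P (fun w => (k.+1%:R * dl n <= e w)%R%:R * passage (Yinc X 0 (dl n)) u k w) /\
   Ex (fun w => (k.+1%:R * dl n <= e w)%R%:R * passage (Yinc X 0 (dl n)) u k w) =
   Ex (fun w => (k.+1%:R * dl n <= e w)%R%:R) * Ex (passage (Yinc X 0 (dl n)) u k).
  by apply: indep2_ExM => // w; exact: ler0n.
rewrite (@Ex_sum _ _ _ P _ (fun k w => (k.+1%:R * dl n <= e w)%R%:R *
   passage (Yinc X 0 (dl n)) u k w)); last by move=> k; case: (Lep k).
apply: eq_bigr => k _; rewrite (Lep k).2; congr (_ * _).
rewrite (exponential_tail q0 ee); last by rewrite mulr_gt0 ?ltr0n.
by rewrite /p -expRM_natl; congr expR; ring.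
Qed.

Lemma Sn_tail eta : 0 < eta -> \forall n \near \oo, forall u, 0 <= u ->
  expR (- (Phi * u)) - eta <= Ex (fun w => (u < Sn n w)%R%:R) <= expR (- (Phi * u)).
Proof.
move=> eta0.
pose J eps n := Ex (fun w => (eps < xi n w)%R%:R * expR (Phi * xi n w)).
(* The error has three parts, each allotted [eta / 3]: the permitted overshoot [Phi * eps], the
   large steps, and survival up to the horizon, [exp(- q n)]. *)
pose eps := eta / (3 * Phi).
have eps0 : 0 < eps by rewrite divr_gt0// mulr_gt0.
have qn n : 0 < q * dl n by rewrite mulr_gt0// dl_gt0.
have lo u n : 0 <= u ->
    expR (- (Phi * u)) - Ex (fun w => (u < Sn n w)%R%:R) <=
    Phi * eps + ((2 ^ n)%:R * J eps n) / q + expR (- (q * n%:R)).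
  move=> u0; rewrite Sn_passage//; set S := \sum_(k < _) _.
  have d0 := ltW (dl_gt0 R n).
  have mZ i : measurable_fun setT (Yinc X 0 (dl n) i) by exact: Yinc_meas.
  have L := exp_xi X_ind X_stat X_cadlag X_nnj n (ltW Phi0).
  have pE : p n * Ex (fun w => expR (Phi * xi n w)) = 1.
    by rewrite exp_xiE ?(ltW Phi0)// PhiE /p mulrC [q * _]mulrC expRxMexpNx_1.
  have := passage_sum_ge mZ (mxi n) (Yinc_indep 0 d0 X_ind)
    (fun i => Yinc_law 0 i d0 X_stat) u0 (ltW Phi0) (expR_ge0 _) L pE (n * 2 ^ n) (ltW eps0).
  rewrite -/S -/(J eps n).
  have J0 : 0 <= J eps n.
    by apply: Ex_ge0 => w; rewrite mulr_ge0 ?ler0n ?expR_ge0.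
  have pK : p n ^+ (n * 2 ^ n) = expR (- (q * n%:R)).
    rewrite /p -expRM_natl; congr expR; rewrite natrM mulrN; congr (- _).
    by rewrite [q * dl n]mulrC !mulrA -[_ * _ * dl n]mulrA dl_pow mulr1 mulrC.
  have sp : \sum_(k < n * 2 ^ n) p n ^+ k.+1 <= (2 ^ n)%:R / q.
    rewrite (le_trans (expR_geo_sum _ (qn n)))// /dl invfM invrK natrX.
    by rewrite mulrC.
  rewrite pK mulrDr => H.
  rewrite -addrA; apply: (passage_lower (K := (\sum_(k < n * 2 ^ n) p n ^+ k.+1) * J eps n + expR (- (q * n%:R)))).
  - by rewrite mulr_ge0// ltW.
  - by rewrite mulr_ge0// ltW.
  - rewrite addr_ge0 ?expR_ge0// mulr_ge0// sumr_ge0// => k _.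
    by rewrite exprn_ge0// expR_ge0.
  - by rewrite lerD2r mulrAC ler_wpM2r.
  - exact: H.
have up u n : 0 <= u -> Ex (fun w => (u < Sn n w)%R%:R) <= expR (- (Phi * u)).
  move=> u0; rewrite Sn_passage//.
  have d0 := ltW (dl_gt0 R n).
  have mZ i : measurable_fun setT (Yinc X 0 (dl n) i) by exact: Yinc_meas.
  have L := exp_xi X_ind X_stat X_cadlag X_nnj n (ltW Phi0).
  have pE : p n * Ex (fun w => expR (Phi * xi n w)) = 1.
    by rewrite exp_xiE ?(ltW Phi0)// PhiE /p mulrC [q * _]mulrC expRxMexpNx_1.
  exact: (passage_sum_le mZ (mxi n) (Yinc_indep 0 d0 X_ind)
    (fun i => Yinc_law 0 i d0 X_stat) u0 (ltW Phi0) (expR_ge0 _) L pE).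
have Jc := jump_exp_rate X_ind X_stat X_cadlag X_nnj X_0 X_mean Phi0 eps0.
have eq3 : 0 < eta / 3 * q by rewrite mulr_gt0//; lra.
move/cvgrPdist_le : Jc => /(_ _ eq3) h1.
have h2 : \forall n \near \oo, expR (- (q * n%:R)) <= eta / 3.
  near=> n.
  have : 3 / eta / q <= n%:R by near: n; exact: nbhs_infty_ger.
  rewrite ler_pdivrMr// => hn; rewrite expRN -[leRHS]invrK lef_pV2 ?posrE ?expR_gt0 ?invr_gt0//.
    by rewrite invf_div mulrC; apply: le_trans (expR_ge1Dx _); lra.
  by lra.
apply: filterS2 h1 h2 => n; rewrite sub0r normrN => h1 h2 u u0.
rewrite up// andbT lerBlDr -lerBlDl (le_trans (lo u n u0))//.
have e3 : Phi * eps = eta / 3 by rewrite /eps; field; rewrite gt_eqF.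
have : (2 ^ n)%:R * J eps n / q <= eta / 3.
  by rewrite ler_pdivrMr//; exact: le_trans (ler_norm _) h1.
rewrite e3; lra.
Unshelve. all: end_near. Qed.

End sup_law.

(** * The Lindley recursion and the law of Q(0) *)

Section lindley_pointwise.
Context (R : realType).
Implicit Types x y v z eps : R.

Definition lindley (z v : R) : R := Num.max 0 (v - z).

(** One of [max 0 (v - z)] and [max 0 (z - v)] vanishes, so one exponential is 1 and the other is
    [exp(- x (v - z))]. *)
Lemma lindley_exp x z v :
  expR (- (x * lindley z v)) + expR (x * Num.max 0 (z - v)) =
  expR (- (x * v)) * expR (x * z) + 1.
Proof.
rewrite /lindley -expRD.
have -> : - (x * v) + x * z = - (x * (v - z)) by ring.
have [h|h] := leP 0 (v - z); have [h'|h'] := leP 0 (z - v).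
- have -> : v = z by lra.
  by rewrite subrr mulr0 oppr0 expR0.
- by rewrite mulr0 expR0.
- by rewrite mulr0 oppr0 expR0 addrC; congr (expR _ + _); ring.
- lra.
Qed.

Lemma exp_excess_lower x (x' : R) y : 0 < x' -> x' <= x -> 0 <= y ->
  x / x' * (expR (x' * y) - 1) <= expR (x * y) - 1.
Proof.
move=> x'0 xx y0; have x0 : 0 < x by lra.
have s01 : 0 <= x' / x <= 1.
  by apply/andP; split; [apply: divr_ge0; lra|rewrite ler_pdivrMr// mul1r].
have := expR_conv 0 (x * y) s01; rewrite mulr0 add0r expR0 mulr1 mulrA divfK ?gt_eqF// => h.
rewrite mulrAC ler_pdivrMr//.
have -> : (expR (x * y) - 1) * x' = x * (x' / x * (expR (x * y) - 1)).
  by field; rewrite gt_eqF.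
by apply: ler_wpM2l; [exact: ltW|lra].
Qed.

(** For [y <= eps], [exp(x y) - 1 <= x y exp(x eps)] while [exp(x' y) - 1 >= x' y], so the excess is
    nearly linear in [x]. A value [y > eps] needs [z > eps] and is charged to the jump term. *)
Lemma exp_excess_upper x (x' : R) eps z v : 0 < x' -> x' <= x -> 0 <= v ->
  expR (x * Num.max 0 (z - v)) - 1 <=
  x / x' * expR (x * eps) * (expR (x' * Num.max 0 (z - v)) - 1) +
  (eps < z)%R%:R * expR (x * z).
Proof.
move=> x'0 xx v0; have x0 : 0 < x by lra.
set y := Num.max 0 _.
have y0 : 0 <= y by rewrite le_max lexx.
have j0 : 0 <= (eps < z)%R%:R * expR (x * z) by rewrite mulr_ge0 ?ler0n ?expR_ge0.
have e1 : 0 <= x / x' * expR (x * eps) by rewrite mulr_ge0 ?expR_ge0// divr_ge0// ltW.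
have e2 := expR_ge1Dx (x' * y).
have m0 : 0 <= x' * y by rewrite mulr_ge0// ltW.
have [ye|ye] := leP y eps.
  rewrite -[leLHS]addr0; apply: lerD => //.
  apply: (@le_trans _ _ (x / x' * expR (x * eps) * (x' * y))); last first.
    by apply: ler_wpM2l => //; lra.
  have -> : x / x' * expR (x * eps) * (x' * y) = (x * y) * expR (x * eps).
    by field; rewrite gt_eqF.
  apply: (@le_trans _ _ ((x * y) * expR (x * y))).
    move: (expR_ge1Dx (- (x * y))) (expRxMexpNx_1 (x * y)) (expR_gt0 (x * y)).
    by set b := expR (- _); set c := expR _; nra.
  by rewrite ler_wpM2l ?mulr_ge0 ?(ltW x0)// ler_expR ler_pM2l.
rewrite -[leLHS]add0r; apply: lerD; first by rewrite mulr_ge0//; lra.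
have [h|h] := leP 0 (z - v); last first.
  have -> : y = 0 by rewrite /y; apply/max_idPl/ltW.
  by rewrite mulr0 expR0 subrr.
have yE : y = z - v by rewrite /y; apply/max_idPr.
have ez : eps < z by lra.
rewrite ez mul1r (@le_trans _ _ (expR (x * y)))//; first by lra.
by rewrite ler_expR ler_pM2l// yE; lra.
Qed.

End lindley_pointwise.

Section lindley_iid.
Context (d : measure_display) (T : measurableType d) (R : realType).
Context (P : probability T R).
Context (Z : nat -> T -> R) (xi : T -> R).
Hypothesis mZ : forall i, measurable_fun setT (Z i).
Hypothesis mxi : measurable_fun setT xi.
Hypothesis iZ : indep_seq P Z.
Hypothesis lZ : forall i, eqlaw P (Z i) xi.
Hypothesis Lxi : forall x, 0 <= x -> L1 P (fun w => expR (x * xi w)).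
Notation E := (Ex P).

Lemma lindley_measurable :
  measurable_fun setT (fun z : R * R => lindley z.1 z.2).
Proof. by rewrite /lindley; meas. Qed.

Notation c := (chain (@lindley R) 0 Z).

Let mc k : measurable_fun setT (c k).
Proof. exact: (chain_meas lindley_measurable). Qed.

Lemma lindley_ge0 k w : 0 <= c k w.
Proof. by case: k => [|k] //=; rewrite /lindley le_max lexx. Qed.

Definition lt_lind k x : R := E (fun w => expR (- (x * c k w))).
Definition excess k x : R := E (fun w => expR (x * Num.max 0 (Z k w - c k w)) - 1).

Let LZ k x : 0 <= x -> L1 P (fun w => expR (x * Z k w)).
Proof.
move=> x0; apply: (@L1_eqlaw _ _ _ P xi (Z k) (fun z => expR (x * z))) => //; last exact: Lxi.
  by move=> A mA; rewrite lZ.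
by meas.
Qed.

Let Lc k x : 0 <= x -> L1 P (fun w => expR (- (x * c k w))).
Proof.
move=> x0; apply: (L1_bnd 1) => [|w]; first by have mck := mc k; meas.
by rewrite ger0_norm ?expR_ge0// expR_le1 oppr_le0 mulr_ge0// lindley_ge0.
Qed.

Lemma lt_lind_le1 k x : 0 <= x -> lt_lind k x <= 1.
Proof.
move=> x0; apply: Ex_le_cst => [|w]; first exact: Lc.
by rewrite expR_le1 oppr_le0 mulr_ge0// lindley_ge0.
Qed.

Lemma lt_lind_ge0 k x : 0 <= lt_lind k x.
Proof. by apply: Ex_ge0 => w; exact: expR_ge0. Qed.

Let Lm k x : 0 <= x -> L1 P (fun w => expR (x * Num.max 0 (Z k w - c k w))).
Proof.
move=> x0; have mck := mc k; have mzk := mZ k.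
apply: (L1_dom (g := fun w => 1 + expR (x * Z k w))); first by meas.
  by apply: L1D; [exact: L1_cst|exact: LZ].
move=> w; rewrite ger0_norm ?expR_ge0//.
have [h|h] := leP 0 (Z k w - c k w); last first.
  by rewrite mulr0 expR0 lerDl expR_ge0.
rewrite -[leLHS]add0r; apply: lerD => //.
by rewrite ler_expR; apply: ler_wpM2l => //; rewrite lerBlDr lerDl lindley_ge0.
Qed.

Let Lex k x : 0 <= x -> L1 P (fun w => expR (x * Num.max 0 (Z k w - c k w)) - 1).
Proof. by move=> x0; apply: L1B; [exact: Lm|exact: L1_cst]. Qed.

Lemma excessE k x : 0 <= x ->
  excess k x = E (fun w => expR (x * xi w)) * lt_lind k x - lt_lind k.+1 x.
Proof.
move=> x0.
have me : measurable_fun setT (fun z : R => expR (x * z)) by meas.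
have mm : measurable_fun setT (fun z : R => expR (- (x * z))) by meas.
have i2 := indep2_comp mm me (indep2_sym (chain_indep lindley_measurable 0 k mZ iZ)).
have [L e] := indep2_ExM i2 (Lc k x0) (LZ k x0) (fun w => expR_ge0 _) (fun w => expR_ge0 _).
have eZ : E (fun w => expR (x * Z k w)) = E (fun w => expR (x * xi w)).
  by apply: (@Ex_eqlaw _ _ _ P (Z k) xi (fun z => expR (x * z))) => // z; exact: expR_ge0.
rewrite /excess ExB; [|exact: Lm|exact: L1_cst].
have : E (fun w => expR (- (x * c k.+1 w)) + expR (x * Num.max 0 (Z k w - c k w))) =
   E (fun w => expR (- (x * c k w)) * expR (x * Z k w) + 1).
  by apply: eq_Ex => w; exact: lindley_exp.
rewrite ExD; [|exact: Lc|exact: Lm].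
rewrite ExD//; last exact: L1_cst.
rewrite e eZ Ex_cst -/(lt_lind k x) -/(lt_lind k.+1 x) mulrC => h.
by apply/eqP; rewrite subr_eq addrAC -h addrAC subrr add0r.
Qed.

Lemma excess_lower k x x' : 0 < x' -> x' <= x ->
  x / x' * excess k x' <= excess k x.
Proof.
move=> x'0 xx; have x0 : 0 <= x by lra.
rewrite -ExZ; last exact/Lex/ltW.
apply: Ex_le => [||w]; [by apply/L1Z/Lex/ltW|exact: Lex|].
by apply: exp_excess_lower => //; rewrite le_max lexx.
Qed.

Lemma excess_upper k x x' eps : 0 < x' -> x' <= x ->
  excess k x <= x / x' * expR (x * eps) * excess k x' +
    E (fun w => (eps < xi w)%R%:R * expR (x * xi w)).
Proof.
move=> x'0 xx; have x0 : 0 <= x by lra.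
have mzk := mZ k.
have Lj : L1 P (fun w => (eps < Z k w)%R%:R * expR (x * Z k w)).
  apply: (L1_dom _ (LZ k x0)) => [|w]; first by meas.
  by case: (_ < _); rewrite ?mul1r ?mul0r ?normr0 ?expR_ge0// ger0_norm ?expR_ge0.
have -> : E (fun w => (eps < xi w)%R%:R * expR (x * xi w)) =
    E (fun w => (eps < Z k w)%R%:R * expR (x * Z k w)).
  symmetry; apply: (@Ex_eqlaw _ _ _ P (Z k) xi (fun z => (eps < z)%R%:R * expR (x * z))) => //.
  by meas.
rewrite -ExZ; last exact/Lex/ltW.
rewrite -ExD//; last by apply/L1Z/Lex/ltW.
apply: Ex_le => [||w]; first exact: Lex.
  by apply: L1D => //; apply/L1Z/Lex/ltW.
by apply: exp_excess_upper => //; exact: lindley_ge0.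
Qed.

Lemma lt_lind_cvg1 k (u : nat -> R) : (forall n, 0 <= u n) ->
  u n @[n --> \oo] --> (0 : R) -> lt_lind k (u n) @[n --> \oo] --> (1 : R).
Proof.
move=> u0 uc; have mck := mc k.
have [] := @Ex_dct _ _ _ P (fun n w => expR (- (u n * c k w))) (fun=> 1) (fun=> 1).
- by move=> n; meas.
- exact: measurable_cst.
- apply: nearW => w.
  have c1 : - (u n * c k w) @[n --> \oo] --> (0 : R).
    have c2 : (u n * c k w : R) @[n --> \oo] --> 0 * c k w by apply: cvgM => //; exact: cvg_cst.
    by rewrite mul0r in c2; rewrite -[X in _ --> X]oppr0; exact: (cvgN c2).
  have : expR (- (u n * c k w)) @[n --> \oo] --> expR 0.
    by apply: continuous_cvg => //; exact: continuous_expR.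
  by rewrite expR0.
- exact: L1_cst.
- move=> n w; rewrite ger0_norm ?expR_ge0// expR_le1 oppr_le0 mulr_ge0//.
  exact: lindley_ge0.
by move=> _; rewrite Ex_cst.
Qed.

End lindley_iid.

Section telescoping.
Context (R : realFieldType).
Variables (g e : nat -> R) (a : R).
Hypothesis a0 : 0 <= a.
Hypothesis g01 : forall k, 0 <= g k <= 1.
Hypothesis gd : forall k, g k.+1 <= g k.
Hypothesis eE : forall k, e k = a * g k + (g k - g k.+1).

Let g_anti k l : (k <= l)%N -> g l <= g k.
Proof.
elim: l => [|l IH]; first by rewrite leqn0 => /eqP->.
rewrite leq_eqVlt => /orP[/eqP->//|kl]; exact: le_trans (gd l) (IH kl).
Qed.

(** In use, [g k] is the transform of the [k]-th Lindley state, [e k] the excess and [a] the growth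
    per step. The sum runs over [K] indices starting at [K], where [g] is at most [g K]; the
    decrements of [g] telescope to at most 1. *)
Lemma telescope_lower b K : (forall k, b <= e k) -> K%:R * b - 1 <= K%:R * (a * g K).
Proof.
move=> be.
have H L : L%:R * b - (g K - g (K + L)%N) <= L%:R * (a * g K).
  elim: L => [|L IH]; first by rewrite !mul0r addn0 subrr subr0.
  rewrite -natr1 mulrDl mul1r [leRHS]mulrDl mul1r addnS.
  have h1 := be (K + L)%N; rewrite eE in h1.
  have h2 : a * g (K + L)%N <= a * g K by apply: ler_wpM2l => //; apply: g_anti; exact: leq_addr.
  lra.
have := H K; have /andP[_ h1] := g01 K; have /andP[h2 _] := g01 (K + K)%N; lra.
Qed.

Lemma telescope_le K : \sum_(i < K) e i <= K%:R * a + 1.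
Proof.
have H : \sum_(i < K) e i <= K%:R * a + (g 0%N - g K).
  elim: K => [|K IH]; first by rewrite big_ord0 mul0r subrr addr0.
  rewrite big_ord_recr/= eE -natr1 mulrDl mul1r.
  have /andP[_ h1] := g01 K.
  have h2 : a * g K <= a by rewrite -[leRHS]mulr1; exact: ler_wpM2l.
  lra.
have /andP[_ h1] := g01 0; have /andP[h2 _] := g01 K; lra.
Qed.

(** The sum runs instead over the indices below [K], where [g] is at least [g K]; both bounds then
    concern the same quantity. *)
Lemma telescope_upper (e' : nat -> R) C J K : (forall k, e k <= C * e' k + J) ->
  K%:R * (a * g K) <= C * \sum_(i < K) e' i + K%:R * J.
Proof.
move=> ee.
have H L : (L <= K)%N -> L%:R * (a * g K) <= C * \sum_(i < L) e' i + L%:R * J.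
  elim: L => [|L IH] LK; first by rewrite big_ord0 !mul0r mulr0 addr0.
  rewrite big_ord_recr/= -natr1 !mulrDl !mul1r [C * _]mulrDr.
  have h2 : a * g K <= a * g L by apply: ler_wpM2l => //; apply: g_anti; exact: ltnW.
  have := IH (ltnW LK); have := ee L; have := gd L; rewrite eE; lra.
exact: H.
Qed.

End telescoping.

(** * The Laplace transform of Q(0) *)

Section pollaczek_khinchine.
Context (d : measure_display) (T : measurableType d) (R : realType).
Context (P : probability T R) (X : R -> {RV P >-> R}).
Hypothesis X_ind : independent_increments X.
Hypothesis X_stat : stationary_increments X.
Hypothesis X_cadlag : {ae P, forall w, cadlag (fun t => X t w)}.
Hypothesis X_nnj : {ae P, forall w, no_negative_jumps (fun t => X t w)}.
Hypothesis X_0 : {ae P, forall w, X 0 w = 0}.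
Hypothesis X_mean : ('E_P[X 1%R] = 0)%E.

Notation Yhat := (Yhat X).
Notation dl := (dl R).
Notation xi := (xi X).
Notation Ex := (Ex P).
Notation psi := (psi X).

Let mxi n : measurable_fun setT (xi n).
Proof. exact: Yinc_meas. Qed.

Definition Qk n K : T -> R :=
  bmax (fun j w => Yhat (- (j%:R * dl n)) w - Yhat 0 w) K.+1.

(* Grid approximation of [Q(0)], with mesh [2^-n] and horizon [n]. *)
Definition Qn n : T -> R := Qk n (n * 2 ^ n).

Lemma Qk_meas n K : measurable_fun setT (Qk n K).
Proof. by apply: bmax_measurable => j; apply: measurable_funB; exact: Yhat_meas. Qed.

Lemma lindley_path s n k w :
  (forall j, (j <= k)%N -> Yhat (s + j%:R * dl n) w - Yhat (s + k%:R * dl n) w <=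
     chain (@lindley R) 0 (Yinc X s (dl n)) k w) /\
  (exists2 j, (j <= k)%N & chain (@lindley R) 0 (Yinc X s (dl n)) k w =
     Yhat (s + j%:R * dl n) w - Yhat (s + k%:R * dl n) w).
Proof.
elim: k => [|k [IH1 [j0 j0k IH2]]] /=.
  split; first by move=> j; rewrite leqn0 => /eqP->; rewrite subrr.
  by exists 0%N => //; rewrite subrr.
rewrite /lindley; split.
  move=> j; rewrite leq_eqVlt ltnS => /orP[/eqP->|jk]; first by rewrite subrr le_max lexx.
  by rewrite le_max; apply/orP; right; have := IH1 j jk; rewrite /Yinc; lra.
have [h|h] := leP 0 (chain (@lindley R) 0 (Yinc X s (dl n)) k w - Yinc X s (dl n) k w).
  by exists j0; [exact: leqW|rewrite IH2 /Yinc; lra].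
by exists k.+1 => //; rewrite subrr.
Qed.

(** The maximum looks back from time 0, the recursion runs forward from [- K dl]; index [j] on one
    side is [K - j] on the other. *)
Lemma QkE n K w : Qk n K w = chain (@lindley R) 0 (Yinc X (- (K%:R * dl n)) (dl n)) K w.
Proof.
have [H1 [j0 j0k H2]] := lindley_path (- (K%:R * dl n)) n K w.
have idx j : (j <= K)%N -> - (K%:R * dl n) + j%:R * dl n = - ((K - j)%:R * dl n).
  by move=> jK; rewrite natrB//; ring.
apply/eqP; rewrite eq_le; apply/andP; split.
  apply: bmax_le => [|j]; first exact: lindley_ge0.
  rewrite ltnS => jK; have := H1 (K - j)%N (leq_subr _ _).
  by rewrite idx ?leq_subr// subKn// addNr.
rewrite H2 idx// addNr.
apply: (bmax_ge (fun j w => Yhat (- (j%:R * dl n)) w - Yhat 0 w)).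
by rewrite ltnS leq_subr.
Qed.

Lemma Qk_nd n K w : Qk n K w <= Qk n K.+1 w.
Proof.
apply: bmax_le => [|j jK]; first exact: bmax_ge0.
by apply: (bmax_ge (fun j w => Yhat (- (j%:R * dl n)) w - Yhat 0 w)); exact: ltnW.
Qed.

Let Zn n := Yinc X 0 (dl n).
Let mZ n i : measurable_fun setT (Zn n i).
Proof. exact: Yinc_meas. Qed.
Let iZ n : indep_seq P (Zn n).
Proof. by apply: Yinc_indep => //; exact/ltW/dl_gt0. Qed.
Let lZ n i : eqlaw P (Zn n i) (xi n).
Proof. by apply: Yinc_law => //; exact/ltW/dl_gt0. Qed.
Let Lxi n x : 0 <= x -> L1 P (fun w => expR (x * xi n w)).
Proof. exact: exp_xi. Qed.

Let g n k x := lt_lind P (Zn n) k x.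

Lemma Qk_laplace n K x : Ex (fun w => expR (- (x * Qk n K w))) = g n K x.
Proof.
have d0 := ltW (dl_gt0 R n).
have ml := @lindley_measurable R.
have mm : measurable_fun setT (fun z : R => expR (- (x * z))) by meas.
under [LHS]eq_Ex do rewrite QkE.
apply: (@Ex_eqlaw _ _ _ P (chain (@lindley R) 0 (Yinc X (- (K%:R * dl n)) (dl n)) K)
  (chain (@lindley R) 0 (Zn n) K) (fun z => expR (- (x * z)))) => //.
- by apply: chain_meas => // i; exact: Yinc_meas.
- exact: chain_meas.
- apply: chain_law => //; first by move=> i; exact: Yinc_meas.
    exact: Yinc_indep.
  by move=> i A mA; rewrite lZ//; apply: Yinc_law.
Qed.

Let g01 n x : 0 <= x -> forall k, 0 <= g n k x <= 1.
Proof.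
move=> x0 k; rewrite lt_lind_ge0 (@lt_lind_le1 _ _ _ P (Zn n))//.
Qed.

(** A Lindley path is not monotone in [k], but its state has the law of [Qk], a maximum over a
    growing window, which is. *)
Let gd n x : 0 <= x -> forall k, g n k.+1 x <= g n k x.
Proof.
move=> x0 k; rewrite -!Qk_laplace.
have Q0 K w : 0 <= Qk n K w by exact: bmax_ge0.
have L K : L1 P (fun w => expR (- (x * Qk n K w))).
  apply: (L1_bnd 1) => [|w]; first by have mq := Qk_meas n K; meas.
  by rewrite ger0_norm ?expR_ge0// expR_le1 oppr_le0 mulr_ge0.
by apply: Ex_le => // w; rewrite ler_expR lerN2 ler_wpM2l// Qk_nd.
Qed.

Definition growth n x : R := (2 ^ n)%:R * (expR (dl n * psi x) - 1).

Lemma growth_ge n x : psi x <= growth n x.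
Proof.
apply: (@le_trans _ _ ((2 ^ n)%:R * (dl n * psi x))); first by rewrite mulrA dl_pow mul1r.
apply: ler_wpM2l; first exact: ler0n.
by rewrite lerBrDl; exact: expR_ge1Dx.
Qed.

Lemma growth_cvg x : growth n x @[n --> \oo] --> psi x.
Proof.
apply: (@squeeze_cvgr _ _ _ _ (fun=> psi x) (fun n => psi x * expR (dl n * psi x))).
- apply: nearW => n; rewrite growth_ge /growth /=.
  have -> : psi x * expR (dl n * psi x) = (2 ^ n)%:R * ((dl n * psi x) * expR (dl n * psi x)).
    by rewrite !mulrA dl_pow mul1r.
  apply: ler_wpM2l; first exact: ler0n.
  set b := dl n * psi x.
  have := expR_ge1Dx (- b); rewrite expRN => h.
  rewrite -[X in X - 1]mul1r -{2}(mulVf (x := expR b)) ?gt_eqF ?expR_gt0// -mulrBl.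
  by rewrite ler_wpM2r ?expR_ge0// lerBlDr -lerBlDl.
- exact: cvg_cst.
- have c1 : (dl n * psi x : R) @[n --> \oo] --> 0 * psi x.
    by apply: cvgM; [exact: dl_cvg0|exact: cvg_cst].
  have c2 : expR (dl n * psi x) @[n --> \oo] --> expR (0 * psi x).
    by apply: continuous_cvg => //; exact: continuous_expR.
  rewrite mul0r expR0 in c2.
  by rewrite -[X in _ --> X]mulr1; apply: cvgM => //; exact: cvg_cst.
Qed.

Let e n k x := excess P (Zn n) k x.
Let a n x := expR (dl n * psi x) - 1.

Let a_ge n x : 0 <= x -> dl n * x <= a n x.
Proof.
move=> x0; rewrite /a lerBrDl; apply: le_trans (expR_ge1Dx _).
rewrite lerD2l; apply: ler_wpM2l; first exact/ltW/dl_gt0.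
exact: psi_ge.
Qed.

Let a0 n x : 0 <= x -> 0 <= a n x.
Proof. by move=> x0; apply: le_trans (a_ge n x0); rewrite mulr_ge0// ltW// dl_gt0. Qed.

Let eE n x : 0 <= x -> forall k, e n k x = a n x * g n k x + (g n k x - g n k.+1 x).
Proof.
move=> x0 k; rewrite /e (@excessE _ _ _ P (Zn n) (xi n))//; last exact: Lxi.
rewrite exp_xiE// -/(g n k x) -/(g n k.+1 x) /a mulrBl mul1r.
by rewrite addrA subrK.
Qed.

(** Slopes from the origin increase, so [e n k x / x] is at least [e n k x' / x'] for small [x'].
    There the decrement of [g] is nonnegative, the growth term is at least [dl n * x'] times
    [g n k x'], and the last factor tends to 1 with [x' -> 0]. *)
Let e_lower n k x : 0 < x -> dl n * x <= e n k x.
Proof.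
move=> x0.
pose u m : R := x * m.+2%:R^-1.
have u0 m : 0 < u m by rewrite mulr_gt0// invr_gt0.
have ux m : u m <= x.
  by rewrite ger_pMr// invf_le1 ?ler1n// ltr0n.
have uc : u m @[m --> \oo] --> (0 : R).
  have h : (m.+2%:R^-1 : R) @[m --> \oo] --> (0 : R).
    apply: (@squeeze_cvgr _ _ _ _ (fun=> 0) (fun m => m.+1%:R^-1)).
    - apply: nearW => m; apply/andP; split; first by rewrite invr_ge0.
      rewrite lef_pV2 ?posrE ?ltr0n//. by rewrite ler_nat.
    - exact: cvg_cst.
    - exact: cvg_harmonic.
  have : (x * m.+2%:R^-1 : R) @[m --> \oo] --> x * 0 by apply: cvgM => //; exact: cvg_cst.
  by rewrite mulr0.
have gc : g n k (u m) @[m --> \oo] --> (1 : R).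
  by apply: (@lt_lind_cvg1 _ _ _ P (Zn n)) => // m; exact: ltW.
have gc2 : (dl n * x * g n k (u m) : R) @[m --> \oo] --> dl n * x * 1.
  by apply: cvgM => //; exact: cvg_cst.
rewrite mulr1 in gc2.
apply: (cvgr_to_le gc2); apply: nearW => m.
apply: le_trans (@excess_lower _ _ _ P (Zn n) (xi n) (mZ n) (@mxi n) (lZ n) (@Lxi n) k x (u m) (u0 m) (ux m)).
rewrite -/(e n k (u m)) eE ?(ltW (u0 m))//.
have h1 : 0 <= g n k (u m) - g n k.+1 (u m) by rewrite subr_ge0 gd// ltW.
have h2 := a_ge n (ltW (u0 m)).
have /andP[h3 _] := g01 n (ltW (u0 m)) k.
have h4 : 0 <= x / u m by rewrite divr_ge0// ltW.
apply: (@le_trans _ _ (x / u m * (a n (u m) * g n k (u m)))); last first.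
  by apply: ler_wpM2l => //; rewrite lerDl.
rewrite mulrA; apply: ler_wpM2r => //.
have -> : dl n * x = x / u m * (dl n * u m) by field; rewrite gt_eqF.
by apply: ler_wpM2l.
Qed.

Let G n x := growth n x * g n (n * 2 ^ n) x.

Let KE n (r : R) : (n * 2 ^ n)%:R * r = n%:R * ((2 ^ n)%:R * r).
Proof. by rewrite natrM mulrA. Qed.

Let G_lower n x : 0 < x -> (0 < n)%N -> x - n%:R^-1 <= G n x.
Proof.
move=> x0 n0; have n0' : 0 < n%:R :> R by rewrite ltr0n.
have := telescope_lower (a0 n (ltW x0)) (g01 n (ltW x0)) (gd n (ltW x0))
  (eE n (ltW x0)) (n * 2 ^ n) (fun k => e_lower n k x0).
have gE : (n * 2 ^ n)%:R * (a n x * g n (n * 2 ^ n)%N x) = n%:R * G n x.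
  by rewrite KE [in LHS](mulrA (2 ^ n)%:R).
have xE : (n * 2 ^ n)%:R * (dl n * x) = n%:R * x by rewrite KE (mulrA (2 ^ n)%:R) dl_pow mul1r.
rewrite gE xE => h.
rewrite -(ler_pM2l n0') mulrBr divff ?gt_eqF//.
Qed.

Let G_upper n x x' eps : 0 < x' -> x' <= x -> (0 < n)%N ->
  G n x <= x / x' * expR (x * eps) * (growth n x' + n%:R^-1) +
    (2 ^ n)%:R * Ex (fun w => (eps < xi n w)%R%:R * expR (x * xi n w)).
Proof.
move=> x'0 xx n0; have n0' : 0 < n%:R :> R by rewrite ltr0n.
have x0 := lt_le_trans x'0 xx.
set C := x / x' * expR (x * eps); set J := Ex _.
have C0 : 0 <= C by rewrite mulr_ge0 ?expR_ge0// divr_ge0// ltW.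
have ee k : e n k x <= C * e n k x' + J.
  exact: (@excess_upper _ _ _ P (Zn n) (xi n) (mZ n) (@mxi n) (lZ n) (@Lxi n) k x x' eps x'0 xx).
have h1 := telescope_upper (a0 n (ltW x0)) (gd n (ltW x0))
  (eE n (ltW x0)) (n * 2 ^ n) ee.
have h2 := telescope_le (a0 n (ltW x'0)) (g01 n (ltW x'0)) (eE n (ltW x'0)) (n * 2 ^ n).
have {h1} h2 := le_trans h1 (lerD (ler_wpM2l C0 h2) (lexx _)).
have gE : (n * 2 ^ n)%:R * (a n x * g n (n * 2 ^ n)%N x) = n%:R * G n x.
  by rewrite KE [in LHS](mulrA (2 ^ n)%:R).
have gE' : (n * 2 ^ n)%:R * a n x' = n%:R * growth n x' by rewrite KE.
have JE : (n * 2 ^ n)%:R * J = n%:R * ((2 ^ n)%:R * J) by rewrite KE.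
move: h2; rewrite gE gE' JE => h2.
rewrite -(ler_pM2l n0'); apply: (le_trans h2).
rewrite [leRHS]mulrDr lerD2r [leRHS]mulrCA; apply: ler_wpM2l => //.
by rewrite [leRHS]mulrDr divff ?gt_eqF.
Qed.

Let small_excess x eta : 0 < x -> 0 < eta -> exists x' eps,
  [/\ 0 < x', x' <= x, 0 < eps & x / x' * expR (x * eps) * psi x' <= x + eta].
Proof.
move=> x0 eta0.
(* Two factors [1 + e1] are lost, one from [exp(x eps)] and one from the slope of [psi] near 0; for
   [e1 <= 1] their product is at most [1 + 3 e1]. *)
pose e1 := Num.min 1 (eta / (3 * x)).
have x3 : 0 < 3 * x by rewrite mulr_gt0.
have e10 : 0 < e1 by rewrite lt_min ltr01 divr_gt0.
have e11 : e1 <= 1 by rewrite ge_min lexx.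
have e1e : 3 * x * e1 <= eta.
  by rewrite mulrC -ler_pdivlMr// ge_min lexx orbT.
have [h0 h00 H] := psi_slope X_ind X_stat X_cadlag X_nnj X_0 X_mean e10.
pose x' := Num.min h0 x.
have x'0 : 0 < x' by rewrite lt_min h00.
exists x', (ln (1 + e1) / x); split => //.
- by rewrite ge_min lexx orbT.
- by rewrite divr_gt0// ln_gt0// ltrDl.
have px : psi x' <= (1 + e1) * x' by apply: H; rewrite x'0 ge_min lexx.
have -> : x * (ln (1 + e1) / x) = ln (1 + e1) by rewrite mulrC divfK ?gt_eqF.
rewrite lnK ?posrE ?addr_gt0//.
apply: (@le_trans _ _ (x / x' * (1 + e1) * ((1 + e1) * x'))).
  by rewrite ler_wpM2l// mulr_ge0 ?addr_ge0 ?ltW// divr_gt0.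
have -> : x / x' * (1 + e1) * ((1 + e1) * x') = x * (1 + e1) * (1 + e1).
  by field; rewrite gt_eqF.
move: e10 e11 e1e x0 => {}e10 e11 e1e x0.
rewrite (_ : x * (1 + e1) * (1 + e1) = x + (2 * (x * e1) + (x * e1) * e1)); last by ring.
rewrite lerD2l; apply: le_trans e1e.
rewrite (_ : 3 * x * e1 = 2 * (x * e1) + (x * e1) * 1); last by ring.
by rewrite lerD2l; apply: ler_wpM2l => //; rewrite mulr_ge0// ltW.
Qed.

(** [x'] and [eps] stay fixed while [n] grows: the telescoping remainder is of order [1/n] because
    the horizon is [n], and the jump term vanishes by [jump_exp_rate]. *)
Let G_cvg x : 0 < x -> G n x @[n --> \oo] --> x.
Proof.
move=> x0; apply/cvgrPdist_le => eta eta0.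
have eta20 : 0 < eta / 2 by rewrite divr_gt0.
have [x' [eps [x'0 xx eps0 hC]]] := small_excess x0 eta20.
have inv : (n%:R^-1 : R) @[n --> \oo] --> (0 : R).
  apply/cvgrPdist_le => r r0; near=> n; rewrite sub0r normrN ger0_norm ?invr_ge0//.
  rewrite -[leRHS]invrK lef_pV2 ?posrE ?invr_gt0//.
    by near: n; exact: nbhs_infty_ger.
  by rewrite ltr0n; near: n; exact: nbhs_infty_gt.
have c1 : (growth n x' + n%:R^-1 : R) @[n --> \oo] --> psi x' + 0.
  by apply: cvgD => //; exact: growth_cvg.
have c2 : (x / x' * expR (x * eps) * (growth n x' + n%:R^-1) : R) @[n --> \oo] -->
    x / x' * expR (x * eps) * (psi x' + 0) by apply: cvgM => //; exact: cvg_cst.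
have c3 : (x / x' * expR (x * eps) * (growth n x' + n%:R^-1) +
    (2 ^ n)%:R * Ex (fun w => (eps < xi n w)%R%:R * expR (x * xi n w)) : R) @[n --> \oo] -->
    x / x' * expR (x * eps) * (psi x' + 0) + 0.
  by apply: cvgD => //; exact: jump_exp_rate.
rewrite !addr0 in c3.
have up : \forall n \near \oo, x / x' * expR (x * eps) * (growth n x' + n%:R^-1) +
    (2 ^ n)%:R * Ex (fun w => (eps < xi n w)%R%:R * expR (x * xi n w)) < x + eta.
  apply: (cvgr_lt _ c3); apply: (le_lt_trans hC); rewrite ltrD2l.
  by rewrite ltr_pdivrMr// ltr_pMr// ltr1n.
near=> n.
have n0 : (0 < n)%N by near: n; exact: nbhs_infty_gt.
have h1 := G_lower x0 n0.
have h2 := G_upper eps x'0 xx n0.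
have h3 : n%:R^-1 <= eta.
  by have : `|0 - n%:R^-1| <= eta; [near: n; move/cvgrPdist_le : inv; apply|
     rewrite sub0r normrN ger0_norm// invr_ge0].
have h4 := le_trans h2 (ltW (near up n _)).
rewrite ler_norml; apply/andP; split.
  by rewrite lerBrDl lerBlDr h4.
rewrite lerBlDr -lerBlDl; apply: le_trans h1.
by rewrite lerD2l lerN2.
Unshelve. all: end_near. Qed.

Lemma pollaczek_khinchine x : 0 < x ->
  Ex (fun w => expR (- (x * Qn n w))) @[n --> \oo] --> x / psi x.
Proof.
move=> x0.
have p0 := lt_le_trans x0 (psi_ge X_ind X_stat X_cadlag X_nnj X_0 X_mean (ltW x0)).
rewrite (_ : (fun n => _) = (fun n => G n x / growth n x)); last first.
  apply/funext => n; rewrite /Qn Qk_laplace /G mulrAC divff ?mul1r// gt_eqF//.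
  exact: lt_le_trans p0 (growth_ge n x).
apply: cvgM; first exact: G_cvg.
by apply: cvgV; [rewrite gt_eqF|exact: growth_cvg].
Qed.

End pollaczek_khinchine.

(** * The law of the reflected process at an exponential time *)

Lemma integral_expR (R : realType) (A B m : R) : B != 0 -> 0 <= m ->
  (\int[lebesgue_measure]_(u in `[0%R, m]) (A * expR (B * u))%:E =
   (A / B * (expR (B * m) - 1))%:E)%E.
Proof.
move=> B0; rewrite le_eqVlt => /orP[/eqP<-|m0].
  by rewrite set_itv1 integral_set1 mulr0 expR0 subrr mulr0.
have dF (z : R) : is_derive z 1 (fun u => A / B * expR (B * u)) (A * expR (B * z)).
  apply: is_derive_eq; rewrite /GRing.scale/=.
  by field.
have cF : continuous (fun u : R => A / B * expR (B * u)).
  move=> z; apply/differentiable_continuous/derivable1_diffP.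
  by have [] := dF z.
have df (z : R) : is_derive z 1 (fun u => A * expR (B * u)) (A * B * expR (B * z)).
  by apply: is_derive_eq; rewrite /GRing.scale/=; ring.
have cf : continuous (fun u : R => A * expR (B * u)).
  move=> z; apply/differentiable_continuous/derivable1_diffP.
  by have [] := df z.
rewrite (@continuous_FTC2 _ _ (fun u => A / B * expR (B * u)))//.
- by rewrite mulr0 expR0 -EFinB -mulrBr.
- exact: continuous_subspaceT.
- split.
  + by move=> z _; have [] := dF z.
  + exact/cvg_at_right_filter/cF.
  + exact/cvg_at_left_filter/cF.
- by move=> z _; rewrite derive1E; have [_ ->] := dF z.
Qed.

(** * Subtracting a nearly exponential variable *)

Section exponential_overtake.
Context (d : measure_display) (T : measurableType d) (R : realType).
Context (P : probability T R).
Variables (V : T -> R) (x v : R).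
Hypotheses (mV : measurable_fun setT V) (V0 : forall w, 0 <= V w).
Hypotheses (x0 : 0 < x) (v0 : 0 <= v).

(** The derivative of [exp(- x (v - u))] in [u]. Integrated up to the minimum of [v] and [V w] it
    recovers the integrand less [exp(- x v)], and Tonelli turns the expectation into an integral of
    the tail of [V]. *)
Let k (u : R) := x * expR (- (x * v)) * expR (x * u).

Let k0 u : 0 <= k u.
Proof. by rewrite /k !mulr_ge0 ?expR_ge0// ltW. Qed.

Let mk : measurable_fun setT k.
Proof. by rewrite /k; meas. Qed.

Let int_k m : 0 <= m ->
  (\int[lebesgue_measure]_(u in `[0%R, m]) (k u)%:E =
   (expR (- (x * v)) * (expR (x * m) - 1))%:E)%E.
Proof.
move=> m0; rewrite /k integral_expR ?gt_eqF//.
by rewrite [x * _]mulrC mulfK// gt_eqF.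
Qed.

Let layer (w : T) (u : R) : R := ((0 <= u) && (u < v))%R%:R * k u * (u < V w)%R%:R.

Let layer0 w u : 0 <= layer w u.
Proof. by rewrite /layer; apply: mulr_ge0 => //; apply: mulr_ge0. Qed.

Let mlayer : measurable_fun setT (fun z : T * R => layer z.1 z.2).
Proof.
have mV1 : measurable_fun setT (fun z : T * R => V z.1).
  by apply: (measurableT_comp mV); exact: measurable_fst.
by rewrite /layer /k; meas.
Qed.

Let int_layer w : (\int[lebesgue_measure]_u (layer w u)%:E =
  (expR (- (x * Num.max 0 (v - V w))) - expR (- (x * v)))%:E)%E.
Proof.
pose m := Num.min v (V w).
have m0 : 0 <= m by rewrite le_min v0 V0.
transitivity (\int[lebesgue_measure]_(u in `[0%R, m[) (k u)%:E)%E.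
  rewrite [RHS]integral_mkcond; apply: eq_integral => u _.
  rewrite patchE /layer; have [um|um] := pselect ([set` `[0, m[] u).
    rewrite mem_set//; move: um; rewrite /= in_itv/= lt_min => /andP[-> /andP[-> ->]].
    by rewrite mul1r mulr1.
  rewrite memNset//; move: um; rewrite /= in_itv/= lt_min => /negP.
  by case: (0 <= u); case: (u < v); case: (u < V w) => //= _; rewrite ?mul0r ?mulr0.
rewrite integral_itv_bndo_bndc; last by apply/measurable_EFinP/measurable_funTS.
rewrite int_k// mulrBr mulr1 -expRD; congr (expR _ - _)%:E.
rewrite /m; have [h|h] := leP v (V w).
  by rewrite (max_l (_ : v - V w <= 0)) ?subr_le0// mulr0 oppr0 addrC subrr.
by rewrite max_r ?subr_ge0 ?ltW//; ring.
Qed.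

Let t (u : R) : R := Ex P (fun w => (u < V w)%R%:R).

Let t0 u : 0 <= t u.
Proof. by apply: Ex_ge0 => w; exact: ler0n. Qed.

Let mt : measurable_fun setT t.
Proof.
apply: nonincreasing_measurable => // a b ab.
apply: Ex_le => [||w]; try by apply: L1_bool; meas.
rewrite ler_nat; have [|//] := ltP b (V w).
by move=> /(le_lt_trans ab)->.
Qed.

Let int_tail : (\int[P]_w (expR (- (x * Num.max 0 (v - V w))) - expR (- (x * v)))%:E =
  \int[lebesgue_measure]_(u in `[0%R, v]) (k u * t u)%:E)%E.
Proof.
under eq_integral do rewrite -int_layer.
rewrite (fubini_tonelli (m1 := P) (m2 := lebesgue_measure) (fun z => (layer z.1 z.2)%:E))/=; last 2 first.
- exact/measurable_EFinP.
- by move=> z; rewrite lee_fin.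
rewrite -integral_itv_bndo_bndc; last first.
  by apply/measurable_EFinP/measurable_funTS; exact: measurable_funM.
rewrite [RHS]integral_mkcond; apply: eq_integral => u _.
have Lb : L1 P (fun w => (u < V w)%R%:R) by apply: L1_bool; meas.
rewrite patchE /layer ExE; last exact: L1Z.
rewrite ExZ// -/(t u).
have [uv|uv] := pselect ([set` `[0, v[] u).
  by rewrite mem_set//; move: uv; rewrite /= in_itv/= => ->; rewrite mul1r.
by rewrite memNset//; move: uv; rewrite /= in_itv/= => /negP/negbTE->; rewrite !mul0r.
Qed.

(** The fraction is the value for a [V] exactly exponential with rate [Phi]. The kernel [k] has mass
    [1 - exp(- x v) <= 1] on [[0, v]], so an error [rho] in the tail costs at most [rho]. *)
Lemma exponential_overtake (Phi rho : R) : x != Phi -> 0 <= rho ->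
  (forall u, 0 <= u -> expR (- (Phi * u)) - rho <= t u <= expR (- (Phi * u))) ->
  `|Ex P (fun w => expR (- (x * Num.max 0 (v - V w)))) -
    (Phi * expR (- (x * v)) - x * expR (- (Phi * v))) / (Phi - x)| <= rho.
Proof.
move=> xPhi rho0 tail.
have L : L1 P (fun w => expR (- (x * Num.max 0 (v - V w)))).
  apply: (L1_bnd 1) => [|w]; first by meas.
  by rewrite ger0_norm ?expR_ge0// expR_le1 oppr_le0 mulr_ge0 ?(ltW x0)// le_max lexx.
have LB : L1 P (fun w => expR (- (x * Num.max 0 (v - V w))) - expR (- (x * v))).
  by apply: L1B => //; exact: L1_cst.
have := int_tail; rewrite ExE// ExB//; last exact: L1_cst.
rewrite Ex_cst; set F := Ex P _ => hF.
have I1 : (\int[lebesgue_measure]_(u in `[0%R, v]) (k u * expR (- (Phi * u)))%:E =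
    (x * expR (- (x * v)) / (x - Phi) * (expR ((x - Phi) * v) - 1))%:E)%E.
  transitivity (\int[lebesgue_measure]_(u in `[0%R, v])
      (x * expR (- (x * v)) * expR ((x - Phi) * u))%:E)%E.
    apply: eq_integral => u _.
    by rewrite /k -mulrA -expRD; congr (_ * expR _)%:E; ring.
  by apply: integral_expR; rewrite ?subr_eq0.
have mkt : measurable_fun (`[0, v]%classic : set R) (EFin \o (fun u => k u * t u)).
  by apply/measurable_EFinP/measurable_funTS; exact: measurable_funM.
have mkP : measurable_fun (`[0, v]%classic : set R) (EFin \o (fun u => k u * expR (- (Phi * u)))).
  by apply/measurable_EFinP/measurable_funTS; apply: measurable_funM => //; meas.
have mk' : measurable_fun (`[0, v]%classic : set R) (EFin \o (fun u => rho * k u)).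
  by apply/measurable_EFinP/measurable_funTS; exact: measurable_funM.
have up : F - expR (- (x * v)) <= x * expR (- (x * v)) / (x - Phi) * (expR ((x - Phi) * v) - 1).
  rewrite -lee_fin hF -I1; apply: ge0_le_integral => //.
  - by move=> u _; rewrite lee_fin mulr_ge0.
  - move=> u; rewrite /= in_itv/= => /andP[u0 _]; rewrite lee_fin ler_wpM2l//.
    by case/andP: (tail u u0).
have lo : x * expR (- (x * v)) / (x - Phi) * (expR ((x - Phi) * v) - 1) <=
    F - expR (- (x * v)) + rho * (1 - expR (- (x * v))).
  rewrite -lee_fin EFinD hF -I1.
  have -> : (rho * (1 - expR (- (x * v))))%:E =
      (\int[lebesgue_measure]_(u in `[0%R, v]) (rho * k u)%:E)%E.
    under [RHS]eq_integral do rewrite EFinM.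
    rewrite ge0_integralZl//.
    - by rewrite int_k// -EFinM; congr (rho * _)%:E; rewrite mulrBr mulr1 -expRD addNr expR0.
    - by apply/measurable_EFinP/measurable_funTS.
    - by move=> u _; rewrite lee_fin.
  rewrite -ge0_integralD//; last 2 first.
  - by move=> u _; rewrite lee_fin mulr_ge0.
  - by move=> u _; rewrite lee_fin mulr_ge0.
  apply: ge0_le_integral => //.
  - by move=> u _; rewrite lee_fin mulr_ge0 ?expR_ge0.
  - exact: emeasurable_funD.
  - move=> u; rewrite /= in_itv/= => /andP[u0 _].
    rewrite -EFinD lee_fin [rho * _]mulrC -mulrDr ler_wpM2l// -lerBlDr.
    by case/andP: (tail u u0).
have GE : (Phi * expR (- (x * v)) - x * expR (- (Phi * v))) / (Phi - x) =
    expR (- (x * v)) + x * expR (- (x * v)) / (x - Phi) * (expR ((x - Phi) * v) - 1).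
  have -> : expR (- (Phi * v)) = expR (- (x * v)) * expR ((x - Phi) * v).
    by rewrite -expRD; congr expR; ring.
  by field; rewrite !subr_eq0 xPhi eq_sym xPhi.
rewrite GE; move: up lo; set I := _ * (expR _ - 1) => up lo.
have c0 : expR (- (x * v)) <= 1 by rewrite expR_le1 oppr_le0 mulr_ge0// ltW.
have r1 : rho * (1 - expR (- (x * v))) <= rho.
  by rewrite -[leRHS]mulr1; apply: ler_wpM2l => //; rewrite gerBl expR_ge0.
rewrite opprD addrA ler_norml; apply/andP; split.
  by rewrite lerBrDl lerBlDr (le_trans lo)// lerD2l.
by rewrite (le_trans _ rho0)// subr_le0.
Qed.

End exponential_overtake.

(** * From the grids to a single path *)

Section path.
Context (d : measure_display) (T : measurableType d) (R : realType).
Context (P : probability T R) (X : R -> {RV P >-> R}) (e : {RV P >-> R}) (w : T).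
Hypothesis gc : cadlag (fun t => X t w).
Hypothesis gj : no_negative_jumps (fun t => X t w).
Hypothesis e0 : 0 <= e w.

Notation dl := (dl R).
Let h (t : R) := Yhat X t w.
Let q n := Qn X n w.
Let s_ n := Sn X e n w.

Let grid n (K : R) j : j%:R * dl n <= K -> K <= n%:R -> (j < (n * 2 ^ n).+1)%N.
Proof.
move=> jK Kn; have := le_trans jK Kn.
have -> : n%:R = (n * 2 ^ n)%:R * dl n :> R by rewrite natrM -mulrA dl_pow mulr1.
by rewrite ler_pM2r ?dl_gt0// ler_nat ltnS.
Qed.

Let right_h (s eta : R) : 0 < eta -> exists2 del, 0 < del &
  forall t, s <= t -> t < s + del -> h s - eta <= h t.
Proof.
move=> eta0; have [del del0 H] := right_local gc gj s eta0.
exists del => // t st td; have := H t st td.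
by rewrite ler_norml /h /Yhat => /andP[_ ?]; lra.
Qed.

Let grid_right n (t : R) : 0 <= t -> exists j : nat, t <= j%:R * dl n <= t + dl n.
Proof.
move=> t0; exists (Num.truncn (t / dl n)).+1.
have d0 := dl_gt0 R n.
have /andP[h1 h2] := truncn_itv (divr_ge0 t0 (ltW d0)).
rewrite -ler_pdivrMr// (ltW h2)/= -natr1 mulrDl mul1r lerD2r.
by rewrite -ler_pdivlMr.
Qed.

Let grid_left n (t : R) : 0 <= t -> exists j : nat, j%:R * dl n <= t <= j%:R * dl n + dl n.
Proof.
move=> t0; exists (Num.truncn (t / dl n)).
have d0 := dl_gt0 R n.
have /andP[h1 h2] := truncn_itv (divr_ge0 t0 (ltW d0)).
rewrite -ler_pdivlMr// h1/=.
by move: h2; rewrite -natr1 ltr_pdivrMr// mulrDl mul1r => /ltW.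
Qed.

Let q_ge n j : (j < (n * 2 ^ n).+1)%N -> h (- (j%:R * dl n)) - h 0 <= q n.
Proof.
move=> jn.
exact: (bmax_ge (fun j w => Yhat X (- (j%:R * dl n)) w - Yhat X 0 w)).
Qed.

Let q_approx t eta : t <= 0 -> 0 < eta -> \forall n \near \oo, h t - h 0 - eta <= q n.
Proof.
move=> t0 eta0; have [del del0 H] := right_h t eta0.
near=> n.
have nt : - t <= n%:R by near: n; exact: nbhs_infty_ger.
have dn : dl n < del by near: n; exact: dl_small.
have mt0 : 0 <= - t by rewrite oppr_ge0.
have [j /andP[j1 j2]] := grid_left n mt0.
apply: le_trans (q_ge (grid j1 nt)).
have : h t - eta <= h (- (j%:R * dl n)) by apply: H; lra.
by lra.
Unshelve. all: end_near. Qed.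

Let q_witness n : exists2 t, t <= 0 & q n = h t - h 0.
Proof.
have [q0|[j _ qj]] := bmax_ex (fun j w => Yhat X (- (j%:R * dl n)) w - Yhat X 0 w)
  (n * 2 ^ n).+1 w.
  by exists 0 => //; rewrite subrr.
exists (- (j%:R * dl n)) => //.
by rewrite oppr_le0 mulr_ge0// ltW// dl_gt0.
Qed.

Let s_ge n j : (j < (n * 2 ^ n).+1)%N -> j%:R * dl n <= e w ->
  h (j%:R * dl n) - h 0 <= s_ n.
Proof.
move=> jn je.
have := bmax_ge (fun j w => if j%:R * dl n <= e w then Yhat X (j%:R * dl n) w - Yhat X 0 w else 0) w jn.
by rewrite je.
Qed.

Let s_witness n : exists2 t, 0 <= t <= e w & s_ n = h t - h 0.
Proof.
have [s0|[j _]] := bmax_ex (fun j w => if j%:R * dl n <= e w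
    then Yhat X (j%:R * dl n) w - Yhat X 0 w else 0) (n * 2 ^ n).+1 w.
  by exists 0; rewrite ?lexx// subrr.
have [je sj|je sj] := leP (j%:R * dl n) (e w); last by exists 0; rewrite ?lexx// subrr.
exists (j%:R * dl n) => //.
by rewrite je andbT mulr_ge0// ltW// dl_gt0.
Qed.

Let s_approx_lt t eta : 0 <= t -> t < e w -> 0 < eta ->
  \forall n \near \oo, h t - h 0 - eta <= s_ n.
Proof.
move=> t0 te eta0; have [del del0 H] := right_h t eta0.
have et0 : 0 < e w - t by rewrite subr_gt0.
near=> n.
have nt : e w <= n%:R by near: n; exact: nbhs_infty_ger.
have dn : dl n < del by near: n; exact: dl_small.
have dn2 : dl n < e w - t by near: n; exact: dl_small.
have [j /andP[j1 j2]] := grid_right n t0.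
have je : j%:R * dl n <= e w by lra.
apply: le_trans (s_ge (grid je nt) je).
have : h t - eta <= h (j%:R * dl n) by apply: H; lra.
by lra.
Unshelve. all: end_near. Qed.

(** At [t = e w] the grid points to the right lie beyond the time horizon, so a time slightly to the
    left is used. As [X] has no negative jump at [t], [Yhat] just before [t] is not much smaller
    than at [t]. *)
Let s_approx t eta : 0 <= t <= e w -> 0 < eta -> \forall n \near \oo, h t - h 0 - eta <= s_ n.
Proof.
move=> /andP[t0]; rewrite le_eqVlt => /orP[/eqP te|te] eta0; last exact: s_approx_lt.
move: t0; rewrite le_eqVlt => /orP[/eqP<-|t0].
  apply: nearW => n; rewrite subrr sub0r (@le_trans _ _ 0)//; last exact: bmax_ge0.
  by rewrite oppr_le0 ltW.
have eta4 : 0 < eta / 4 by rewrite divr_gt0.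
have [del del0 H] := left_local gc gj t eta4.
pose b := Num.min (Num.min del (eta / 4)) t.
have b0 : 0 < b by rewrite !lt_min del0 eta4 t0.
have [bd be bt] : [/\ b <= del, b <= eta / 4 & b <= t].
  by split; rewrite /b !ge_min lexx ?orbT.
have t'0 : 0 <= t - b / 2 by lra.
have t'e : t - b / 2 < e w by rewrite -te; lra.
have := s_approx_lt t'0 t'e eta4.
apply: filterS => n; apply: le_trans.
have : X (t - b / 2) w <= X t w + eta / 4 by apply: H; lra.
rewrite /h /Yhat; lra.
Qed.

Let s_bounded : exists M, forall t, 0 <= t <= e w -> h t - h 0 <= M.
Proof.
have [M HM] := path_lbounded gc gj 0 (e w).
exists (e w + M - h 0) => t te; rewrite lerD2r /h /Yhat.
by have := HM t te; have /andP[_ ?] := te; lra.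
Qed.

Let A := [set h t - h 0 | t in [set t | 0 <= t <= e w]].
Let S := sup A.

Let A_ub t : 0 <= t <= e w -> h t - h 0 <= S.
Proof.
move=> te; apply: ub_le_sup; last by exists t.
by have [M HM] := s_bounded; exists M => _ [u ue <-]; exact: HM.
Qed.

Let A_adh eta : 0 < eta -> exists2 t, 0 <= t <= e w & S - eta < h t - h 0.
Proof.
move=> eta0.
have hs : has_sup A.
  split; first by exists (h 0 - h 0), 0 => //=; rewrite lexx.
  by have [M HM] := s_bounded; exists M => _ [u ue <-]; exact: HM.
by have [_ [t te <-] ht] := sup_adherent eta0 hs; exists t.
Qed.

Let s_cvg : s_ n @[n --> \oo] --> S.
Proof.
apply/cvgrPdist_le => eta eta0.
have eta20 : 0 < eta / 2 by rewrite divr_gt0.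
have [t te ht] := A_adh eta20.
apply: filterS (s_approx te eta20) => n hn.
have [u ue su] := s_witness n; have := A_ub ue; rewrite -su => sS.
by rewrite ger0_norm ?subr_ge0//; lra.
Qed.

Let M := M_of X (e w) w.

Let QE t u : (Y_of X t w - Y_of X u w)%:E = (h u - h t)%:E.
Proof. by rewrite /Y_of /h /Yhat; congr _%:E; ring. Qed.

(** For every [t] in [[0, e w]], the starting times [r] and [t] in the supremum already give
    [Q(t) >= h r - h t >= h r - h 0 - S] and [Q(t) >= 0]. *)
Let M_ge r : r <= 0 -> ((Num.max 0 (h r - h 0 - S))%:E <= M)%E.
Proof.
move=> r0; apply: le_ereal_inf_tmp => _ [t /= te <-]; rewrite /Q_of.
have te0 : 0 <= t by case/andP: te.
rewrite EFin_max ge_max; apply/andP; split.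
  by apply: ereal_sup_ubound; exists t => //=; rewrite subrr.
apply: le_ereal_sup_tmp; exists (h r - h t)%:E.
  by exists r; [exact: le_trans te0|rewrite QE].
by rewrite lee_fin; have := A_ub te; lra.
Qed.

(** [t] is taken where [h] is within [eta] of its supremum on [[0, e w]]. In [Q(t)], starting times
    [r <= 0] then contribute at most [Qr - S + eta], and those in [(0, t]] at most [eta]. *)
Let M_le Qr eta : (forall r, r <= 0 -> h r - h 0 <= Qr) -> 0 < eta ->
  (M <= (Num.max 0 (Qr - S) + eta)%:E)%E.
Proof.
move=> HQ eta0; have [t te ht] := A_adh eta0.
apply: ge_ereal_inf; exists (Q_of X t w); first by exists t.
apply: ge_ereal_sup => _ [r /= rt <-]; rewrite QE lee_fin.
have m0 : 0 <= Num.max 0 (Qr - S) by rewrite le_max lexx.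
have m1 : Qr - S <= Num.max 0 (Qr - S) by rewrite le_max lexx orbT.
have [r0|r0] := leP r 0; first by have := HQ r r0; lra.
have re : 0 <= r <= e w by rewrite (ltW r0) (le_trans rt)//; case/andP: te.
by have := A_ub re; lra.
Qed.

(** An infinite [Q(0)] is treated along with the finite case: if the grid values are unbounded, [M]
    is infinite, [expeR] gives 0, and the grid exponentials tend to 0. *)
Lemma path_limit x : 0 < x -> exists2 L,
  expeR (- (x%:E * M_of X (e w) w)) = L%:E &
  expR (- (x * Num.max 0 (Qn X n w - Sn X e n w))) @[n --> \oo] --> L.
Proof.
move=> x0; rewrite -/M.
have [[C HC]|unb] := pselect (exists C, forall n, q n <= C).
  pose B := [set h r - h 0 | r in [set r | r <= 0]].
  have Bub r : r <= 0 -> h r - h 0 <= C + 1.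
    move=> r0; have [n _ /(_ n (leqnn n))] := q_approx r0 ltr01.
    by move=> /= hn; have := HC n; lra.
  have hB : has_sup B.
    split; first by exists (h 0 - h 0), 0 => //=.
    by exists (C + 1) => _ [r r0 <-]; exact: Bub.
  pose Qr := sup B.
  have HQ r : r <= 0 -> h r - h 0 <= Qr.
    by move=> r0; apply: ub_le_sup; [case: hB|exists r].
  have q_cvg : q n @[n --> \oo] --> Qr.
    apply/cvgrPdist_le => eta eta0.
    have eta20 : 0 < eta / 2 by rewrite divr_gt0.
    have [_ [t t0 <-] ht] := sup_adherent eta20 hB.
    apply: filterS (q_approx t0 eta20) => n hn.
    have [u u0 su] := q_witness n; have := HQ u u0; rewrite -su => sS.
    by rewrite ger0_norm ?subr_ge0//; rewrite -/Qr in ht; lra.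
  have mc : Num.max 0 (q n - s_ n) @[n --> \oo] --> Num.max 0 (Qr - S).
    apply: (@continuous_cvg _ _ _ _ _ _ (fun z : R => Num.max 0 z)).
      by apply: (@continuous_max _ _ (fun=> 0) id); [exact: cst_continuous|].
    exact: cvgB.
  have M0 : (0%:E <= M)%E.
    by apply: le_trans (M_ge (lexx 0)); rewrite lee_fin le_max lexx.
  have ME : M = (Num.max 0 (Qr - S))%:E.
    have Mfin : M \is a fin_num.
      by rewrite ge0_fin_numE//; apply: le_lt_trans (M_le HQ ltr01) (ltry _).
    rewrite -(fineK Mfin); congr _%:E; apply/eqP; rewrite eq_le; apply/andP; split.
      by apply/ler_addgt0Pr => eta eta0; rewrite -lee_fin fineK//; exact: M_le.
    rewrite ge_max; apply/andP; split; first by rewrite fine_ge0.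
    rewrite lerBlDr; apply: ge_sup; first by case: hB.
    move=> _ [r /= r0 <-]; rewrite -lerBlDr -lee_fin fineK//.
    by apply: le_trans (M_ge r0); rewrite lee_fin le_max lexx orbT.
  exists (expR (- (x * Num.max 0 (Qr - S)))); first by rewrite ME.
  apply: (@continuous_cvg _ _ _ _ _ _ expR); first exact: continuous_expR.
  by apply: cvgN; apply: cvgM => //; exact: cvg_cst.
have q_large C : \forall n \near \oo, C <= q n.
  have [n hn] : exists n, C + 1 < q n.
    apply: contrapT => /forallNP H; apply: unb; exists (C + 1) => n.
    by have /negP := H n; rewrite -leNgt.
  have [r r0 qr] := q_witness n.
  by apply: filterS (q_approx r0 ltr01) => m; rewrite -qr; lra.
have My : M = +oo%E.
  apply/eqyP => C C0; have [n _ /(_ n (leqnn n)) /= hn] := q_large (C + S).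
  have [r r0 qr] := q_witness n.
  apply: le_trans (M_ge r0); rewrite lee_fin le_max; apply/orP; right.
  by rewrite -qr; lra.
exists 0; first by rewrite My gt0_muley ?lte_fin.
have mc : x * Num.max 0 (q n - s_ n) @[n --> \oo] --> +oo.
  apply/cvgryPge => C.
  have := q_large (C / x + S); apply: filterS => n hn.
  rewrite mulrC -ler_pdivrMr// le_max; apply/orP; right.
  have [u ue su] := s_witness n; have := A_ub ue; rewrite -su; lra.
exact: (cvg_comp _ _ mc (@cvgr_expR R)).
Qed.

End path.

(** * Limits of integrals without measurability *)

Section nonmeasurable_integral.
Context (d : measure_display) (T : measurableType d) (R : realType).
Context (P : probability T R).

(* [M_of] is not known to be measurable.  The integral of a nonnegative function
   is a supremum over the simple functions below it, hence monotone without any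
   measurability. *)
Lemma ge0_le_upper_integral (f g : T -> \bar R) :
  (forall w, (0 <= f w)%E) -> (forall w, (f w <= g w)%E) ->
  (\int[P]_w f w <= \int[P]_w g w)%E.
Proof.
move=> f0 fg; rewrite !ge0_integralTE//; last by move=> w; exact: le_trans (fg w).
apply: le_ereal_sup => _ [h hf <-]; exists h => // w.
exact: le_trans (fg w).
Qed.

(** Off the null set [N], [f] equals the measurable [g], the upper limit of the [f_ n]. Two
    measurable envelopes, with value 0 and [+oo] on [N], enclose [f] everywhere and have the same
    integral as [g]. *)
Lemma integral_ae_limit (f_ : nat -> T -> R) (f : T -> \bar R) :
  (forall n, measurable_fun setT (f_ n)) -> (forall n w, 0 <= f_ n w <= 1) ->
  (forall w, (0 <= f w)%E) ->
  {ae P, forall w, exists2 L, f w = L%:E & f_ n w @[n --> \oo] --> L} ->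
  exists2 F, (\int[P]_w f w = F%:E)%E & Ex P (f_ n) @[n --> \oo] --> F.
Proof.
move=> mf f01 f0 [N [mN N0 subN]].
pose g w := limn_sup (f_ ^~ w).
have mg : measurable_fun setT g.
  apply: measurable_fun_limn_sup => // w _.
  - by exists 1 => _ [n _ <-]; case/andP: (f01 n w).
  - by exists 0 => _ [n _ <-]; case/andP: (f01 n w).
have gE w : ~ N w -> f w = (g w)%:E /\ f_ n w @[n --> \oo] --> g w.
  move=> Nw; have [L fL cL] : exists2 L, f w = L%:E & f_ n w @[n --> \oo] --> L.
    by apply: contrapT => h; apply: Nw; apply: subN.
  have [_ gL] := cvg_limn_inf_sup cL.
  by rewrite /g gL.
have aeg : {ae P, forall w, f_ n w @[n --> \oo] --> g w}.
  exists N; split=> // w /= h; apply: contrapT => Nw; apply: h.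
  by have [] := gE w Nw.
have [Lg cg] := Ex_dct mf mg aeg (L1_cst P 1) (fun n w =>
  ltac:(by case/andP: (f01 n w) => h1 h2; rewrite ger0_norm)).
exists (Ex P g) => //.
pose b w : bool := (0 < (\1_N w : R)).
have bN w : b w <-> N w.
  rewrite /b indicE; split; last by move=> h; rewrite mem_set// ltr01.
  by case: (boolP (w \in N)) => [/set_mem//|_]; rewrite ltxx.
have mb : measurable_fun setT b.
  by apply: measurable_fun_ltr => //; exact: measurable_indic.
pose env (c : \bar R) w := if b w then c else `|g w|%:E.
have menv c : measurable_fun setT (env c).
  apply: measurable_fun_ifT => //.
  by apply/measurable_EFinP; exact: measurableT_comp.
have env0 c w : (0 <= c)%E -> (0 <= env c w)%E.
  by move=> c0; rewrite /env; case: ifP => // _; rewrite lee_fin.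
have envE c : (0 <= c)%E -> (\int[P]_w env c w = (Ex P g)%:E)%E.
  move=> c0; rewrite -ExE//.
  transitivity (\int[P]_w (`|g w|)%:E)%E.
    apply: ge0_ae_eq_integral => //.
    - by apply/measurable_EFinP; exact: measurableT_comp.
    - by move=> w _; exact: env0.
    - by exists N; split=> // w /= h; apply: contrapT => Nw; apply: h => _;
        rewrite /env; case: ifPn => // /bN.
  apply: ae_eq_integral => //.
  - by apply/measurable_EFinP; exact: measurableT_comp.
  - exact/measurable_EFinP.
  exists N; split=> // w /= h; apply: contrapT => Nw; apply: h => _.
  have [fE _] := gE w Nw; rewrite ger0_norm//.
  by rewrite -lee_fin -fE.
apply/eqP; rewrite eq_le; apply/andP; split.
  rewrite -(envE +oo%E)//; apply: ge0_le_upper_integral => // w.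
  rewrite /env; case: ifPn => [_|/negP/bN Nw]; first exact: leey.
  by have [-> _] := gE w Nw; rewrite lee_fin ler_norm.
rewrite -(envE 0%E)//; apply: ge0_le_upper_integral => w; first exact: env0.
rewrite /env; case: ifPn => // /negP/bN Nw.
have [fE _] := gE w Nw; rewrite fE ger0_norm//.
by rewrite -lee_fin -fE.
Qed.

End nonmeasurable_integral.

Section reflected_law.
Context (d : measure_display) (T : measurableType d) (R : realType).
Context (P : probability T R) (X : R -> {RV P >-> R}).
Hypothesis X_ind : independent_increments X.
Hypothesis X_stat : stationary_increments X.
Hypothesis X_cadlag : {ae P, forall w, cadlag (fun t => X t w)}.
Hypothesis X_nnj : {ae P, forall w, no_negative_jumps (fun t => X t w)}.
Hypothesis X_0 : {ae P, forall w, X 0 w = 0}.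
Hypothesis X_mean : ('E_P[X 1%R] = 0)%E.
Variables (q : R) (e : {RV P >-> R}).
Hypotheses (q0 : 0 < q) (ee : exponentially_distributed e q).
Hypothesis e_indep : independent_of_process e X.

Notation Yhat := (Yhat X).
Notation dl := (dl R).
Notation Ex := (Ex P).
Notation psi := (psi X).
Notation Qn := (Qn X).
Notation Sn := (Sn X e).

(** One grid started at time [- n] carries both variables: coordinate 0 is the clock, coordinates 1
    to [K] are the increments before time 0, those above [K] the increments after it. *)
Lemma Qn_Sn_smeas n : let K := (n * 2 ^ n)%N in
  let W := ext e (Yinc X (- (K%:R * dl n)) (dl n)) in
  smeas W [set i | (0 < i <= K)%N] (Qn n) /\
  smeas W [set i | i = 0%N \/ (K < i)%N] (Sn n).
Proof.
move=> K W; split.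
  have -> : Qn n = chain (@lindley R) 0 (Yinc X (- (K%:R * dl n)) (dl n)) K.
    by apply/funext => w; exact: QkE.
  apply: chain_smeas_sub; first exact: lindley_measurable.
  by move=> i iK; exact: (@smeas_Z _ _ _ W _ i.+1).
pose D := [set i | i = 0%N \/ (K < i)%N].
have m0 : smeas W D e by apply: (@smeas_Z _ _ _ W D 0%N); left.
have mY j : smeas W D (fun w => Yhat (j%:R * dl n) w - Yhat 0 w).
  elim: j => [|j IH].
    by rewrite mul0r; under eq_fun do rewrite subrr; exact: measurable_cst.
  have -> : (fun w => Yhat (j.+1%:R * dl n) w - Yhat 0 w) = (fun w =>
      (Yhat (j%:R * dl n) w - Yhat 0 w) + Yinc X (- (K%:R * dl n)) (dl n) (K + j) w).
    apply/funext => w; rewrite /Yinc.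
    have h i : - (K%:R * dl n) + (K + i)%:R * dl n = i%:R * dl n by rewrite natrD; ring.
    by rewrite -addnS !h; ring.
  apply: measurable_funD => //.
  by apply: (@smeas_Z _ _ _ W D (K + j).+1); right; rewrite ltnS leq_addr.
rewrite /smeas; apply: bmax_measurable => j.
apply: measurable_fun_ifT; [|exact: mY|exact: measurable_cst].
by apply: measurable_fun_ler => //; exact: measurable_cst.
Qed.

Lemma Qn_meas n : measurable_fun setT (Qn n).
Proof. exact: Qk_meas. Qed.

Lemma Sn_meas n : measurable_fun setT (Sn n).
Proof.
by have [_ h] := Qn_Sn_smeas n; apply: smeas_meas h => i; exact: ext_meas.
Qed.

Lemma Qn_Sn_indep n : indep2 P (Qn n) (Sn n).
Proof.
have [h1 h2] := Qn_Sn_smeas n.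
apply: (indep2_smeas _ _ _ h1 h2) => [i||]; first exact: ext_meas.
  by apply: ext_indep => //; exact/ltW/dl_gt0.
by apply/seteqP; split=> // i /= [/andP[i0 iK] [i0'|]]; [rewrite i0' in i0|rewrite ltnNge iK].
Qed.

Definition reflected_lt n x := Ex (fun w => expR (- (x * Num.max 0 (Qn n w - Sn n w)))).

Let Phi := Phi_hat X q.

(** For each fixed value of [Qn n], replacing [Sn n] by an exact exponential variable costs at most
    [eta]. What remains is linear in the transforms of [Qn n] at [x] and at [Phi]. *)
Lemma reflected_lt_cvg x : 0 < x -> x != Phi ->
  reflected_lt n x @[n --> \oo] --> (Phi * (x / psi x) - x * (Phi / q)) / (Phi - x).
Proof.
move=> x0 xPhi.
have [Phi0 PhiE] := Phi_hat_spec X_ind X_stat X_cadlag X_nnj X_0 X_mean q0.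
have PK y := pollaczek_khinchine X_ind X_stat X_cadlag X_nnj X_0 X_mean (x := y).
pose lt n y := Ex (fun w => expR (- (y * Qn n w))).
pose G n := (Phi * lt n x - x * lt n Phi) / (Phi - x).
have Gc : G n @[n --> \oo] --> (Phi * (x / psi x) - x * (Phi / q)) / (Phi - x).
  have c1 : (Phi * lt n x : R) @[n --> \oo] --> Phi * (x / psi x).
    by apply: cvgM; [exact: cvg_cst|exact: PK].
  have c2 : (x * lt n Phi : R) @[n --> \oo] --> x * (Phi / q).
    by apply: cvgM; [exact: cvg_cst|rewrite -PhiE; exact: PK].
  by apply: cvgM; [exact: cvgB|exact: cvg_cst].
have key eta : 0 < eta -> \forall n \near \oo, `|reflected_lt n x - G n| <= eta.
  move=> eta0.
  have := Sn_tail X_ind X_stat X_cadlag X_nnj X_0 X_mean q0 ee e_indep Phi0 PhiE eta0.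
  apply: filterS => n tail.
  have mQ := Qn_meas n; have mS := Sn_meas n.
  have Q0 w : 0 <= Qn n w by exact: bmax_ge0.
  have S0 w : 0 <= Sn n w by exact: bmax_ge0.
  pose h (z : R * R) := expR (- (x * Num.max 0 (z.1 - z.2))).
  have mh : measurable_fun setT h by rewrite /h; meas.
  have h01 z : 0 <= h z <= 1.
    by rewrite expR_ge0 expR_le1 oppr_le0 mulr_ge0 ?(ltW x0)// le_max lexx.
  rewrite /reflected_lt (indep2_Ex (h := h) mQ mS (Qn_Sn_indep n) mh h01).
  pose H v := Ex (fun w => h (v, Sn n w)).
  have Lh v : L1 P (fun w => h (v, Sn n w)).
    apply: (L1_bnd 1) => [|w]; first by rewrite /h /=; meas.
    by have /andP[? ?] := h01 (v, Sn n w); rewrite ger0_norm.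
  have mH : measurable_fun setT H.
    apply: nonincreasing_measurable; first exact: measurableT.
    move=> a b ab; apply: (Ex_le (Lh b) (Lh a)) => w.
    rewrite /h/= ler_expR lerN2; apply: ler_wpM2l; first exact: ltW.
    by rewrite ge_max le_max lexx/= le_max lerD2r ab orbT.
  have LH : L1 P (fun w => H (Qn n w)).
    apply: (L1_bnd 1) => [|w]; first exact: measurableT_comp.
    rewrite ger0_norm; last by apply: Ex_ge0 => w'; exact: expR_ge0.
    by apply: Ex_le_cst => // w'; case/andP: (h01 (Qn n w, Sn n w')).
  have LQ y : 0 < y -> L1 P (fun w => expR (- (y * Qn n w))).
    move=> y0; apply: (L1_bnd 1) => [|w]; first by meas.
    by rewrite ger0_norm ?expR_ge0// expR_le1 oppr_le0 mulr_ge0// ltW.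
  pose g w := (Phi * expR (- (x * Qn n w)) - x * expR (- (Phi * Qn n w))) / (Phi - x).
  have gE : g = fun w => (Phi - x)^-1 *
      (Phi * expR (- (x * Qn n w)) - x * expR (- (Phi * Qn n w))).
    by apply/funext => w; rewrite /g mulrC.
  have Lg : L1 P g by rewrite gE; apply/L1Z/L1B; apply/L1Z/LQ.
  have -> : G n = Ex g.
    by rewrite gE ExZ ?ExB ?ExZ//; try (apply/L1B); try apply/L1Z; try exact: LQ;
      rewrite /G mulrC.
  rewrite -[Ex (fun w => _)]/(Ex (fun w => H (Qn n w))) -ExB//.
  have bd w : - eta <= H (Qn n w) - g w <= eta.
    by rewrite -ler_norml; apply: exponential_overtake => //; exact: ltW.
  rewrite ler_norml; apply/andP; split.
    rewrite -(Ex_cst P (- eta)); apply: Ex_le; [exact: L1_cst|exact: L1B|].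
    by move=> w; case/andP: (bd w).
  by apply: Ex_le_cst => [|w]; [exact: L1B|case/andP: (bd w)].
apply/cvgrPdist_le => eps eps0; have e20 : 0 < eps / 2 by rewrite divr_gt0.
move/cvgrPdist_le : Gc => /(_ _ e20) h1.
apply: filterS2 h1 (key _ e20) => n h1 h2.
rewrite (le_trans (ler_distD (G n) _ _))// [leRHS]splitr lerD//.
by rewrite distrC.
Qed.

Lemma reflected_lt_lip n x y : 0 < x -> x <= y ->
  `|reflected_lt n x - reflected_lt n y| <= (y - x) / x.
Proof.
move=> x0 xy; have y0 := lt_le_trans x0 xy.
have mQ := Qn_meas n; have mS := Sn_meas n.
have L z : 0 < z -> L1 P (fun w => expR (- (z * Num.max 0 (Qn n w - Sn n w)))).
  move=> z0; apply: (L1_bnd 1) => [|w]; first by meas.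
  by rewrite ger0_norm ?expR_ge0// expR_le1 oppr_le0 mulr_ge0 ?(ltW z0)// le_max lexx.
have bd w : 0 <= expR (- (x * Num.max 0 (Qn n w - Sn n w))) -
    expR (- (y * Num.max 0 (Qn n w - Sn n w))) <= (y - x) / x.
  set m := Num.max _ _; have m0 : 0 <= m by rewrite le_max lexx.
  rewrite subr_ge0 ler_expR lerN2 ler_wpM2r//=.
  have -> : expR (- (y * m)) = expR (- (x * m)) * expR (- ((y - x) * m)).
    by rewrite -expRD; congr expR; ring.
  have h1 := expR_ge1Dx (- ((y - x) * m)).
  have h2 : expR (- (x * m)) * (x * m) <= 1.
    rewrite -[leRHS](expRxMexpNx_1 (x * m)) mulrC.
    apply: ler_wpM2r; first exact: expR_ge0.
    by apply: le_trans (expR_ge1Dx _); rewrite lerDr.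
  rewrite ler_pdivlMr//.
  have yx : 0 <= y - x by rewrite subr_ge0.
  apply: (@le_trans _ _ (expR (- (x * m)) * ((y - x) * m) * x)).
    apply: ler_wpM2r; first exact: ltW.
    rewrite -{1}[expR (- (x * m))]mulr1 -mulrBr; apply: ler_wpM2l; first exact: expR_ge0.
    by lra.
  rewrite (_ : _ * x = (y - x) * (expR (- (x * m)) * (x * m))); last by ring.
  by rewrite -[leRHS]mulr1; apply: ler_wpM2l.
rewrite /reflected_lt -ExB; [|exact: L|exact: L].
rewrite ger0_norm; last by apply: Ex_ge0 => w; case/andP: (bd w).
by apply: Ex_le_cst => [|w]; [apply: L1B; exact: L|case/andP: (bd w)].
Qed.

End reflected_law.

(** With [a] for [Phi], [p] for [psi (h + a)] and [q] for [psi a], this is the formula off [Phi]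
    solved for the difference quotient of [psi]. *)
Lemma difference_quotient_field (F : fieldType) (a h p q : F) :
  a != 0 -> h != 0 -> p != 0 -> q != 0 -> h + a != 0 ->
  (a * ((h + a) / p) - (h + a) * (a / q)) / (a - (h + a)) * p * (q / a) / (h + a) =
  h^-1 * (p - q).
Proof.
move=> a0 h0 p0 q0 ha0.
have -> : a - (h + a) = - h by rewrite opprD addrCA subrr addr0.
by field; rewrite oppr_eq0 h0 ha0 a0 q0 p0.
Qed.

(** * The Laplace transform of M(e), including the point Phi *)

Section laplace_M.
Context (d : measure_display) (T : measurableType d) (R : realType).
Context (P : probability T R) (X : R -> {RV P >-> R}).
Hypothesis X_ind : independent_increments X.
Hypothesis X_stat : stationary_increments X.
Hypothesis X_cadlag : {ae P, forall w, cadlag (fun t => X t w)}.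
Hypothesis X_nnj : {ae P, forall w, no_negative_jumps (fun t => X t w)}.
Hypothesis X_0 : {ae P, forall w, X 0 w = 0}.
Hypothesis X_mean : ('E_P[X 1%R] = 0)%E.
Variables (q : R) (e : {RV P >-> R}).
Hypotheses (q0 : 0 < q) (ee : exponentially_distributed e q).
Hypothesis e_indep : independent_of_process e X.

Notation psi := (psi X).
Let Phi := Phi_hat X q.

Lemma exponential_ge0 : {ae P, forall w, 0 <= e w}.
Proof.
have mB : measurable (`]-oo, 0[%classic : set R) by exact: measurable_itv.
exists (e @^-1` `]-oo, 0[); split.
- by rewrite -[X in measurable X]setTI; exact: measurable_funP.
- transitivity (distribution P e `]-oo, 0[) => //.
  rewrite ee// /exponential_prob integral0_eq// => x /=; rewrite in_itv/= => x0.
  by rewrite lt0_exponential_pdf.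
- by move=> w /= /negP; rewrite in_itv/= -ltNge.
Qed.

Lemma laplace_M_limit x : 0 < x -> exists2 F,
  laplace_M X e x = F%:E & reflected_lt X e n x @[n --> \oo] --> F.
Proof.
move=> x0; apply: (@integral_ae_limit _ _ _ P
  (fun n w => expR (- (x * Num.max 0 (Qn X n w - Sn X e n w))))) => [n|n w|w|].
- have mQ := Qn_meas X n; have mS := Sn_meas X e n.
  by meas.
- by rewrite expR_ge0 expR_le1 oppr_le0 mulr_ge0 ?(ltW x0)// le_max lexx.
- exact: expeR_ge0.
apply: filterS3 X_cadlag X_nnj exponential_ge0 => w cw jw ew.
exact: path_limit.
Qed.

Lemma laplace_M_neq x : 0 < x -> x != Phi ->
  laplace_M X e x = ((Phi * (x / psi x) - x * (Phi / q)) / (Phi - x))%:E.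
Proof.
move=> x0 xPhi; have [F -> cF] := laplace_M_limit x0; congr _%:E.
have c := reflected_lt_cvg X_ind X_stat X_cadlag X_nnj X_0 X_mean q0 ee e_indep x0 xPhi.
exact: (cvg_unique (@Rhausdorff R) cF c).
Qed.

Let FM x := fine (laplace_M X e x).

Let FM_lip x y : 0 < x -> x <= y -> `|FM x - FM y| <= (y - x) / x.
Proof.
move=> x0 xy; have y0 := lt_le_trans x0 xy.
have [F FE cF] := laplace_M_limit x0; have [G GE cG] := laplace_M_limit y0.
rewrite /FM FE GE /=.
have c : `|reflected_lt X e n x - reflected_lt X e n y| @[n --> \oo] --> `|F - G|.
  by apply: cvg_norm; exact: cvgB.
by apply: (cvgr_to_le c); apply: nearW => n; exact: reflected_lt_lip.
Qed.

Let Phi_spec := Phi_hat_spec X_ind X_stat X_cadlag X_nnj X_0 X_mean q0.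

Let FM_cvg : FM x @[x --> Phi] --> FM Phi.
Proof.
have [Phi0 _] := Phi_spec; rewrite -/Phi in Phi0.
have P20 : 0 < Phi / 2 by rewrite divr_gt0.
apply/cvgrPdist_le => eps eps0; near=> x.
have h1 : `|Phi - x| <= Phi / 2 by near: x; apply: cvgr_dist_le.
have h2 : `|Phi - x| <= eps * (Phi / 2).
  by near: x; apply: cvgr_dist_le => //; exact: mulr_gt0.
have xP : Phi / 2 <= x by move: h1; rewrite ler_norml => /andP[_]; lra.
have bound u v : Phi / 2 <= u -> u <= v -> v - u <= eps * (Phi / 2) ->
    `|FM u - FM v| <= eps.
  move=> uP uv vu; have u0 := lt_le_trans P20 uP.
  apply: (le_trans (FM_lip u0 uv)); rewrite ler_pdivrMr//; apply: (le_trans vu).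
  by apply: ler_wpM2l => //; exact: ltW.
have [xPhi|xPhi] := leP x Phi.
  by rewrite distrC; apply: bound => //; rewrite -(ger0_norm (_ : 0 <= Phi - x)) ?subr_ge0.
apply: bound; [lra|exact: ltW|].
by rewrite -(ger0_norm (_ : 0 <= x - Phi)) ?subr_ge0 ?(ltW xPhi)// distrC.
Unshelve. all: end_near. Qed.

(** Off [Phi] the difference quotient is an explicit function of the transform and of [psi], both
    continuous at [Phi]. Differentiability of [psi] at [Phi] thus comes out without differentiating
    under the expectation. *)
Lemma derive1_psi_Phi : derive1 (psi_hat X) Phi = FM Phi * q ^+ 2 / Phi ^+ 2.
Proof.
have [Phi0 PhiE] := Phi_spec; rewrite -/Phi in Phi0 PhiE.
pose k x := FM x * psi (Num.max 0 x) * (q / Phi) / x.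
have kc : k x @[x --> Phi] --> k Phi.
  apply: cvgM; last by apply: cvgV; [rewrite gt_eqF|exact: cvg_id].
  apply: cvgM; last exact: cvg_cst.
  apply: cvgM; first exact: FM_cvg.
  exact: (psi_continuous X_ind X_stat X_cadlag X_nnj X_0 X_mean).
have -> : FM Phi * q ^+ 2 / Phi ^+ 2 = k Phi.
  rewrite /k (max_r (ltW Phi0)) PhiE; move: (Phi) Phi0 => a a0.
  by field; rewrite gt_eqF.
have shift : (h + Phi) @[h --> (0 : R)^'] --> Phi.
  have : (h + Phi) @[h --> (0 : R)] --> 0 + Phi.
    by apply: cvgD; [exact: cvg_id|exact: cvg_cst].
  by rewrite add0r; apply: cvg_trans; apply: cvg_app; exact: nbhs_dnbhs.
rewrite /derive1; apply/cvg_lim => //.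
have kc' : k (h + Phi) @[h --> (0 : R)^'] --> k Phi.
  exact: (cvg_comp _ _ shift kc).
apply: cvg_trans kc'; apply: near_eq_cvg; near=> h.
have h0 : h != 0 by near: h; exact: nbhs_dnbhs_neq.
have hP : 0 < h + Phi by near: h; move/cvgr_gt : shift; apply.
rewrite !psi_hatE// -/(psi (h + Phi)) -/(psi Phi) PhiE /k /FM laplace_M_neq//; last first.
  by rewrite -subr_eq0 addrK.
rewrite (max_r (ltW hP)) /GRing.scale/=.
have ps0 := lt_le_trans hP (psi_ge X_ind X_stat X_cadlag X_nnj X_0 X_mean (ltW hP)).
by apply: difference_quotient_field; rewrite ?h0 ?(gt_eqF ps0) ?(gt_eqF q0) ?(gt_eqF hP) ?(gt_eqF Phi0).
Unshelve. all: end_near. Qed.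

End laplace_M.

Unset Implicit Arguments.
Theorem theorem2 (R : realType) (d : measure_display) (T : measurableType d)
    (P : probability T R) (X : R -> {RV P >-> R})
    (X_spectrally_positive : spectrally_positive X)
    (X_mean0 : ('E_P[X 1%R] = 0)%E)
    (q : R) (q_gt0 : 0 < q) (e : {RV P >-> R})
    (e_exponential : exponentially_distributed e q)
    (e_indep : independent_of_process e X) :
  (forall x : R, 0 < x -> x <> Phi_hat X q ->
     laplace_M X e x =
       (right_derivative (psi_hat X) 0 * x / psi_hat X x
         * (Phi_hat X q / q)
         * ((q - psi_hat X x) / (Phi_hat X q - x)))%:E) /\
  laplace_M X e (Phi_hat X q) =
    (right_derivative (psi_hat X) 0 * Phi_hat X q ^+ 2
      * derive1 (psi_hat X) (Phi_hat X q) / q ^+ 2)%:E.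
Proof.
have [[X_0 X_cadlag X_ind X_stat] X_nnj _] := X_spectrally_positive.
have [Phi0 PhiE] := Phi_hat_spec X_ind X_stat X_cadlag X_nnj X_0 X_mean0 q_gt0.
rewrite right_derivative_psi//; split=> [x x0 /eqP xPhi|].
  have p0 := lt_le_trans x0 (psi_ge X_ind X_stat X_cadlag X_nnj X_0 X_mean0 (ltW x0)).
  rewrite (laplace_M_neq X_ind X_stat X_cadlag X_nnj X_0 X_mean0 q_gt0 e_exponential e_indep x0 xPhi).
  rewrite psi_hatE// -/(psi X x); congr _%:E.
  by field; rewrite (gt_eqF p0) (gt_eqF q_gt0) subr_eq0 eq_sym xPhi.
(* Finiteness of the transform at [Phi] lets the [fine] in [derive1_psi_Phi] be undone; the claim is
   then that lemma solved for [F]. *)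
have [F FE _] := laplace_M_limit X_cadlag X_nnj e_exponential Phi0.
rewrite (derive1_psi_Phi X_ind X_stat X_cadlag X_nnj X_0 X_mean0 q_gt0 e_exponential e_indep).
rewrite FE/=; congr _%:E.
by field; rewrite (gt_eqF Phi0) (gt_eqF q_gt0).
Qed.
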